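(* Let $V$ be a simple vertex operator algebra, $H\subseteq V$ a Heisenberg vertex operator subalgebra acting semisimply on $V$ with real zero-mode eigenvalues, $C=\mathrm{Com}(H,V)$, $\mathcal L$ the lattice of Heisenberg weights of $V$, and let $$V=\bigoplus_{\lambda\in\mathcal L}F_\lambda\otimes C_\lambda$$ be the decomposition of $V$ as an $H\otimes C$-module. If $\mathcal E$ is a sublattice of $\mathcal L$ such that $\bigoplus_{\lambda\in\mathcal E}F_\lambda$ forms a lattice vertex operator algebra, then $E=\bigoplus_{\lambda\in\mathcal E}C_\lambda$ has a natural vertex operator algebra structure.
   Context: The Heisenberg VOA $H$ of rank $r$ is attached to an $r$-dimensional abelian Lie algebra with non-degenerate symmetric bilinear form; $F_\lambda$ is its simple Fock module of highest weight $\lambda$. $\mathrm{Com}(H,V)$ is the commutant of $H$ in $V$, and $C=C_0$. $\mathcal L\subset\mathbb R^r$ is the set of simultaneous eigenvalues $\lambda$ of the Heisenberg zero modes on $V$; the $\lambda$-eigenspace is $V_\lambda=F_\lambda\otimes C_\lambda$ for a $C$-module $C_\lambda$. ''Natural'' means that the structure extends that of $C=C_0$, acts on each $C_\lambda$ through its given $C$-module structure, is compatible with the $\mathcal E$-grading, and is inherited from that of $V$. No vertex tensor category hypotheses are imposed. (The lattice $\mathcal E$ is not required to be positive definite, so ''vertex operator algebra'' is understood without a lower-boundedness requirement on conformal weights.) *)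

(* Defs.v *)
From HB Require Import structures.
From mathcomp Require Import all_boot all_order all_algebra.
From mathcomp Require Import boolp classical_sets reals.
From mathcomp Require Import complex.

Set Implicit Arguments.
Unset Strict Implicit.
Unset Printing Implicit Defensive.

Import Order.TTheory GRing.Theory Num.Theory.
Local Open Scope classical_set_scope.
Local Open Scope ring_scope.

Section Span.
Variables (K : numFieldType) (V : lmodType K).

Definition span (S : set V) : {pred V} := fun v =>
  `[< forall M : {pred V},
        submod_closed M -> (forall x, S x -> x \in M) -> v \in M >].

Lemma span_submod_closed (S : set V) : submod_closed (span S).
Proof.
split; first by apply/asboolP => M [].
move=> a x y /asboolP Mx /asboolP My; apply/asboolP => M cM SM.
by case: (cM) => _; apply; [exact: Mx | exact: My].
Qed.

HB.instance Definition _ (S : set V) :=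
  GRing.isSubmodClosed.Build K V (span S) (span_submod_closed S).

Record span_type (S : set V) := SpanType {
  span_val :> V;
  span_valP : span_val \in span S }.

HB.instance Definition _ (S : set V) := [isSub for @span_val S].
HB.instance Definition _ (S : set V) := [Choice of span_type S by <:].
HB.instance Definition _ (S : set V) :=
  [SubChoice_isSubLmodule of span_type S by <:].

End Span.

Section VertexOperatorAlgebra.
Variable K : numFieldType.

(* [mode a n b] is the n-th product a_n b, with Y(a, z) = sum_n a_n z^(-n-1).
   The axioms are the vacuum, translation and locality axioms for Y, together
   with a conformal vector [omega], L(n) = omega_(n+1), whose L(-1) is the
   translation operator and whose L(0) is diagonalizable with integer
   eigenvalues.  The conformal weight spaces need be neither bounded below nor
   finite dimensional: for a lattice vertex operator algebra V of nonzero rank,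
   with E the whole lattice, the algebra constructed on the multiplicity spaces
   is the group algebra of E, all of it in conformal weight 0.
   [voa_locality] is the coefficient of z^(-m-1) w^(-n-1) in
   (z - w)^N [Y(a, z), Y(b, w)] c = 0. *)
Record voa (V : lmodType K) := VOA {
  mode : V -> int -> V -> V;
  vac : V;
  omega : V;
  ccharge : K;
  voa_linearl : forall n b, linear (fun a => mode a n b);
  voa_linearr : forall a n, linear (mode a n);
  voa_trunc : forall a b, exists N : int, forall n, N <= n -> mode a n b = 0;
  voa_vacuum : forall n b, mode vac n b = if n == -1 then b else 0;
  voa_creation : forall a n, 0 <= n -> mode a n vac = 0;
  voa_create : forall a, mode a (-1) vac = a;
  voa_locality : forall a b, exists N : nat, forall (m n : int) c,
    \sum_(i < N.+1) ((-1) ^+ i * 'C(N, i)%:R) *: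
      (mode a (m + N%:Z - i%:Z) (mode b (n + i%:Z) c) -
       mode b (n + i%:Z) (mode a (m + N%:Z - i%:Z) c)) = 0;
  voa_translation : forall a n b,
    mode omega 0 (mode a n b) - mode a n (mode omega 0 b) =
      - n%:~R *: mode a (n - 1) b;
  voa_virasoro : forall (m n : int) v,
    mode omega (m + 1) (mode omega (n + 1) v) -
    mode omega (n + 1) (mode omega (m + 1) v) =
      (m - n)%:~R *: mode omega (m + n + 1) v +
      (if m + n == 0 then (((m ^+ 3 - m)%:~R / 12%:R) * ccharge) *: v else 0);
  voa_grading : forall v,
    v \in span [set w | exists n : int, mode omega 1 w = n%:~R *: w] }.

Variables (V : lmodType K) (Y : voa V).

Definition voa_ideal (I : {pred V}) : Prop :=
  submod_closed I /\
  forall a n x, x \in I -> mode Y a n x \in I /\ mode Y x n a \in I.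

Definition voa_simple : Prop :=
  vac Y <> 0 /\
  forall I : {pred V}, voa_ideal I ->
    (forall x, x \in I -> x = 0) \/ (forall x, x \in I).

Definition vertex_subalgebra (U : {pred V}) : Prop :=
  [/\ submod_closed U, vac Y \in U &
      forall a n b, a \in U -> b \in U -> mode Y a n b \in U].

Definition vertex_subalgebra_gen (S : set V) : set V :=
  [set a | forall U : {pred V},
     vertex_subalgebra U -> (forall x, S x -> x \in U) -> a \in U].

Definition commutant (U : set V) : set V :=
  [set v | forall a (n : int), U a -> 0 <= n -> mode Y a n v = 0].

End VertexOperatorAlgebra.

Section Heisenberg.
Variables (K : numFieldType) (V : lmodType K) (Y : voa V).
Variables (r : nat) (B : 'M[K]_r) (h : 'I_r -> V).

(* [h] is a basis of the abelian Lie algebra, with Gram matrix [B]. *)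
Definition sugawara : V :=
  2%:R^-1 *: \sum_i \sum_j invmx B i j *: mode Y (h i) (-1) (h j).

(* The vertex subalgebra generated by the fields of [h] is the Heisenberg
   algebra of rank r, with conformal vector [sugawara].  The last condition
   (each [h i] is primary of conformal weight 1) says that L(n), for n >= -1,
   restricts on it to the corresponding mode of [sugawara], as required for
   [omega Y - sugawara] to be the conformal vector of the commutant. *)
Definition heisenberg : Prop :=
  [/\ B^T = B,
      B \in unitmx,
      forall i j (n : nat),
        mode Y (h i) n%:Z (h j) = (if n == 1%N then B i j *: vac Y else 0) &
      forall i (n : nat),
        mode Y (omega Y) (n%:Z + 1) (h i) = (if n == 0%N then h i else 0)].

Definition heis_sub : set V := vertex_subalgebra_gen Y (range h).

Definition heis_submodule (M : {pred V}) : Prop :=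
  submod_closed M /\ forall i n x, x \in M -> mode Y (h i) n x \in M.

Definition heis_gen (v : V) : set V :=
  [set x | forall M : {pred V}, heis_submodule M -> v \in M -> x \in M].

End Heisenberg.

(* [fock_tensor u e f x] states that x is the element of V written f (x) u,
   where e is the highest-weight vector of a Fock module F inside W and u is a
   highest-weight vector of the same weight in V: (f, x) lies on the graph of
   the homomorphism of Heisenberg modules F -> V sending e to u, i.e. in the
   submodule of W (+) V generated by (e, u). *)
Inductive fock_tensor (K : numFieldType) (W V : lmodType K)
    (YW : voa W) (Y : voa V) (r : nat) (hW : 'I_r -> W) (h : 'I_r -> V)
    (u : V) (e : W) : W -> V -> Prop :=
| FockTop : fock_tensor YW Y hW h u e e u
| FockMode i n f x of fock_tensor YW Y hW h u e f x :
    fock_tensor YW Y hW h u e (mode YW (hW i) n f) (mode Y (h i) n x)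
| FockLinear (a : K) f x g y of fock_tensor YW Y hW h u e f x &
    fock_tensor YW Y hW h u e g y :
    fock_tensor YW Y hW h u e (a *: f + g) (a *: x + y).

(* [exp_coef x k] is the coefficient of z^k in exp (sum_(n >= 1) x_n z^n / n),
   and [pow_coef x m k] that in the m-th power of the exponent. *)
Fixpoint pow_coef (K : numFieldType) (V : lmodType K)
    (x : nat -> V -> V) (m k : nat) (v : V) : V :=
  if m is m'.+1 then
    \sum_(j < k) j.+1%:R^-1 *: x j.+1 (pow_coef x m' (k - j.+1) v)
  else if k == 0%N then v else 0.

Definition exp_coef (K : numFieldType) (V : lmodType K)
    (x : nat -> V -> V) (k : nat) (v : V) : V :=
  \sum_(m < k.+1) m`!%:R^-1 *: pow_coef x m k v.

Section Weights.
Variables (R : realType) (r : nat) (B : 'M[R[i]]_r).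

(* Coordinates in the basis [h] of the element of the Lie algebra that
   corresponds to the weight [l] under the form: its pairing with the j-th basis
   element is [l 0 j]. *)
Definition wt_dual (l : 'rV[R]_r) (i : 'I_r) : R[i] :=
  \sum_j (l 0 j)%:C%C * invmx B j i.

Definition wt_form (l m : 'rV[R]_r) : R[i] :=
  \sum_i wt_dual l i * (m 0 i)%:C%C.

Variables (V : lmodType R[i]) (Y : voa V) (h : 'I_r -> V).

Definition wt_mode (l : 'rV[R]_r) (n : int) (v : V) : V :=
  \sum_i wt_dual l i *: mode Y (h i) n v.

Definition wt_space (l : 'rV[R]_r) : set V :=
  [set v | forall i, mode Y (h i) 0 v = (l 0 i)%:C%C *: v].

Definition heis_weights : set 'rV[R]_r :=
  [set l | exists2 v, v <> 0 & wt_space l v].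

(* The multiplicity space C_l = Hom_H (F_l, V), a homomorphism being identified
   with the image of the highest-weight vector of F_l. *)
Definition mult_space (l : 'rV[R]_r) : set V :=
  [set v | wt_space l v /\ forall i (n : nat), mode Y (h i) n.+1%:Z v = 0].

(* A highest-weight module over the Heisenberg algebra is a simple Fock module
   as soon as it is nonzero, the form being nondegenerate. *)
Definition fock_submodule (l : 'rV[R]_r) (M : set V) : Prop :=
  exists v, [/\ v <> 0, mult_space l v & M = heis_gen Y h v].

(* V is the sum of its Fock submodules of real highest weight, i.e.
   V = (+)_l F_l (x) C_l. *)
Definition heis_semisimple : Prop :=
  forall v, v \in span [set w | exists l M, fock_submodule l M /\ M w].

(* (+)_(l in E) C_l, formed inside V: the sum is direct since the C_l lie in
   distinct simultaneous eigenspaces of the zero modes. *)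
Definition mult_sum (E : {pred 'rV[R]_r}) : lmodType R[i] :=
  span_type (\bigcup_(l in [set` E]) mult_space l).

End Weights.

(* V is the lattice vertex operator algebra of the even lattice E, with
   underlying Heisenberg module (+)_(l in E) F_l: [e l] is the highest-weight
   vector e^l of F_l, [eps] the 2-cocycle, and the vertex operators are
     Y(e^l, z) = exp (sum_(n >= 1) l(-n) z^n / n)
                 exp (- sum_(n >= 1) l(n) z^(-n) / n) T_l z^(l(0)),
   T_l being the shift operator; on F_m, z^(l(0)) is z^k with k = (l, m). *)
Record lattice_voa (R : realType) (r : nat) (B : 'M[R[i]]_r)
    (E : {pred 'rV[R]_r}) (V : lmodType R[i]) (Y : voa V) (h : 'I_r -> V)
    (e : 'rV[R]_r -> V) (eps : 'rV[R]_r -> 'rV[R]_r -> R[i]) : Prop :=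
  LatticeVOA {
  lat_zmod : zmod_closed E;
  lat_even : {in E, forall l, exists k : int, wt_form B l l = (2 * k)%:~R};
  lat_eps_neq0 : {in E &, forall l m, eps l m != 0};
  lat_eps_unit : {in E, forall l, eps 0 l = 1 /\ eps l 0 = 1};
  lat_eps_cocycle : {in E & &, forall l m n,
    eps l m * eps (l + m) n = eps m n * eps l (m + n)};
  lat_eps_comm : {in E &, forall l m (k : int), wt_form B l m = k%:~R ->
    eps l m = (-1) ^+ `|k|%N * eps m l};
  lat_heis : heisenberg Y B h;
  lat_omega : omega Y = sugawara Y B h;
  lat_vac : e 0 = vac Y;
  lat_hw : {in E, forall l, e l <> 0 /\ mult_space Y h l (e l)};
  lat_sum : forall v, v \in span (\bigcup_(l in [set` E]) heis_gen Y h (e l));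
  lat_vertex : {in E, forall l, exists T : {linear V -> V},
    [/\ {in E, forall m, T (e m) = eps l m *: e (l + m)},
        forall i (n : int) v, n != 0 ->
          T (mode Y (h i) n v) = mode Y (h i) n (T v) &
        {in E, forall m (k n : int) w,
          wt_form B l m = k%:~R -> heis_gen Y h (e m) w ->
          exists N0 : nat, forall N : nat, (N0 <= N)%N ->
            mode Y (e l) n w =
            \sum_(j < N | 0 <= j%:Z - n - 1 - k)
              exp_coef (fun p => wt_mode B Y h l (- p%:Z))
                `|(j%:Z - n - 1 - k)%R|%N
                (T (exp_coef (fun p v => - wt_mode B Y h l p%:Z v) j w))}]}
}.

(* The vertex operator algebra structure YE on (+)_(l in E) C_l is natural,
   relative to the lattice vertex operator algebra YA on (+)_(l in E) F_l: it
   has the vacuum and the conformal vector of C = Com(H, V), the action of C on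
   it (in particular on C itself and on each C_l) is the given one, it is graded
   by E, and the vertex operators of V restricted to
   (+)_(l in E) F_l (x) C_l are the tensor products of those of YA and YE, i.e.
   (f (x) u)_n (g (x) v) = sum_j f_(n-1-j) g (x) u_j v. *)
Record natural_voa (R : realType) (r : nat) (B : 'M[R[i]]_r)
    (V : lmodType R[i]) (Y : voa V) (h : 'I_r -> V) (E : {pred 'rV[R]_r})
    (A : lmodType R[i]) (YA : voa A) (hA : 'I_r -> A) (e : 'rV[R]_r -> A)
    (YE : voa (mult_sum Y h E)) : Prop := NaturalVOA {
  nat_vac : val (vac YE) = vac Y;
  nat_omega : val (omega YE) = omega Y - sugawara Y B h;
  nat_coset : forall c, commutant Y (heis_sub Y h) c ->
    exists2 c' : mult_sum Y h E, val c' = c &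
      forall n x, val (mode YE c' n x) = mode Y c n (val x);
  nat_graded : {in E &, forall l m (u v : mult_sum Y h E) n,
    mult_space Y h l (val u) -> mult_space Y h m (val v) ->
    mult_space Y h (l + m) (val (mode YE u n v))};
  nat_inherited : {in E &, forall l m (u v : mult_sum Y h E) f x g y n,
    mult_space Y h l (val u) -> mult_space Y h m (val v) ->
    fock_tensor YA Y hA h (val u) (e l) f x ->
    fock_tensor YA Y hA h (val v) (e m) g y ->
    exists z : int -> V,
      (forall j, fock_tensor YA Y hA h (val (mode YE u j v)) (e (l + m))
                   (mode YA f (n - 1 - j) g) (z j)) /\
      exists N0 : nat, forall N : nat, (N0 <= N)%N ->
        mode Y x n y = \sum_(j < N.*2.+1) z (j%:Z - N%:Z)}
}.

(* Main.v *)
(* For u in C_l and v in C_m, the n-th mode of u sends v into the weight space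
   l + m of V.  Let P be the projection of that space onto its highest-weight
   vectors along the images of the negative Heisenberg modes.  Since [Y(e^l, z)
   e^m] has leading term [eps l m *: e (l + m)] at z^k, k = (l, m), the formula
   Y_V = Y_A (x) Y_E forces u_n^E v = eps(l, m)^-1 P (u_(n-k) v), and this is taken
   as the definition.  Conversely u_n v = sum_j S_j(l) P (u_(n+j) v), where S_j(l)
   are the coefficients of exp (sum_n l(-n) z^n / n), because both sides have the
   same image under P and under the positive modes.  Hence
     P Y(u, z) Y(v, w) x = (1 - w/z)^k P Y(u, z) P Y(v, w) x,
   so locality on V gives locality on E, the sign (-1)^k from exchanging z and w
   being that of the commutator of eps.  The conformal vector is omega minus the
   Sugawara vector, and the tensor product formula extends from e^l (x) u and
   e^m (x) v to all of F_l (x) u and F_m (x) v by the commutator formula and the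
   formula for the modes of h(-n) x. *)
Require Import Defs.
From HB Require Import structures.
From mathcomp Require Import all_boot all_order all_algebra.
From mathcomp Require Import boolp classical_sets functions reals.
From mathcomp Require Import complex.
From mathcomp Require Import ssrAC zify ring.

Set Implicit Arguments.
Unset Strict Implicit.
Unset Printing Implicit Defensive.

Import Order.TTheory GRing.Theory Num.Theory.
Local Open Scope classical_set_scope.
Local Open Scope ring_scope.

Local Notation span := Defs.span.

(** For two arbitrary fields the axioms give only locality, so the commutator formula and the
    formula for the modes of a product have to be derived from it. Series are kept as functions of
    their integer indices, with multiplication by z - w as a difference operator; the commutator
    formula then becomes Newton interpolation. The projection P is cut out by operators at hand: the
    zero modes and the Sugawara L(0) are simultaneously diagonalizable, and P selects the lowest
    Sugawara degree of a weight space. The same construction serves the lattice algebra, whose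
    vertex operators enter only through the leading terms of e^l_n e^m. The shift (l, m) and the
    scalar eps(l, m) depend on the weights, while a vector of the sum has components of several
    weights; hence modes are defined on homogeneous vectors and then glued bilinearly. The pairing
    may be negative, so that (1 - w/z)^k is an infinite series. Every sum is finite by truncation
    only, and much of the work consists in making the truncation bounds uniform. *)

Section SpanTheory.
Variables (K : numFieldType) (V : lmodType K).

Lemma mem_span (S : set V) x : S x -> x \in span S.
Proof. by move=> Sx; apply/asboolP => M _; apply. Qed.

Lemma span_ind (S : set V) (Q : V -> Prop) :
  Q 0 -> (forall a x y, Q x -> Q y -> Q (a *: x + y)) ->
  (forall x, S x -> Q x) -> forall v, v \in span S -> Q v.
Proof.
move=> Q0 QD QS v /asboolP/(_ (fun x => `[< Q x >])) H; apply/asboolP/H.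
- split; first exact/asboolP.
  by move=> a x y /asboolP Qx /asboolP Qy; apply/asboolP/QD.
- by move=> x /QS Qx; apply/asboolP.
Qed.

End SpanTheory.

(** * Sums of finitely supported families *)

Section FiniteSum.
Variable V : zmodType.
Implicit Type f : nat -> V.

Definition vanish_from (N : nat) f := forall i, (N <= i)%N -> f i = 0.
Definition summable f := exists N, vanish_from N f.
(** The bound is selected by choice, with default 0, so that the sum is a total function of the
    family; [fsumE] shows that every valid bound gives the same value. *)
Definition fsum f : V := \sum_(i < xget 0%N [set N | vanish_from N f]) f i.

Lemma sum_ord_widen f N M : vanish_from N f -> (N <= M)%N ->
  \sum_(i < M) f i = \sum_(i < N) f i.
Proof.
move=> f0 NM; rewrite (big_ord_widen_cond M xpredT f NM).
rewrite (bigID (fun i : 'I_M => (i < N)%N)) /= [X in _ + X]big1 ?addr0 //.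
by move=> i; rewrite -leqNgt => /f0.
Qed.

Lemma fsumE f N : vanish_from N f -> fsum f = \sum_(i < N) f i.
Proof.
move=> fN; rewrite /fsum; set M := xget _ _.
have fM : vanish_from M f by apply: (@xgetPex _ 0%N [set N | vanish_from N f]); exists N.
case: (leqP N M) => [NM|/ltnW MN]; first by rewrite (sum_ord_widen fN NM).
by rewrite (sum_ord_widen fM MN).
Qed.

Lemma fsum_recl f : summable f -> fsum f = f 0%N + fsum (fun i => f i.+1).
Proof.
case=> N fN.
rewrite (@fsumE f N.+1) ?big_ord_recl; last by move=> i /ltnW/fN.
by rewrite (@fsumE _ N) // => i Ni; apply: fN; apply: leqW.
Qed.

Lemma vanish_fromW f N M : (N <= M)%N -> vanish_from N f -> vanish_from M f.
Proof. by move=> NM fN i Mi; apply: fN; apply: leq_trans Mi. Qed.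

Lemma summableB f g : summable f -> summable g -> summable (fun i => f i - g i).
Proof.
move=> [N fN] [M gM]; exists (maxn N M) => i; rewrite geq_max => /andP[Ni Mi].
by rewrite fN ?gM ?subr0.
Qed.

Lemma fsumB f g : summable f -> summable g ->
  fsum (fun i => f i - g i) = fsum f - fsum g.
Proof.
move=> [N fN] [M gM].
have fL := vanish_fromW (leq_maxl N M) fN; have gL := vanish_fromW (leq_maxr N M) gM.
rewrite (fsumE fL) (fsumE gL) -sumrB; apply: fsumE => i Li.
by rewrite fL ?gL ?subr0.
Qed.

End FiniteSum.

Lemma fsum_morph (U V : zmodType) (L : {additive U -> V}) (f : nat -> U) :
  summable f -> fsum (fun i => L (f i)) = L (fsum f).
Proof.
move=> [N fN]; rewrite (fsumE fN) raddf_sum; apply: fsumE => i Ni.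
by rewrite fN ?raddf0.
Qed.

Lemma iter_morphB (M : zmodType) (S : M -> M) n :
  {morph S : x y / x - y} -> {morph iter n S : x y / x - y}.
Proof. by move=> SB x y; elim: n => //= n ->; rewrite SB. Qed.

Lemma iter_morph0 (M : zmodType) (S : M -> M) n :
  {morph S : x y / x - y} -> iter n S 0 = 0.
Proof. by move=> SB; have := iter_morphB n SB 0 0; rewrite !subrr. Qed.

Lemma iter_comm (T : Type) (P Q : T -> T) m n x :
  (forall x, P (Q x) = Q (P x)) -> iter m P (iter n Q x) = iter n Q (iter m P x).
Proof.
move=> PQ; elim: m => //= m ->; elim: n => //= n IH.
by rewrite -IH PQ.
Qed.

(** Each term of the binomial expansion of (Q - P)^(i + j) contains P^i or Q^j. Since P and Q are
    bare additive functions, the expansion is replaced by an induction on i + j that peels off one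
    factor. *)
Lemma iter_sub_killed (M : zmodType) (P Q R : M -> M) :
  {morph P : x y / x - y} -> {morph Q : x y / x - y} ->
  {morph R : x y / x - y} ->
  (forall x, P (Q x) = Q (P x)) -> (forall x, R x = Q x - P x) ->
  forall i j x, iter i P x = 0 -> iter j Q x = 0 -> iter (i + j) R x = 0.
Proof.
move=> PB QB RB PQ RE i j x.
move: {2}(i + j)%N (erefl (i + j)%N) => n.
elim: n i j x => [|n IH] i j x.
  by move/eqP; rewrite addn_eq0 => /andP[/eqP-> /eqP->].
case: i => [|i]; first by move=> _ /= -> _; rewrite iter_morph0.
case: j => [|j]; first by move=> _ _ /= ->; exact: (iter_morph0 (i.+1 + 0) RB).
rewrite addSn => -[def_n]; rewrite !iterSr => Px Qx.
rewrite RE (iter_morphB _ RB).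
have -> : iter (i + j.+1) R (P x) = 0.
  apply: (IH i j.+1) => //.
  rewrite -[P x]/(iter 1 P x) (@iter_comm _ Q P) => [|y]; last by rewrite PQ.
  by rewrite [iter j.+1 Q x]iterSr Qx (iter_morph0 1 PB).
rewrite subr0 -addSnnS; apply: IH => //; first by rewrite addSnnS.
by rewrite -[Q x]/(iter 1 Q x) (@iter_comm _ P Q) // [iter i.+1 P x]iterSr Px (iter_morph0 1 QB).
Qed.

(** * Locality and products of fields *)

Section FormalDifference.
Variable V : zmodType.
Implicit Types (f : int -> int -> V) (W : int -> int -> int -> V).

(* A function of [m] and [n] stands for the series of its values times
   z^(-m-1) w^(-n-1); [zw] is then the multiplication by z - w. *)
Definition zw f m n := f (m + 1) n - f m (n + 1).

Definition zw12 W m n p := W (m + 1) n p - W m (n + 1) p.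
Definition zw13 W m n p := W (m + 1) n p - W m n (p + 1).
Definition zw23 W m n p := W m (n + 1) p - W m n (p + 1).

(* The expansions of 1 / (z - w) in |z| > |w| and of 1 / (w - z) in |w| > |z| *)
Definition zw_invl f (m n : int) :=
  fsum (fun i : nat => f (m - 1 - i%:Z) (n + i%:Z)).
Definition zw_invr f (m n : int) :=
  fsum (fun i : nat => f (m + i%:Z) (n - 1 - i%:Z)).

Definition summablel f := forall m n : int,
  summable (fun i : nat => f (m - 1 - i%:Z) (n + i%:Z)).
Definition summabler f := forall m n : int,
  summable (fun i : nat => f (m + i%:Z) (n - 1 - i%:Z)).

Lemma zw_invlK f : summablel f -> zw (zw_invl f) = f.
Proof.
move=> sf; apply/funext => m; apply/funext => n; rewrite /zw {1}/zw_invl.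
rewrite fsum_recl; last exact: sf.
have -> : f (m + 1 - 1 - 0%:Z) (n + 0%:Z) = f m n by congr f; lia.
rewrite -addrA [X in _ + X](_ : _ = 0) ?addr0 //; apply/eqP; rewrite subr_eq0.
apply/eqP; rewrite /zw_invl; congr fsum; apply/funext => i.
by congr f; lia.
Qed.

Lemma zw_invrK f : summabler f -> zw (zw_invr f) = - f.
Proof.
move=> sf; apply/funext => m; apply/funext => n; rewrite /zw {2}/zw_invr.
rewrite fsum_recl; last exact: sf.
have -> : f (m + 0%:Z) (n + 1 - 1 - 0%:Z) = f m n by congr f; lia.
rewrite opprD addrCA [X in _ + X](_ : _ = 0) ?addr0 //; apply/eqP; rewrite subr_eq0.
apply/eqP; rewrite /zw_invr; congr fsum; apply/funext => i.
by congr f; lia.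
Qed.

Lemma zwB f g : zw (f - g) = zw f - zw g.
Proof.
by apply/funext => m; apply/funext => n; rewrite /zw !fctE !opprD addrACA.
Qed.

Lemma zw12B : {morph zw12 : W W' / W - W'}.
Proof.
move=> W W'; apply/funext => m; apply/funext => n; apply/funext => p.
by rewrite /zw12 !fctE !opprD addrACA.
Qed.

Lemma zw13B : {morph zw13 : W W' / W - W'}.
Proof.
move=> W W'; apply/funext => m; apply/funext => n; apply/funext => p.
by rewrite /zw13 !fctE !opprD addrACA.
Qed.

Lemma zw23B : {morph zw23 : W W' / W - W'}.
Proof.
move=> W W'; apply/funext => m; apply/funext => n; apply/funext => p.
by rewrite /zw23 !fctE !opprD addrACA.
Qed.

End FormalDifference.

Section IteratedDifference.
Variable V : zmodType.
Implicit Types (f : int -> int -> V) (W : int -> int -> int -> V).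

Lemma iter_zw23 W N m : (iter N (@zw23 V) W) m = iter N (@zw V) (W m).
Proof. by elim: N => //= N IH; rewrite -IH. Qed.

Lemma iter_zw13 W N n :
  (fun m p => iter N (@zw13 V) W m n p) = iter N (@zw V) (fun m p => W m n p).
Proof. by elim: N => //= N IH; rewrite -IH. Qed.

Lemma iter_zw12 W N p :
  (fun m n => iter N (@zw12 V) W m n p) = iter N (@zw V) (fun m n => W m n p).
Proof. by elim: N => //= N IH; rewrite -IH. Qed.

(** This relation between the three differences lets Dong's lemma trade powers of the first two for
    a power of the third. *)
Lemma zw23E W : zw23 W = zw13 W - zw12 W.
Proof.
apply/funext => m; apply/funext => n; apply/funext => p.
by rewrite !fctE /zw23 /zw13 /zw12 opprB [RHS]addrC subrKA.
Qed.

Lemma zw12_13C W : zw12 (zw13 W) = zw13 (zw12 W).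
Proof.
apply/funext => m; apply/funext => n; apply/funext => p.
by rewrite /zw12 /zw13 !opprD addrACA.
Qed.

Lemma zw12_23C W : zw12 (zw23 W) = zw23 (zw12 W).
Proof. by rewrite !zw23E zw12B zw12_13C. Qed.

Lemma zw13_23C W : zw13 (zw23 W) = zw23 (zw13 W).
Proof. by rewrite !zw23E zw13B zw12_13C. Qed.

Definition zw_invl3 W m n p := zw_invl (fun m n => W m n p) m n.
Definition zw_invr3 W m n p := zw_invr (fun m n => W m n p) m n.
Definition summablel3 W := forall p, summablel (fun m n => W m n p).
Definition summabler3 W := forall p, summabler (fun m n => W m n p).

Lemma summablel_zw13 W : summablel3 W -> summablel3 (zw13 W).
Proof.
move=> sW p m n; have := summableB (sW p (m + 1) n) (sW (p + 1) m n).
by congr summable; apply/funext => i; rewrite /zw13; congr (W _ _ _ - _); lia.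
Qed.

Lemma zw13_invl W : summablel3 W -> zw13 (zw_invl3 W) = zw_invl3 (zw13 W).
Proof.
move=> sW; apply/funext => m; apply/funext => n; apply/funext => p.
rewrite /zw13 /zw_invl3 /zw_invl -fsumB //; try exact: sW.
by congr fsum; apply/funext => i; congr (W _ _ _ - _); lia.
Qed.

Lemma summablel_zw23 W : summablel3 W -> summablel3 (zw23 W).
Proof.
move=> sW p m n; have := summableB (sW p m (n + 1)) (sW (p + 1) m n).
by congr summable; apply/funext => i; rewrite /zw23; congr (W _ _ _ - _); lia.
Qed.

Lemma zw23_invl W : summablel3 W -> zw23 (zw_invl3 W) = zw_invl3 (zw23 W).
Proof.
move=> sW; apply/funext => m; apply/funext => n; apply/funext => p.
rewrite /zw23 /zw_invl3 /zw_invl -fsumB //; try exact: sW.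
by congr fsum; apply/funext => i; congr (W _ _ _ - _); lia.
Qed.

Lemma summabler_zw13 W : summabler3 W -> summabler3 (zw13 W).
Proof.
move=> sW p m n; have := summableB (sW p (m + 1) n) (sW (p + 1) m n).
by congr summable; apply/funext => i; rewrite /zw13; congr (W _ _ _ - _); lia.
Qed.

Lemma zw13_invr W : summabler3 W -> zw13 (zw_invr3 W) = zw_invr3 (zw13 W).
Proof.
move=> sW; apply/funext => m; apply/funext => n; apply/funext => p.
rewrite /zw13 /zw_invr3 /zw_invr -fsumB //; try exact: sW.
by congr fsum; apply/funext => i; congr (W _ _ _ - _); lia.
Qed.

Lemma summabler_zw23 W : summabler3 W -> summabler3 (zw23 W).
Proof.
move=> sW p m n; have := summableB (sW p m (n + 1)) (sW (p + 1) m n).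
by congr summable; apply/funext => i; rewrite /zw23; congr (W _ _ _ - _); lia.
Qed.

Lemma zw23_invr W : summabler3 W -> zw23 (zw_invr3 W) = zw_invr3 (zw23 W).
Proof.
move=> sW; apply/funext => m; apply/funext => n; apply/funext => p.
rewrite /zw23 /zw_invr3 /zw_invr -fsumB //; try exact: sW.
by congr fsum; apply/funext => i; congr (W _ _ _ - _); lia.
Qed.

(** Dividing by the difference of the first two variables commutes with multiplying by the other
    differences, so locality with a third field can be applied to the undivided product. *)
Lemma iter_zw_invl W N M : summablel3 W ->
  iter N (@zw13 V) (iter M (@zw23 V) (zw_invl3 W)) =
  zw_invl3 (iter N (@zw13 V) (iter M (@zw23 V) W)).
Proof.
move=> sW; have [s23 e23] : summablel3 (iter M (@zw23 V) W) /\
    iter M (@zw23 V) (zw_invl3 W) = zw_invl3 (iter M (@zw23 V) W).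
  by elim: M => //= M [sM ->]; split; [exact: summablel_zw23 | exact: zw23_invl].
rewrite e23; have [//] : summablel3 (iter N (@zw13 V) (iter M (@zw23 V) W)) /\
    iter N (@zw13 V) (zw_invl3 (iter M (@zw23 V) W)) =
    zw_invl3 (iter N (@zw13 V) (iter M (@zw23 V) W)).
by elim: N => //= N [sN ->]; split; [exact: summablel_zw13 | exact: zw13_invl].
Qed.

Lemma iter_zw_invr W N M : summabler3 W ->
  iter N (@zw13 V) (iter M (@zw23 V) (zw_invr3 W)) =
  zw_invr3 (iter N (@zw13 V) (iter M (@zw23 V) W)).
Proof.
move=> sW; have [s23 e23] : summabler3 (iter M (@zw23 V) W) /\
    iter M (@zw23 V) (zw_invr3 W) = zw_invr3 (iter M (@zw23 V) W).
  by elim: M => //= M [sM ->]; split; [exact: summabler_zw23 | exact: zw23_invr].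
rewrite e23; have [//] : summabler3 (iter N (@zw13 V) (iter M (@zw23 V) W)) /\
    iter N (@zw13 V) (zw_invr3 (iter M (@zw23 V) W)) =
    zw_invr3 (iter N (@zw13 V) (iter M (@zw23 V) W)).
by elim: N => //= N [sN ->]; split; [exact: summabler_zw13 | exact: zw13_invr].
Qed.

Lemma zw_invl3_0 : zw_invl3 (0 : int -> int -> int -> V) = 0.
Proof.
apply/funext => m; apply/funext => n; apply/funext => p.
by rewrite /zw_invl3 /zw_invl (@fsumE _ _ 0%N) ?big_ord0.
Qed.

Lemma zw_invr3_0 : zw_invr3 (0 : int -> int -> int -> V) = 0.
Proof.
apply/funext => m; apply/funext => n; apply/funext => p.
by rewrite /zw_invr3 /zw_invr (@fsumE _ _ 0%N) ?big_ord0.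
Qed.

End IteratedDifference.

(** * Locality as a difference equation, and uniqueness of fields *)

Section VertexAlgebra.
Variables (K : numFieldType) (V : lmodType K) (Y : voa V).
Implicit Types (a b c x y : V) (m n p : int).

Local Notation "a @[ n ] b" := (mode Y a n b)
  (at level 9, n at level 99, b at level 9, format "a @[ n ]  b").
Local Notation T := (mode Y (omega Y) 0).

HB.instance Definition _ a n :=
  GRing.isLinear.Build K V V *:%R (mode Y a n) (voa_linearr Y a n).

Definition model n b a := a @[n] b.
HB.instance Definition _ n b :=
  GRing.isLinear.Build K V V *:%R (model n b) (voa_linearl Y n b).

Lemma modeDl a b n c : (a + b) @[n] c = a @[n] c + b @[n] c.
Proof. exact: (linearD (model n c)). Qed.
Lemma modeBl a b n c : (a - b) @[n] c = a @[n] c - b @[n] c.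
Proof. exact: (linearB (model n c)). Qed.
Lemma modeZl k a n c : (k *: a) @[n] c = k *: a @[n] c.
Proof. exact: (linearZ_LR (model n c)). Qed.
Lemma mode0l n c : 0 @[n] c = 0.
Proof. exact: (linear0 (model n c)). Qed.
Lemma mode_suml I (r : seq I) (P : pred I) (F : I -> V) n c :
  (\sum_(i <- r | P i) F i) @[n] c = \sum_(i <- r | P i) (F i) @[n] c.
Proof. exact: (linear_sum (model n c)). Qed.

(** The binomial expansion of (z - w)^N, which identifies the sum in [voa_locality] with an iterate
    of [zw]. *)
Lemma zw_iterE (f : int -> int -> V) N m n : iter N (@zw V) f m n =
  \sum_(i < N.+1) ((-1) ^+ i * 'C(N, i)%:R) *: f (m + N%:Z - i%:Z) (n + i%:Z).
Proof.
elim: N m n => [|N IH] m n.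
  by rewrite big_ord1 /= mulr1 scale1r; congr f; lia.
rewrite iterS /zw !IH big_ord_recl [in RHS]big_ord_recl /=.
rewrite !bin0 -!addrA; congr (_ *: f _ _ + _); try lia.
rewrite [in X in _ - X]big_ord_recr [in RHS]big_ord_recr /=.
rewrite opprD. rewrite [LHS]addrA -sumrB; congr (_ + _).
  apply: eq_bigr => i _; rewrite /bump /= !add1n.
  have -> : m + (1 + N%:Z) - i.+1%:Z = m + N%:Z - i%:Z by lia.
  have -> : n + 1 + i%:Z = n + i.+1%:Z by lia.
  by rewrite -scalerBl binS natrD mulrDr exprS; congr (_ *: _); ring.
rewrite /bump /= !add1n exprS binn -scaleNr !mulr1 mulN1r.
by rewrite binn mulr1; congr (_ *: f _ _); lia.
Qed.

Lemma mode_comm_zw a b : exists N, forall c,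
  iter N (@zw V) (fun m n => a @[m] (b @[n] c) - b @[n] (a @[m] c)) = 0.
Proof.
have [N HN] := voa_locality Y a b; exists N => c.
by apply/funext => m; apply/funext => n; rewrite zw_iterE HN.
Qed.

Lemma transl_vac : T (vac Y) = 0.
Proof. exact: voa_creation. Qed.

Lemma iter_zw0 N : iter N (@zw V) 0 = 0.
Proof. by apply: iter_morph0; exact: zwB. Qed.

Lemma mode_truncN a b : exists N : nat, forall n, N%:Z <= n -> a @[n] b = 0.
Proof.
by have [N HN] := voa_trunc Y a b; exists `|N|%N => n Nn; apply: HN; lia.
Qed.

(* Goddard's uniqueness theorem: by locality with the field of y, agreement on
   the vacuum propagates to y = y_(-1) vac. *)
Lemma goddard (f : int -> V -> V) s :
  (forall n, f n 0 = 0) ->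
  (forall n x, T (f n x) - f n (T x) = - n%:~R *: f (n - 1) x) ->
  (forall n, 0 <= n -> f n (vac Y) = 0) -> f (-1) (vac Y) = s ->
  (forall y, exists N, iter N (@zw V) (fun m n =>
     f m (y @[n] (vac Y)) - y @[n] (f m (vac Y))) = 0) ->
  forall n x, f n x = s @[n] x.
Proof.
move=> f0 fT fc fs floc.
(* On the vacuum, [f] and the field of [s] obey the same recursion under [T] starting at index -1;
   the factor n + 1 in it is invertible. *)
have fvac n : f n (vac Y) = s @[n] (vac Y).
  case: n => [n|n]; first by rewrite fc ?voa_creation.
  elim: n => [|n IH]; first by rewrite (_ : Negz 0 = -1) // fs voa_create.
  have nz : (n.+1%:R : K) != 0 by rewrite pnatr_eq0.
  have := fT (Negz n) (vac Y); have := voa_translation Y s (Negz n) (vac Y).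
  rewrite transl_vac f0 linear0 !subr0 IH => ->.
  rewrite NegzE mulrNz opprK => /(scalerI nz).
  by have -> : - n.+1%:Z - 1 = Negz n.+1 by lia.
move=> n x; have [N1 H1] := floc x; have [N2 H2] := mode_comm_zw s x.
pose g m p := f m (x @[p] (vac Y)) - s @[m] (x @[p] (vac Y)).
have g0 : iter (N1 + N2) (@zw V) g = 0.
  have -> : g = (fun m p => f m (x @[p] (vac Y)) - x @[p] (f m (vac Y))) -
     (fun m p => s @[m] (x @[p] (vac Y)) - x @[p] (s @[m] (vac Y))).
    apply/funext => m; apply/funext => p; rewrite !fctE fvac /g.
    by rewrite opprB subrKA.
  rewrite (iter_morphB _ (@zwB V)) addnC iterD H1 iter_zw0 addnC iterD H2.
  by rewrite iter_zw0 subrr.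
have gp m p : 0 <= p -> g m p = 0.
  by move=> p0; rewrite /g voa_creation // f0 linear0 subrr.
(* At second index -1, all terms but the first have a nonnegative second index and vanish by [gp];
   the first is g n (-1), where x_(-1) vac = x. *)
have := congr1 (fun h => h (n - (N1 + N2)%:Z) (-1)) g0.
rewrite zw_iterE big_ord_recl big1 => [|i _]; last first.
  by rewrite gp ?scaler0 // lift0; lia.
rewrite expr0 bin0 mulr1 scale1r addr0 /= => /eqP.
have -> : n - (N1 + N2)%:Z + (N1 + N2)%:Z - 0 = n by lia.
by rewrite /g voa_create subr_eq0 => /eqP.
Qed.
End VertexAlgebra.

(** * Compatibility of division by z - w with d/dz + d/dw *)

Section Derivation.
Variables (K : numFieldType) (V : lmodType K).
Implicit Types f : int -> int -> V.

(* The action of d/dz + d/dw, which commutes with z - w. *)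
Definition der f (m n : int) :=
  - m%:~R *: f (m - 1) n + - n%:~R *: f m (n - 1).

Lemma zw_der f : zw (der f) = der (zw f).
Proof.
apply/funext => m; apply/funext => n; rewrite /zw /der.
rewrite !addrK ?subrK !intrD !opprD !scalerDl !scalerBr !scaleNr !opprK !scale1r.
by rewrite opprD !opprK [LHS](AC (3*(1*2)) (1*4*3*5*(2*6)))/= addNr addr0 [RHS]addrA.
Qed.

Lemma der_invl f : summablel f -> zw_invl (der f) = der (zw_invl f).
Proof.
move=> sf; apply/funext => m; apply/funext => n.
have [N1 H1] := sf (m - 1) n; have [N2 H2] := sf m (n - 1).
pose N := maxn N1 N2.
have vA : vanish_from N (fun i : nat => f (m - 1 - 1 - i%:Z) (n + i%:Z)).
  exact: vanish_fromW (leq_maxl _ _) H1.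
have vB : vanish_from N (fun i : nat => f (m - 1 - i%:Z) (n - 1 + i%:Z)).
  exact: vanish_fromW (leq_maxr _ _) H2.
(* The two sides differ termwise by the increments of [B], which vanishes at 0 because of its factor
   i and at N by truncation. *)
pose B i := i%:R *: f (m - 1 - i%:Z) (n - 1 + i%:Z).
rewrite /der /zw_invl (fsumE vA) (fsumE vB) (@fsumE _ _ N); last first.
  move=> i Ni; have := vA i Ni; have := vB i Ni.
  have -> : m - 1 - i%:Z - 1 = m - 1 - 1 - i%:Z by lia.
  have -> : n + i%:Z - 1 = n - 1 + i%:Z by lia.
  by move=> -> ->; rewrite !scaler0 addr0.
rewrite -[RHS]addr0 -[X in _ = _ + X](_ : \sum_(0 <= i < N) (B i.+1 - B i) = 0).
  rewrite big_mkord !scaler_sumr -!big_split /=; apply: eq_bigr => i _.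
  rewrite /B.
  have -> : m - 1 - i%:Z - 1 = m - 1 - 1 - i%:Z by lia.
  have -> : n + i%:Z - 1 = n - 1 + i%:Z by lia.
  have -> : m - 1 - i.+1%:Z = m - 1 - 1 - i%:Z by lia.
  have -> : n - 1 + i.+1%:Z = n + i%:Z by lia.
  rewrite addrACA -scalerDl -scaleNr -scalerDl.
  by congr (_ *: _ + _ *: _); rewrite ?rmorphB ?rmorphD /=; ring.
by rewrite telescope_sumr // /B (vB N) // scaler0 scale0r subrr.
Qed.

Lemma der_invr f : summabler f -> zw_invr (der f) = der (zw_invr f).
Proof.
move=> sf; apply/funext => m; apply/funext => n.
have := congr1 (fun g => g n m) (@der_invl (fun n m => f m n) (fun m n => sf n m)).
rewrite /zw_invl /zw_invr /der [RHS]addrC => <-.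
by congr fsum; apply/funext => i; rewrite addrC.
Qed.

End Derivation.

(** * Dong's lemma *)

Section Dong.
Variables (K : numFieldType) (V : lmodType K) (Y : voa V).
Implicit Types (a b c x y : V) (m n p : int).

Local Notation "a @[ n ] b" := (mode Y a n b)
  (at level 9, n at level 99, b at level 9, format "a @[ n ]  b").
Local Notation T := (mode Y (omega Y) 0).

Definition prodl a b x m n := a @[m] (b @[n] x).
Definition prodr a b x m n := b @[n] (a @[m] x).

(* The product of the fields of a and b divided by z - w, whose multiples by
   the powers of z - w have the fields of the products of a and b as their
   residues in z. *)
Definition op_kernel a b x := zw_invl (prodl a b x) + zw_invr (prodr a b x).

Lemma summable_prodl a b x : summablel (prodl a b x).
Proof.
move=> m n; have [N HN] := mode_truncN Y b x.
by exists (N + `|n|)%N => i Ni; rewrite /prodl HN ?linear0 //; lia.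
Qed.

Lemma summable_prodr a b x : summabler (prodr a b x).
Proof.
move=> m n; have [N HN] := mode_truncN Y a x.
by exists (N + `|m|)%N => i Ni; rewrite /prodr HN ?linear0 //; lia.
Qed.

Lemma zwD (f g : int -> int -> V) : zw (f + g) = zw f + zw g.
Proof.
by apply/funext => m; apply/funext => n; rewrite /zw !fctE opprD addrACA.
Qed.

(** One factor z - w cancels both denominators, and the opposite signs of the two expansions produce
    the commutator, which locality kills. *)
Lemma zw_kernel a b x : zw (op_kernel a b x) = prodl a b x - prodr a b x.
Proof.
rewrite zwD zw_invlK ?zw_invrK //; [exact: summable_prodr|exact: summable_prodl].
Qed.

Lemma kernel_vac a b m : 0 <= m ->
  op_kernel a b (vac Y) m (-1) = a @[m - 1] b /\
  forall n, 0 <= n -> op_kernel a b (vac Y) m n = 0.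
Proof.
move=> m0; have r0 n : zw_invr (prodr a b (vac Y)) m n = 0.
  rewrite /zw_invr (@fsumE _ _ 0%N) ?big_ord0 // => i _.
  by rewrite /prodr (voa_creation Y a) ?linear0 //; lia.
split=> [|n n0]; rewrite /op_kernel !fctE r0 addr0 /zw_invl.
  rewrite (@fsumE _ _ 1%N) ?big_ord1 => [|i i1].
    by rewrite /prodl /= subr0 addr0 voa_create.
  by rewrite /prodl voa_creation ?linear0 //; lia.
rewrite (@fsumE _ _ 0%N) ?big_ord0 // => i _.
by rewrite /prodl (voa_creation Y b) ?linear0 //; lia.
Qed.

Lemma transl_mode a n x :
  T (a @[n] x) = a @[n] (T x) - n%:~R *: a @[n - 1] x.
Proof.
by rewrite -scaleNr -voa_translation addrC subrK.
Qed.

Lemma iter_zw_mode (f : int -> int -> V) a k N :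
  iter N (@zw V) (fun m n => a @[k] (f m n)) =
  fun m n => a @[k] (iter N (@zw V) f m n).
Proof.
elim: N => //= N ->; apply/funext => m; apply/funext => n.
by rewrite /zw linearB.
Qed.

Lemma fsum_mode a n (f : nat -> V) : summable f ->
  fsum (fun i => a @[n] (f i)) = a @[n] (fsum f).
Proof. exact: (fsum_morph (mode Y a n)). Qed.

Lemma transl_kernel a b x m n :
  T (op_kernel a b x m n) - op_kernel a b (T x) m n = der (op_kernel a b x) m n.
Proof.
have sl := summable_prodl a b; have sr := summable_prodr a b.
transitivity ((zw_invl (der (prodl a b x)) + zw_invr (der (prodr a b x))) m n).
  rewrite /op_kernel !fctE linearD opprD addrACA /=; congr (_ + _).
    rewrite /zw_invl3 /zw_invl -fsum_mode; last exact: sl.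
    rewrite -fsumB; last exact: (sl (T x)); last first.
      by have [N HN] := sl x m n; exists N => i /HN ->; rewrite linear0.
    congr fsum; apply/funext => i; rewrite /prodl /der !transl_mode.
    by rewrite linearB linearZ /= !scaleNr [LHS](AC (3*1) ((1*4)*(3*2)))/= subrr add0r.
  rewrite /zw_invr3 /zw_invr -fsum_mode; last exact: sr.
  rewrite -fsumB; last exact: (sr (T x)); last first.
    by have [N HN] := sr x m n; exists N => i /HN ->; rewrite linear0.
  congr fsum; apply/funext => i; rewrite /prodr /der !transl_mode.
  by rewrite linearB linearZ /= !scaleNr [LHS](AC (3*1) ((1*4)*(2*3)))/= subrr add0r.
rewrite der_invl // der_invr // /der !fctE !scalerDr.
by rewrite addrACA.
Qed.

(** Let t be the variable of [y]. The commutator is killed by (z - w)^(N1 + 1), whose first factor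
    cancels the denominators, and by (z - t)^N2 (w - t)^N3, which pass through the division. Since w
    - t = (z - t) - (z - w), a power of w - t alone suffices. The index of z stays free, so residues
    in z may be taken afterwards. *)
Lemma dong a b y x : exists N, iter N (@zw23 V)
  (fun m n p => op_kernel a b (y @[p] x) m n - y @[p] (op_kernel a b x m n)) = 0.
Proof.
have [N1 H1] := mode_comm_zw Y a b; have [N2 H2] := mode_comm_zw Y a y.
have [N3 H3] := mode_comm_zw Y b y.
exists (N1.+1 + N2 + N3)%N; set W := fun m n p => _.
pose W1 := fun m n p => prodl a b (y @[p] x) m n - y @[p] (prodl a b x m n).
pose W2 := fun m n p => prodr a b (y @[p] x) m n - y @[p] (prodr a b x m n).
have sl := summable_prodl a b; have sr := summable_prodr a b.
have sly p m n : summable (fun i : nat => y @[p] (prodl a b x (m - 1 - i%:Z) (n + i%:Z))).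
  by have [N HN] := sl x m n; exists N => i /HN ->; rewrite linear0.
have sry p m n : summable (fun i : nat => y @[p] (prodr a b x (m + i%:Z) (n - 1 - i%:Z))).
  by have [N HN] := sr x m n; exists N => i /HN ->; rewrite linear0.
have sW1 : summablel3 W1 by move=> p m n; exact: summableB (sl (y @[p] x) m n) (sly p m n).
have sW2 : summabler3 W2 by move=> p m n; exact: summableB (sr (y @[p] x) m n) (sry p m n).
have WE : W = zw_invl3 W1 + zw_invr3 W2.
  apply/funext => m; apply/funext => n; apply/funext => p.
  rewrite /W /op_kernel !fctE linearD opprD addrACA /=; congr (_ + _).
    rewrite /zw_invl3 /zw_invl -fsum_mode; last exact: sl.
    by rewrite -fsumB //; exact: sl.
  rewrite /zw_invr3 /zw_invr -fsum_mode; last exact: sr.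
  by rewrite -fsumB //; exact: sr.
(* [y] is commuted past [b], which a power of w - t kills, and then past [a], which a power of z - t
   kills. *)
have kill1 : iter N2 (@zw13 V) (iter N3 (@zw23 V) W1) = 0.
  pose A1 := fun m n p => a @[m] (b @[n] (y @[p] x) - y @[p] (b @[n] x)).
  pose A2 := fun m n p => a @[m] (y @[p] (b @[n] x)) - y @[p] (a @[m] (b @[n] x)).
  have -> : W1 = A1 - (- A2).
    apply/funext => m; apply/funext => n; apply/funext => p.
    by rewrite /W1 /A1 /A2 /prodl !fctE opprK linearB subrKA.
  rewrite (iter_morphB _ (@zw23B V)) (iter_morphB _ (@zw13B V)).
  have -> : iter N3 (@zw23 V) A1 = 0.
    apply/funext => m; rewrite iter_zw23 /A1.
    have -> := iter_zw_mode (fun n p => b @[n] (y @[p] x) - y @[p] (b @[n] x)) a m N3.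
    by rewrite H3; apply/funext => n; apply/funext => p; rewrite linear0.
  have -> : iter N2 (@zw13 V) (iter N3 (@zw23 V) (- A2)) = 0.
    rewrite iter_comm; last exact: zw13_23C.
    have -> : iter N2 (@zw13 V) (- A2) = 0.
      apply/funext => m; apply/funext => n; apply/funext => p.
      have := iter_zw13 (-A2) N2 n; move/(congr1 (fun g => g m p)) => /= ->.
      have -> : (fun m p => (- A2) m n p) =
        0 - (fun m p => a @[m] (y @[p] (b @[n] x)) - y @[p] (a @[m] (b @[n] x))).
        by rewrite sub0r.
      by rewrite (iter_morphB _ (@zwB V)) H2 iter_zw0 subrr.
    by rewrite iter_morph0 //; exact: zw23B.
  by rewrite iter_morph0 ?subrr //; exact: zw13B.
have kill2 : iter N2 (@zw13 V) (iter N3 (@zw23 V) W2) = 0.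
  pose A1 := fun m n p => b @[n] (a @[m] (y @[p] x) - y @[p] (a @[m] x)).
  pose A2 := fun m n p => b @[n] (y @[p] (a @[m] x)) - y @[p] (b @[n] (a @[m] x)).
  have -> : W2 = A1 - (- A2).
    apply/funext => m; apply/funext => n; apply/funext => p.
    by rewrite /W2 /A1 /A2 /prodr !fctE opprK linearB subrKA.
  rewrite (iter_morphB _ (@zw23B V)) (iter_morphB _ (@zw13B V)).
  have -> : iter N2 (@zw13 V) (iter N3 (@zw23 V) A1) = 0.
    rewrite iter_comm; last exact: zw13_23C.
    have -> : iter N2 (@zw13 V) A1 = 0.
      apply/funext => m; apply/funext => n; apply/funext => p.
      have := iter_zw13 A1 N2 n; move/(congr1 (fun g => g m p)) => /= ->.
      have -> := iter_zw_mode (fun m p => a @[m] (y @[p] x) - y @[p] (a @[m] x)) b n N2.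
      by rewrite H2 linear0.
    by rewrite iter_morph0 //; exact: zw23B.
  have -> : iter N3 (@zw23 V) (- A2) = 0.
    apply/funext => m; rewrite iter_zw23.
    have -> : (- A2) m =
      0 - (fun n p => b @[n] (y @[p] (a @[m] x)) - y @[p] (b @[n] (a @[m] x))).
      by rewrite sub0r.
    by rewrite (iter_morphB _ (@zwB V)) H3 iter_zw0 subrr.
  by rewrite iter_morph0 ?subrr //; exact: zw13B.
have W12 : iter N1.+1 (@zw12 V) W = 0.
  apply/funext => m; apply/funext => n; apply/funext => p.
  have := iter_zw12 W N1.+1 p; move/(congr1 (fun g => g m n)) => /= ->.
  rewrite WE; have -> : (fun m n => (zw_invl3 W1 + zw_invr3 W2) m n p) =
    op_kernel a b (y @[p] x) - (fun m n => y @[p] (op_kernel a b x m n)).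
    by rewrite -WE.
  rewrite -iterS iterSr zwB zw_kernel.
  have -> : zw (fun m n => y @[p] (op_kernel a b x m n)) =
    fun m n => y @[p] ((prodl a b x - prodr a b x) m n).
    by rewrite -zw_kernel; exact: (iter_zw_mode (op_kernel a b x) y p 1).
  have -> : prodl a b (y @[p] x) - prodr a b (y @[p] x) = 
    (fun m n => a @[m] (b @[n] (y @[p] x)) - b @[n] (a @[m] (y @[p] x))) by [].
  rewrite (iter_morphB _ (@zwB V)) H1 sub0r.
  have -> := iter_zw_mode (prodl a b x - prodr a b x) y p N1.
  have -> : prodl a b x - prodr a b x = 
    (fun m n => a @[m] (b @[n] x) - b @[n] (a @[m] x)) by [].
  by rewrite H1 !fctE linear0 oppr0.
rewrite iterD; apply: (iter_sub_killed (@zw12B V) (@zw13B V) (@zw23B V) (@zw12_13C V) (@zw23E V)).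
- by rewrite iter_comm ?W12 ?iter_morph0 //; [exact: zw23B | exact: zw12_23C].
- have -> : W = zw_invl3 W1 - (- zw_invr3 W2) by rewrite opprK.
  have -> : - zw_invr3 W2 = 0 - zw_invr3 W2 by rewrite sub0r.
  rewrite !(iter_morphB _ (@zw23B V), iter_morphB _ (@zw13B V)).
  rewrite iter_zw_invl // iter_zw_invr // kill1 kill2 zw_invl3_0 zw_invr3_0.
  by rewrite (iter_morph0 _ (@zw23B V)) (iter_morph0 _ (@zw13B V)) !subrr.
Qed.

End Dong.

(** * Fields of the products of two vectors *)

Section Products.
Variables (K : numFieldType) (V : lmodType K) (Y : voa V).
Implicit Types (a b c x y : V) (m n p : int).

Local Notation "a @[ n ] b" := (mode Y a n b)
  (at level 9, n at level 99, b at level 9, format "a @[ n ]  b").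
Local Notation T := (mode Y (omega Y) 0).
Local Notation ker := (op_kernel Y).

Lemma kernel0 a b : ker a b 0 = 0.
Proof.
apply/funext => m; apply/funext => n; rewrite /op_kernel !fctE.
rewrite /zw_invl /zw_invr !(@fsumE _ _ 0%N) ?big_ord0 ?addr0 // => i _.
  by rewrite /prodr !linear0.
by rewrite /prodl !linear0.
Qed.

Lemma iter_zw_der (f : int -> int -> V) j :
  iter j (@zw V) (der f) = der (iter j (@zw V) f).
Proof. by elim: j => //= j ->; rewrite zw_der. Qed.

(** The residue in z of (z - w)^j times the kernel meets the hypotheses of [goddard]: the
    z-derivative has no residue, so [der] leaves only d/dw; [kernel_vac] gives the values on the
    vacuum, and [dong] the locality. The case j = 0 is the normally ordered product, j > 0 the
    nonnegative products. *)
Lemma mode_product a b j n x :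
  (a @[j%:Z - 1] b) @[n] x = iter j (@zw V) (ker a b x) 0 n.
Proof.
apply/esym; move: n x.
apply: (goddard (Y := Y) (f := fun n x => iter j (@zw V) (ker a b x) 0 n)).
- by move=> n; rewrite kernel0 iter_zw0.
- move=> n x.
  have := congr1 (fun f => f 0 n) (iter_zw_mode Y (ker a b x) (omega Y) 0 j).
  move=> /= <-.
  have e f g : iter j (@zw V) f 0 n - iter j (@zw V) g 0 n = iter j (@zw V) (f - g) 0 n.
    by rewrite (iter_morphB _ (@zwB V)).
  rewrite e (_ : _ - _ = der (ker a b x)); last first.
    by apply/funext => u; apply/funext => v; rewrite !fctE transl_kernel.
  by rewrite iter_zw_der {1}/der mulr0z oppr0 scale0r add0r.
- move=> n n0; rewrite zw_iterE big1 // => i _.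
  have ji : 0 <= 0 + j%:Z - i%:Z by have := ltn_ord i; lia.
  by have [_ ->] := kernel_vac Y a b ji; rewrite ?scaler0 //; lia.
- rewrite zw_iterE big_ord_recl big1 => [|i _]; last first.
    have ji : 0 <= 0 + j%:Z - (lift ord0 i)%:Z by rewrite lift0; have := ltn_ord i; lia.
    by have [_ ->] := kernel_vac Y a b ji; rewrite ?scaler0 // lift0; lia.
  rewrite expr0 bin0 mulr1 scale1r addr0.
  have -> : 0 + j%:Z - (ord0 : 'I_j.+1)%:Z = j%:Z by rewrite /=; lia.
  have -> : -1 + (ord0 : 'I_j.+1)%:Z = -1 by rewrite /=; lia.
  by have [|-> _] := @kernel_vac _ _ Y a b j%:Z.
move=> y; have [N HN] := dong Y a b y (vac Y); exists N.
set W := (X in iter N _ X = 0) in HN.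
have -> : (fun m n => iter j (@zw V) (ker a b (y @[n] (vac Y))) 0 m -
    y @[n] (iter j (@zw V) (ker a b (vac Y)) 0 m)) = (iter j (@zw12 V) W) 0.
  apply/funext => m; apply/funext => n.
  have := congr1 (fun f => f 0 m) (iter_zw12 W j n) => /= ->.
  have := congr1 (fun f => f 0 m) (iter_zw_mode Y (ker a b (vac Y)) y n j).
  move=> /= <-.
  have -> : (fun m0 n0 => W m0 n0 n) = ker a b (y @[n] (vac Y)) -
     (fun m n0 => y @[n] (ker a b (vac Y) m n0)) by [].
  by rewrite (iter_morphB _ (@zwB V)).
rewrite -iter_zw23 iter_comm ?HN; last by move=> w; rewrite zw12_23C.
by rewrite iter_morph0 //; exact: zw12B.
Qed.

(* The binomial coefficient of an arbitrary integer m. *)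
Definition zbin (m : int) (j : nat) : K := \prod_(i < j) ((m - i%:Z)%:~R / i.+1%:R).

Lemma zbin0r m : zbin m 0 = 1. Proof. by rewrite /zbin big_ord0. Qed.

Lemma zbin1 m : zbin m 1 = m%:~R.
Proof. by rewrite /zbin big_ord1 subr0 divr1. Qed.

Lemma zbinS m j : zbin m j.+1 = zbin m j * ((m - j%:Z)%:~R / j.+1%:R).
Proof. by rewrite /zbin big_ord_recr. Qed.

Lemma zbin0 j : zbin 0 j.+1 = 0.
Proof.
elim: j => [|j IH]; first by rewrite zbin1.
by rewrite zbinS IH mul0r.
Qed.

Lemma zbin_pascal m j : zbin (m + 1) j.+1 = zbin m j.+1 + zbin m j.
Proof.
have nz (i : nat) : (i.+1%:R : K) != 0 by rewrite pnatr_eq0.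
elim: j => [|j IH].
  by rewrite !zbin1 zbin0r intrD.
rewrite zbinS IH [in RHS]zbinS; rewrite [zbin m j.+1]zbinS.
rewrite !rmorphB !rmorphD /= -!pmulrn.
move: (nz j) (nz j.+1) => n1 n2.
by rewrite -!natr1 in n1 n2 *; field; apply/andP; split.
Qed.
End Products.

(** * Commutator and iterate formulas *)

Section Borcherds.
Variables (K : numFieldType) (V : lmodType K) (Y : voa V).
Implicit Types (a b c x y : V) (m n p : int).

Local Notation "a @[ n ] b" := (mode Y a n b)
  (at level 9, n at level 99, b at level 9, format "a @[ n ]  b").
Local Notation T := (mode Y (omega Y) 0).

(** Along a diagonal m + n constant, [zw] is the forward difference in m, so f is polynomial in m of
    degree less than N; this is its Newton expansion at m = 0. Each difference lowers the index sum
    by one, hence the term - j. *)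
Lemma newton (f : int -> int -> V) N m n : iter N (@zw V) f = 0 ->
  f m n = \sum_(j < N) zbin K m j *: iter j (@zw V) f 0 (m + n - j%:Z).
Proof.
elim: N f m n => [|N IH] f m n f0; first by rewrite [f]f0 big_ord0.
rewrite iterSr in f0.
have [g gE] : exists g : int -> int -> V, forall m n,
    g m n = f m n - \sum_(j < N.+1) zbin K m j *: iter j (@zw V) f 0 (m + n - j%:Z).
  by eexists.
have gS k l : g (k + 1) l = g k (l + 1).
  have [c cE] : exists c : nat -> V, forall j,
      c j = iter j (@zw V) f 0 (k + l + 1 - j%:Z) by eexists.
  have e1 : g (k + 1) l = f (k + 1) l - \sum_(j < N.+1) zbin K (k + 1) j *: c j.
    rewrite gE; congr (_ - _).
 apply: eq_bigr => j _.
 rewrite cE.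
 have -> : k + 1 + l - j%:Z = k + l + 1 - j%:Z.
 lia.
 by [].
  have e2 : g k (l + 1) = f k (l + 1) - \sum_(j < N.+1) zbin K k j *: c j.
    by rewrite gE; congr (_ - _); apply: eq_bigr => j _; rewrite cE addrA.
  rewrite e1 e2; apply/eqP; rewrite subr_eq -addrA [X in _ == X]addrC.
  rewrite -subr_eq [X in _ == X]addrC; apply/eqP.
  rewrite -[LHS]/(zw f k l) (IH (zw f) k l f0) -sumrB.
  rewrite big_ord_recl !zbin0r subrr add0r; apply: eq_bigr => j _.
  rewrite lift0 zbin_pascal scalerDl [RHS]addrC addKr.
  rewrite cE iterSr.
  by have -> : k + l + 1 - j.+1%:Z = k + l - j%:Z by lia.
have g0 l : g 0 l = 0.
  rewrite gE big_ord_recl big1 => [|i _]; last by rewrite zbin0 scale0r.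
  by rewrite zbin0r scale1r /= addr0 add0r subr0 subrr.
suff : g m n = 0 by move/eqP; rewrite gE subr_eq0 => /eqP.
case: m => [k|k].
  elim: k n => [|k IHk] n; first exact: g0.
  by rewrite -[k.+1]addn1 PoszD gS.
elim: k n => [|k IHk] n.
  by have := gS (-1) (n - 1); rewrite addNr subrK g0 => <-.
have := gS (Negz k.+1) (n - 1); rewrite subrK => <-.
by rewrite (_ : Negz k.+1 + 1 = Negz k) //; lia.
Qed.

(** The Newton expansion of the commutator. Its j-th difference at 0 is a mode of a_j b by
    [mode_product] at j + 1, where the extra factor z - w turns the kernel into the commutator. *)
Lemma mode_comm a b N x m n :
  (forall j : nat, (N <= j)%N -> a @[j%:Z] b = 0) ->
  a @[m] (b @[n] x) - b @[n] (a @[m] x) =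
  \sum_(j < N) zbin K m j *: (a @[j%:Z] b) @[m + n - j%:Z] x.
Proof.
move=> abN; have [M HM] := mode_comm_zw Y a b.
pose F j := zbin K m j *: (a @[j%:Z] b) @[m + n - j%:Z] x.
have comm_prod j k : iter j (@zw V)
    (fun m n => a @[m] (b @[n] x) - b @[n] (a @[m] x)) 0 k = (a @[j%:Z] b) @[k] x.
  have := mode_product Y a b j.+1 k x; rewrite iterSr zw_kernel.
  by rewrite (_ : j.+1%:Z - 1 = j%:Z) ?[in X in X -> _]/j; last lia; move=> ->.
(* N bounds the nonzero products a_j b, while M is the order of locality; both cut off only
   vanishing terms. *)
have -> : \sum_(j < N) F j = \sum_(j < M) F j.
  have F0 : vanish_from N F by move=> j Nj; rewrite /F abN // mode0l scaler0.
  have F1 : vanish_from M F.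
    move=> j Mj; rewrite /F -comm_prod.
    by rewrite -(subnK Mj) iterD HM iter_zw0 scaler0.
  by rewrite -(fsumE F0) (fsumE F1).
rewrite (newton m n (HM x)); apply: eq_bigr => j _.
by rewrite comm_prod.
Qed.

Lemma mode_transl a n x : (T a) @[n] x = - n%:~R *: a @[n - 1] x.
Proof.
have [N HN] := mode_truncN Y (omega Y) a.
rewrite -voa_translation (@mode_comm _ _ N.+1 _ 0 n) => [|j Nj]; last by apply: HN; lia.
rewrite big_ord_recl big1 => [|j _]; last by rewrite lift0 zbin0 scale0r.
by rewrite zbin0r scale1r addr0 add0r subr0.
Qed.

Lemma mode_iterate q a b n x : exists N0, forall N, (N0 <= N)%N ->
  (a @[-1 - q%:Z] b) @[n] x = \sum_(i < N) 'C(q + i, i)%:R *: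
    (a @[-1 - q%:Z - i%:Z] (b @[n + i%:Z] x) +
     (-1) ^+ q *: b @[n - 1 - q%:Z - i%:Z] (a @[i%:Z] x)).
Proof.
elim: q a => [|q IH] a.
  have [N1 H1] := summable_prodl Y a b x 0 n.
  have [N2 H2] := summable_prodr Y a b x 0 n.
  exists (maxn N1 N2) => N; rewrite geq_max => /andP[NN1 NN2].
  rewrite -[-1 - 0%:Z]/(0%:Z - 1) mode_product /= /op_kernel !fctE /zw_invl /zw_invr.
  rewrite (fsumE (vanish_fromW NN1 H1)) (fsumE (vanish_fromW NN2 H2)) -big_split.
  apply: eq_bigr => i _; rewrite /= add0n binn !scale1r /prodl /prodr.
  by congr (mode Y _ _ _ + mode Y _ _ (mode Y _ _ _)); lia.
have [N0 HN0] := IH (T a); have [N1 HN1] := mode_truncN Y a x.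
exists (maxn N0 N1.+1) => N; rewrite geq_max => /andP[NN0 NN1].
have nz : (q.+1%:R : K) != 0 by rewrite pnatr_eq0.
apply: (scalerI nz).
have -> : q.+1%:R *: (a @[-1 - q.+1%:Z] b) @[n] x = ((T a) @[-1 - q%:Z] b) @[n] x.
  rewrite mode_transl modeZl; congr (_ *: mode Y (mode Y _ _ _) _ _).
    by rewrite -mulrNz -[q.+1%:R]/(q.+1%:Z%:~R); congr (_%:~R); lia.
  by lia.
rewrite (HN0 _ NN0) scaler_sumr.
(* Passing from T a to a shifts the index of the terms with b in front by one; the telescoping
   increments of [B] realign them. *)
pose B i := (i%:R * 'C(q + i, i)%:R * (-1) ^+ q) *:
  b @[n - 1 - q%:Z - i%:Z] (a @[i%:Z - 1] x).
rewrite -[RHS]addr0 -[X in _ = _ + X](_ : \sum_(0 <= i < N) (B i.+1 - B i) = 0); last first.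
  rewrite telescope_sumr // [B N]/B HN1 ?linear0 ?scaler0; last lia.
  by rewrite /B !mul0r scale0r subrr.
rewrite big_mkord -big_split; apply: eq_bigr => i _ /=.
rewrite !mode_transl !linearZ /= !scalerDr !scalerA -[RHS]addrA; congr (_ + _).
  have -> : -1 - q%:Z - i%:Z - 1 = -1 - q.+1%:Z - i%:Z by lia.
  have -> : - (-1 - q%:Z - i%:Z)%:~R = (q + i).+1%:R :> K.
    by rewrite -mulrNz -[RHS]/((q + i).+1%:Z%:~R); congr (_%:~R); lia.
  congr (_ *: _); rewrite -!natrM; congr _%:R.
  by have := mul_bin_down (q + i).+1 i; rewrite /= !addSn -addSn addnK; lia.
rewrite addrA /B.
have -> : i.+1%:Z - 1 = i%:Z by lia.
have -> : n - 1 - q%:Z - i.+1%:Z = n - 1 - q.+1%:Z - i%:Z by lia.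
have -> : (i%:Z%:~R : K) = i%:R by [].
rewrite -scalerDl.
have -> : 'C(q.+1 + i, i)%:R * q.+1%:R * (-1) ^+ q.+1 +
    i.+1%:R * 'C(q + i.+1, i.+1)%:R * (-1) ^+ q = 0 :> K.
  have := mul_bin_left (q + i).+1 i; rewrite -addSn addnK addnS -addSn.
  move=> /(congr1 (fun k => k%:R : K)); rewrite !natrM => ->.
  by rewrite exprS; ring.
rewrite scale0r add0r ?scalerN -scaleNr; congr (_ *: _); ring.
Qed.
End Borcherds.

(** * Heisenberg fields *)

Lemma eq_add_of_subr (U : zmodType) (x y z : U) : x - y = z -> x = y + z.
Proof. by move=> <-; rewrite addrC subrK. Qed.

Section HeisenbergModes.
Variables (K : numFieldType) (V : lmodType K) (Y : voa V).
Variables (r : nat) (B : 'M[K]_r) (h : 'I_r -> V).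
Hypothesis Yh : heisenberg Y B h.
Implicit Types (a b c x y : V) (m n p : int) (i j l : 'I_r).

Local Notation "a @[ n ] b" := (mode Y a n b)
  (at level 9, n at level 99, b at level 9, format "a @[ n ]  b").
Local Notation sug := (sugawara Y B h).
Local Notation cosetw := (omega Y - sugawara Y B h).

Lemma gram_sym : B^T = B. Proof. by case: Yh. Qed.

Lemma gram_unit : B \in unitmx. Proof. by case: Yh. Qed.

Lemma invgram_sym i j : invmx B i j = invmx B j i.
Proof. by rewrite -[in LHS]gram_sym -trmx_inv mxE. Qed.

Lemma sum_invgram i l : \sum_j invmx B i j * B l j = (i == l)%:R.
Proof.
have := mulVmx gram_unit; move=> /matrixP/(_ i l); rewrite !mxE => <-.
by apply: eq_bigr => j _; rewrite (_ : B l j = B j l) // -[in LHS]gram_sym mxE.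
Qed.

Lemma mode_commute a b : (forall n, 0 <= n -> a @[n] b = 0) ->
  forall m n x, a @[m] (b @[n] x) = b @[n] (a @[m] x).
Proof.
move=> ab0 m n x; apply/eqP; rewrite -subr_eq0 (@mode_comm _ _ _ _ _ 0%N) ?big_ord0 //.
by move=> k _; exact: ab0.
Qed.

Lemma heis_mode i j n : 0 <= n -> (h i) @[n] (h j) = if n == 1 then B i j *: vac Y else 0.
Proof. by case: n => // n _; case: Yh => _ _ H _; rewrite H. Qed.

Lemma heis_comm i j m n x : (h i) @[m] ((h j) @[n] x) =
  (h j) @[n] ((h i) @[m] x) + (if m + n == 0 then m%:~R * B i j else 0) *: x.
Proof.
apply: eq_add_of_subr; rewrite (@mode_comm _ _ _ _ _ 2) => [|k k2]; last first.
  by rewrite heis_mode // ifF //; case: k k2 => [|[]].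
rewrite !big_ord_recl big_ord0 !lift0 /= !heis_mode // mode0l scaler0 add0r addr0.
rewrite modeZl voa_vacuum zbin1 scalerA.
have -> : (m + n == 0) = (m + n - 1 == -1) by lia.
by case: ifP; rewrite // scaler0 scale0r.
Qed.

Lemma omega_heis0 i n : 0 < n -> (omega Y) @[n] (h i) = if n == 1 then h i else 0.
Proof.
case: n => [[//|n]|//] _; case: Yh => _ _ _ H.
have -> : n.+1%:Z = n%:Z + 1 by lia.
by rewrite H; have -> : (n%:Z + 1 == 1) = (n == 0%N) by lia.
Qed.

Lemma omega_heis i m n x : (omega Y) @[m] ((h i) @[n] x) =
  (h i) @[n] ((omega Y) @[m] x) - n%:~R *: (h i) @[m + n - 1] x.
Proof.
apply: eq_add_of_subr; rewrite (@mode_comm _ _ _ _ _ 2) => [|k k2]; last first.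
  by rewrite omega_heis0 ?ifF //; case: k k2 => [|[]].
rewrite !big_ord_recl big_ord0 !lift0 /= mode_transl omega_heis0 // zbin0r scale1r zbin1 ?subr0 !addr0.
by rewrite -scalerDl -scaleNr -!rmorphN -rmorphD /=; congr (_%:~R *: _); lia.
Qed.

(** Skew-symmetry is bypassed: the conformal vector is omega_(-1) vac, and the nonnegative modes of
    [h i] kill the vacuum. *)
Lemma heis_omega i n : 0 <= n -> (h i) @[n] (omega Y) = if n == 1 then h i else 0.
Proof.
move=> n0; rewrite -(voa_create Y (omega Y)).
have := omega_heis i (-1) n (vac Y); rewrite voa_creation // linear0.
move/eqP; rewrite eq_sym subr_eq0 => /eqP ->.
have [->|n1] := eqVneq n 1; first by rewrite scale1r voa_create.
have [->|n2] := eqVneq n 0; first by rewrite scale0r.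
by rewrite voa_creation ?scaler0 //; lia.
Qed.

Lemma sugawara_ind (Q : V -> Prop) :
  (forall (k : K) x y, Q x -> Q y -> Q (k *: x + y)) -> Q 0 ->
  (forall i j, Q ((h i) @[-1] (h j))) -> Q sug.
Proof.
move=> QD Q0 Qh.
have QZ k x : Q x -> Q (k *: x) by move=> Qx; rewrite -[_ *: _]addr0; exact: QD.
have QA x y : Q x -> Q y -> Q (x + y) by rewrite -{2}(scale1r x); exact: QD.
rewrite /sugawara; apply: (QZ); apply: big_ind => // i _.
by apply: big_ind => // j _; exact: QZ.
Qed.

Lemma heis_sugawara l n : 0 <= n -> (h l) @[n] sug = if n == 1 then h l else 0.
Proof.
move=> n0; have e i j : (h l) @[n] ((h i) @[-1] (h j)) =
    if n == 1 then B l j *: h i + B l i *: h j else 0.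
  rewrite heis_comm heis_mode // (_ : (n + -1 == 0) = (n == 1)); last by lia.
  case: eqP => [->|_]; last by rewrite linear0 scale0r addr0.
  by rewrite linearZ /= voa_create mul1r.
rewrite /sugawara linearZ linear_sum /=.
under eq_bigr => i _ do rewrite linear_sum /=; under eq_bigr => i _.
  by under eq_bigr => j _ do rewrite linearZ /= e; over.
case: eqP => _; last first.
  by rewrite big1 ?scaler0 // => i _; rewrite big1 // => j _; rewrite scaler0.
under eq_bigr => i _.
  under eq_bigr => j _ do rewrite scalerDr !scalerA; rewrite big_split /=.
  rewrite -scaler_suml sum_invgram; over.
rewrite big_split /= [X in _ + X]exchange_big /=.
under [X in _ + X]eq_bigr => j _.
  rewrite -scaler_suml; under eq_bigr => i _ do rewrite invgram_sym.
  rewrite sum_invgram; over.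
have sd : \sum_i (i == l)%:R *: h i = h l.
  rewrite (bigD1 l) //= eqxx scale1r big1 ?addr0 // => i /negbTE ->.
  by rewrite scale0r.
by rewrite sd -mulr2n -scaler_nat scalerA mulVf ?scale1r ?pnatr_eq0.
Qed.

Lemma heis_coset l n : 0 <= n -> (h l) @[n] cosetw = 0.
Proof. by move=> n0; rewrite linearB /= heis_omega ?heis_sugawara ?subrr. Qed.

Lemma coset_heis l m n x : cosetw @[m] ((h l) @[n] x) = (h l) @[n] (cosetw @[m] x).
Proof. by apply/esym/mode_commute => k; exact: heis_coset. Qed.

Lemma coset_sugawara m n x : cosetw @[m] (sug @[n] x) = sug @[n] (cosetw @[m] x).
Proof.
apply: mode_commute => k k0.
apply: (sugawara_ind (Q := fun s => cosetw @[k] s = 0)) => [c y z y0 z0||i j].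
- by rewrite linearP /= y0 z0 scaler0 addr0.
- exact: linear0.
- by rewrite -(voa_create Y (h j)) !coset_heis voa_creation ?linear0.
Qed.

(** Since the coset part of the conformal vector commutes with the Heisenberg modes, the commutator
    is that of [omega Y], and the Sugawara modes need not be expanded. *)
Lemma sugawara_heis l n x : sug @[1] ((h l) @[n] x) =
  (h l) @[n] (sug @[1] x) - n%:~R *: (h l) @[n] x.
Proof.
have := coset_heis l 1 n x; rewrite !modeBl linearB /= omega_heis.
rewrite (_ : 1 + n - 1 = n); last by lia.
rewrite -addrA => /addrI/eqP; rewrite -opprD eqr_opp => /eqP <-.
by rewrite [RHS]addrC addKr.
Qed.

(** These are the products that express conformal weight 2 and central charge r; the rank arises as
    the trace of [invmx B] times [B]. *)
Lemma omega_sugawara (k : nat) : (omega Y) @[k.+1%:Z] sug =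
  if k == 0%N then 2 *: sug else if k == 2%N then (r%:R / 2) *: vac Y else 0.
Proof.
have e i j : (omega Y) @[k.+1%:Z] ((h i) @[-1] (h j)) =
    if k == 0%N then 2 *: (h i) @[-1] (h j) else if k == 2%N then B i j *: vac Y else 0.
  rewrite omega_heis omega_heis0 // scaleN1r opprK.
  case: k => [|[|[|k]]].
  - by rewrite (_ : 1 + -1 - 1 = -1) // scaler_nat mulr2n.
  - by rewrite linear0 add0r (_ : 2 + -1 - 1 = 0) // heis_mode.
  - by rewrite linear0 add0r (_ : 3 + -1 - 1 = 1) // heis_mode.
  - rewrite linear0 add0r (_ : k.+4%:Z + -1 - 1 = k.+2%:Z); last by lia.
    by rewrite heis_mode.
rewrite /sugawara linearZ linear_sum /=.
under eq_bigr => i _ do rewrite linear_sum /=; under eq_bigr => i _.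
  by under eq_bigr => j _ do rewrite linearZ /= e; over.
case: k {e} => [|[|[|k]]] /=.
- rewrite scalerA mulrC -scalerA; congr (_ *: _); rewrite scaler_sumr; apply: eq_bigr => i _.
  by rewrite scaler_sumr; apply: eq_bigr => j _; rewrite scalerA mulrC -scalerA.
- by rewrite big1 ?scaler0 // => i _; rewrite big1 // => j _; rewrite scaler0.
- under eq_bigr => i _.
    under eq_bigr => j _ do rewrite scalerA; rewrite -scaler_suml sum_invgram eqxx; over.
  by rewrite sumr_const card_ord scale1r -scaler_nat scalerA mulrC.
- by rewrite big1 ?scaler0 // => i _; rewrite big1 // => j _; rewrite scaler0.
Qed.

Lemma omega_comm_sugawara m n x :
  (omega Y) @[m + 1] (sug @[n + 1] x) - sug @[n + 1] ((omega Y) @[m + 1] x) =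
  (m - n)%:~R *: sug @[m + n + 1] x +
  (if m + n == 0 then (((m ^+ 3 - m)%:~R / 12%:R) * r%:R) *: x else 0).
Proof.
move: omega_sugawara; move: sug => s os.
rewrite (@mode_comm _ _ _ _ _ 4) => [|[//|k] k3]; last first.
  by rewrite os ifF ?ifF //; case: k k3 => [|[|[]]].
rewrite !big_ord_recl big_ord0 !lift0 /= !os /=.
rewrite mode_transl !mode0l !scaler0 zbin0r zbin1 !modeZl voa_vacuum scale1r !(add0r, addr0).
have -> : m + 1 + (n + 1) - 1 = m + n + 1 by lia.
have -> : (m + 1 + (n + 1) - 3%:Z == -1) = (m + n == 0) by lia.
rewrite addrA !scalerA -scalerDl; congr (_ *: _ + _).
  by rewrite !rmorphB !rmorphD /=; ring.
case: ifP => _; last by rewrite !scaler0.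
congr (_ *: _).
rewrite !zbinS zbin0r !rmorphB !rmorphD rmorphXn /=.
by field.
Qed.

(** The Goddard-Kent-Olive argument. Coset modes commute with Sugawara modes, so the bracket reduces
    to that of [omega Y] with itself minus a mixed one with the Sugawara vector, and the central
    charges subtract. *)
Lemma coset_virasoro m n x :
  cosetw @[m + 1] (cosetw @[n + 1] x) - cosetw @[n + 1] (cosetw @[m + 1] x) =
  (m - n)%:~R *: cosetw @[m + n + 1] x +
  (if m + n == 0 then (((m ^+ 3 - m)%:~R / 12%:R) * (ccharge Y - r%:R)) *: x else 0).
Proof.
rewrite [X in mode Y cosetw (m + 1) X]modeBl linearB /= coset_sugawara.
rewrite [X in _ - X]modeBl opprD opprK addrACA [_ + sug @[_] _]addNr addr0.
rewrite modeBl [in X in _ - X]modeBl linearB /= opprB addrACA addrC.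
rewrite [LHS](AC (2*2) ((3*2)*(4*1)))/= voa_virasoro omega_comm_sugawara.
rewrite [n + m]addrC addrACA -(opprB m n) rmorphN /= scaleNr.
rewrite modeBl scalerBr; congr (_ + _).
case: ifP => [|_]; last by rewrite addr0.
rewrite addr_eq0 -eqr_oppLR => /eqP <-; rewrite -scalerDl; congr (_ *: _).
by rewrite !rmorphB !rmorphXn !rmorphN /=; ring.
Qed.

End HeisenbergModes.

(** * Projections onto highest-weight vectors *)

Section Decomposition.
Variables (K : numFieldType) (V : lmodType K) (L : eqType) (S : L -> set V).

Definition summand := forall l a x y, S l x -> S l y -> S l (a *: x + y).

(* Distinct summands are separated by an operator that acts on every summand by
   a scalar. *)
Definition separated := forall l m, l != m ->
  exists (Q : {linear V -> V}) (q : L -> K),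
    (forall k y, S k y -> Q y = q k *: y) /\ q l != q m.

Hypothesis S_0 : forall l, S l 0.
Hypothesis S_lin : summand.
Hypothesis S_span : forall v, v \in span (\bigcup_(l in setT) S l).
Hypothesis S_sep : separated.

Definition rest (l : L) : {pred V} := span (\bigcup_(m in [set m | m != l]) S m).

Lemma rest_lin l a x y : x \in rest l -> y \in rest l -> a *: x + y \in rest l.
Proof. by have [_] := span_submod_closed (\bigcup_(m in [set m | m != l]) S m); exact. Qed.

Lemma restP l m x : S m x -> m != l -> x \in rest l.
Proof. by move=> Smx ml; apply: mem_span; exists m. Qed.

(** Lagrange interpolation: w involves finitely many summands m, and the product of the operators (Q
    - q m) / (q l - q m) fixes S l and kills w. The factors commute because they act by scalars on
    the summands, which span. *)
Lemma rest_kill l w : w \in rest l -> exists (Q : V -> V) (q : L -> K),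
  [/\ linear Q, forall k y, S k y -> Q y = q k *: y, q l = 1 & Q w = 0].
Proof.
have lin0 (Q : V -> V) : linear Q -> Q 0 = 0.
  by move=> HQ; have /= := HQ (-1) 0 0; rewrite scaler0 addr0 scaleN1r addNr.
have linZ (Q : V -> V) : linear Q -> forall a x, Q (a *: x) = a *: Q x.
  by move=> HQ a x; have /= := HQ a x 0; rewrite (lin0 Q HQ) !addr0.
have scalar (Q Q' : V -> V) (q q' : L -> K) : linear Q -> linear Q' ->
    (forall k y, S k y -> Q y = q k *: y) ->
    (forall k y, S k y -> Q' y = q' k *: y) -> forall v, Q (Q' v) = Q' (Q v).
  move=> lQ lQ' HQ HQ' v; move: v (S_span v); apply: span_ind => [|a x y Qx Qy|x [k _ Sx]].
  - by rewrite (lin0 Q lQ) (lin0 Q' lQ') (lin0 Q lQ).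
  - by rewrite lQ' !lQ lQ' Qx Qy.
  - rewrite (HQ' k x) // (HQ k x) // (linZ Q lQ) (linZ Q' lQ').
    by rewrite (HQ k x) // (HQ' k x) // !scalerA mulrC.
move: w; apply: span_ind => [|a x y|x [m /= ml Sx]].
- exists id, (fun=> 1); split=> // k y _; by rewrite scale1r.
- move=> [Q [q [lQ HQ ql Qx]]] [Q' [q' [lQ' HQ' ql' Qy]]].
  exists (Q \o Q'), (fun k => q k * q' k); split.
  + by move=> c u v /=; rewrite lQ' lQ.
  + by move=> k z Sz; rewrite /= (HQ' k z) // (linZ Q lQ) (HQ k z) // scalerA mulrC.
  + by rewrite ql ql' mulr1.
  + by rewrite /= lQ' lQ (scalar Q Q' q q') // Qx Qy (lin0 Q lQ) (lin0 Q' lQ') scaler0 addr0.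
- have [Q [q [HQ qlm]]] := S_sep ml.
  have nz : q l - q m != 0 by rewrite subr_eq0 eq_sym.
  exists (fun v => (q l - q m)^-1 *: (Q v - q m *: v)).
  exists (fun k => (q l - q m)^-1 * (q k - q m)); split.
  + move=> c u v; rewrite linearP.
    have -> : c *: Q u + Q v - q m *: (c *: u + v) =
        c *: (Q u - q m *: u) + (Q v - q m *: v).
      by rewrite scalerDr opprD addrACA scalerBr !scalerA [q m * c]mulrC.
    by rewrite scalerDr !scalerA mulrC.
  + by move=> k y Sy; rewrite (HQ k) // -scalerBl scalerA.
  + by rewrite mulVf.
  + by rewrite (HQ m) // -scalerBl subrr scale0r scaler0.
Qed.

Lemma rest_indep l v : S l v -> v \in rest l -> v = 0.
Proof.
move=> Sv /rest_kill[Q [q [_ HQ ql Qv]]].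
by rewrite -[v]scale1r -ql -(HQ l).
Qed.

Definition proj (l : L) (v : V) : V := xget 0 [set w | S l w /\ v - w \in rest l].

Lemma proj_spec l v : S l (proj l v) /\ v - proj l v \in rest l.
Proof.
apply: (@xgetPex _ 0 [set w | S l w /\ v - w \in rest l]).
move: v (S_span v); apply: span_ind => [|a x y [x' [Sx xx]] [y' [Sy yy]]|x [k _ Sx]].
- exists 0; split; first exact: S_0.
  by rewrite subrr; have [] := span_submod_closed (\bigcup_(m in [set m | m != l]) S m).
- exists (a *: x' + y'); split; first exact: S_lin.
  by rewrite opprD addrACA -scalerBr; exact: rest_lin.
- have [e|kl] := eqVneq k l.
    exists x; rewrite -e; split=> //; rewrite subrr.
    by have [] := span_submod_closed (\bigcup_(m in [set m | m != k]) S m).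
  by exists 0; split; [exact: S_0|rewrite subr0; exact: restP kl].
Qed.

Lemma proj_uniq l v w : S l w -> v - w \in rest l -> proj l v = w.
Proof.
move=> Sw rw; have [Sp rp] := proj_spec l v.
apply/eqP; rewrite -subr_eq0; apply/eqP/(@rest_indep l).
  by rewrite addrC -scaleN1r; exact: S_lin.
have := rest_lin (-1) rp rw.
by rewrite scaleN1r opprB subrKA.
Qed.

Lemma proj_linear l : linear (proj l).
Proof.
move=> a x y; have [Sx rx] := proj_spec l x; have [Sy ry] := proj_spec l y.
apply: proj_uniq; first exact: S_lin.
by rewrite opprD addrACA -scalerBr; exact: rest_lin.
Qed.

Lemma proj_in l v : S l (proj l v). Proof. by case: (proj_spec l v). Qed.

Lemma proj_id l v : S l v -> proj l v = v.
Proof.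
move=> Sv; apply: proj_uniq => //; rewrite subrr.
by have [] := span_submod_closed (\bigcup_(m in [set m | m != l]) S m).
Qed.

Lemma proj_rest l v : v \in rest l -> proj l v = 0.
Proof. by move=> rv; apply: proj_uniq; rewrite ?subr0. Qed.

(** Injectivity of [g] keeps the images of the other summands away from S (g l). Creation operators
    are used with a shift of the degree, coset and conformal modes with the identity. *)
Lemma proj_shift (T : {linear V -> V}) (g : L -> L) l v : injective g ->
  (forall m x, S m x -> S (g m) (T x)) -> proj (g l) (T v) = T (proj l v).
Proof.
move=> gI ST; have [Sp rp] := proj_spec l v.
apply: proj_uniq; first exact: ST.
rewrite -linearB; move: (_ - _) rp; apply: span_ind => [|a x y Tx Ty|x [m /= ml Sx]].
- by rewrite linear0; have [] := span_submod_closed (\bigcup_(m in [set m | m != g l]) S m).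
- by rewrite linearP; exact: rest_lin.
- by apply: restP (ST _ _ Sx) _; apply: contra_neq ml => /gI.
Qed.

Lemma proj_support v : exists s : seq L, forall l, l \notin s -> proj l v = 0.
Proof.
move: v (S_span v); apply: span_ind => [|a x y [s Hs] [t Ht]|x [k _ Sx]].
- by exists [::] => l _; rewrite proj_id //; exact: S_0.
- exists (s ++ t) => l; rewrite mem_cat negb_or => /andP[/Hs xs /Ht yt].
  by rewrite proj_linear xs yt scaler0 addr0.
- exists [:: k] => l; rewrite inE => lk; apply: proj_rest.
  by apply: restP Sx _; rewrite eq_sym.
Qed.

End Decomposition.

Section WeightForm.
Variables (R : realType) (r : nat) (B : 'M[R[i]]_r).
Implicit Types l m : 'rV[R]_r.

Lemma wt_dualD l m i : wt_dual B (l + m) i = wt_dual B l i + wt_dual B m i.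
Proof.
rewrite /wt_dual -big_split; apply: eq_bigr => j _ /=.
by rewrite mxE rmorphD /= mulrDl.
Qed.

Lemma wt_formDl l m k : wt_form B (l + m) k = wt_form B l k + wt_form B m k.
Proof.
rewrite /wt_form -big_split; apply: eq_bigr => j _ /=.
by rewrite wt_dualD mulrDl.
Qed.

Lemma wt_dual0 i : wt_dual B 0 i = 0.
Proof. by rewrite /wt_dual big1 // => j _; rewrite mxE mul0r. Qed.

Lemma wt_form0l l : wt_form B 0 l = 0.
Proof. by rewrite /wt_form big1 // => i _; rewrite wt_dual0 mul0r. Qed.

Lemma wt_formC l m : (forall i j, invmx B i j = invmx B j i) ->
  wt_form B l m = wt_form B m l.
Proof.
move=> Bs; rewrite /wt_form /wt_dual.
under eq_bigr => i _ do rewrite mulr_suml.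
under [RHS]eq_bigr => i _ do rewrite mulr_suml.
rewrite exchange_big; apply: eq_bigr => i _; apply: eq_bigr => j _ /=.
by rewrite Bs mulrC mulrCA mulrC.
Qed.

End WeightForm.

(** * Heisenberg and Sugawara modes on highest-weight vectors *)

Section HighestWeight.
Variables (R : realType) (r : nat) (B : 'M[R[i]]_r).
Variables (V : lmodType R[i]) (Y : voa V) (h : 'I_r -> V).
Hypothesis Yh : heisenberg Y B h.
Implicit Types (l m k : 'rV[R]_r) (u v x y : V).

Local Notation "a @[ n ] b" := (mode Y a n b)
  (at level 9, n at level 99, b at level 9, format "a @[ n ]  b").
Local Notation sug := (sugawara Y B h).
Local Notation cosetw := (omega Y - sugawara Y B h).

Lemma wt_space_lin l a x y : wt_space Y h l x -> wt_space Y h l y ->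
  wt_space Y h l (a *: x + y).
Proof.
by move=> Hx Hy i; rewrite linearP /= Hx Hy scalerDr !scalerA [_ * a]mulrC.
Qed.

Lemma wt_space0 l : wt_space Y h l 0.
Proof. by move=> i; rewrite linear0 scaler0. Qed.

Lemma mult_space_lin l a x y : mult_space Y h l x -> mult_space Y h l y ->
  mult_space Y h l (a *: x + y).
Proof.
move=> [Hx Kx] [Hy Ky]; split; first exact: wt_space_lin.
by move=> i n; rewrite linearP /= Kx Ky scaler0 addr0.
Qed.

Lemma mult_space0 l : mult_space Y h l 0.
Proof. by split=> [|i n]; [exact: wt_space0|rewrite linear0]. Qed.

Lemma mult_space_mode l u i (n : int) : mult_space Y h l u -> 0 <= n ->
  (h i) @[n] u = if n == 0 then (l 0 i)%:C%C *: u else 0.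
Proof. by case: n => [[|n]|] // [Hu Ku] _; [exact: Hu|exact: Ku]. Qed.

Lemma mult_space0P u : (forall i (n : int), 0 <= n -> (h i) @[n] u = 0) ->
  mult_space Y h 0 u.
Proof.
move=> H; split=> [i|i n]; last by rewrite H.
by rewrite H // mxE scale0r.
Qed.

Lemma mult_space_vac : mult_space Y h 0 (vac Y).
Proof. by apply: mult_space0P => i n n0; rewrite voa_creation. Qed.

Lemma mult_space_coset : mult_space Y h 0 cosetw.
Proof. by apply: mult_space0P => i n n0; exact: (heis_coset Yh). Qed.

Lemma heis_hw l u i (m n : int) x : mult_space Y h l u ->
  (h i) @[m] (u @[n] x) = u @[n] ((h i) @[m] x) + (l 0 i)%:C%C *: u @[m + n] x.
Proof.
move=> Hu; apply: eq_add_of_subr; rewrite (@mode_comm _ _ _ _ _ 1) => [|k k1]; last first.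
  by rewrite (mult_space_mode _ Hu) // ifF //; case: k k1.
rewrite big_ord1 zbin0r scale1r (mult_space_mode _ Hu) // modeZl.
by rewrite (_ : m + n - (ord0 : 'I_1)%:Z = m + n) //= subr0.
Qed.

Lemma heis_wt l i (n : int) x : wt_space Y h l x -> wt_space Y h l ((h i) @[n] x).
Proof.
move=> Hx j; rewrite (heis_comm Yh) Hx linearZ /= mul0r if_same scale0r.
by rewrite addr0.
Qed.

Lemma hw_wt l m u n x : mult_space Y h l u -> wt_space Y h m x ->
  wt_space Y h (l + m) (u @[n] x).
Proof.
move=> Hu Hx i; rewrite (heis_hw _ _ _ _ Hu) Hx linearZ /= add0r -scalerDl.
by rewrite mxE rmorphD /= addrC.
Qed.

Lemma sugawara_mode (n : int) x : sug @[n] x = 2^-1 *: \sum_i \sum_j invmx B i j *: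
  (((h i) @[-1] (h j)) @[n] x).
Proof.
rewrite /sugawara modeZl mode_suml; congr (_ *: _); apply: eq_bigr => i _.
by rewrite mode_suml; apply: eq_bigr => j _; rewrite modeZl.
Qed.

Lemma sum_invgram_sym (F G : 'I_r -> V) l :
  (2^-1 : R[i]) *: \sum_i \sum_j invmx B i j *:
     ((l 0 j)%:C%C *: F i + (l 0 i)%:C%C *: F j) = \sum_i wt_dual B l i *: F i.
Proof.
have Bs := invgram_sym Yh.
transitivity ((2^-1 : R[i]) *: (\sum_i wt_dual B l i *: F i + \sum_i wt_dual B l i *: F i)).
  congr (_ *: _); under eq_bigr => i _.
    under eq_bigr => j _ do rewrite scalerDr !scalerA; rewrite big_split /=; over.
  rewrite big_split /=; congr (_ + _); last rewrite exchange_big /=;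
    apply: eq_bigr => i _; rewrite -scaler_suml; congr (_ *: _);
    by apply: eq_bigr => j _; rewrite mulrC // Bs.
set X := \sum_i _; have -> : X + X = 2 *: X by rewrite scaler_nat mulr2n.
by rewrite scalerA mulVf ?scale1r ?pnatr_eq0.
Qed.

Lemma sugawara_hw l u : mult_space Y h l u ->
  sug @[0] u = wt_mode B Y h l (-1) u /\ sug @[1] u = (wt_form B l l / 2) *: u.
Proof.
move=> Hu.
have e i j (n : int) : 0 <= n -> ((h i) @[-1] (h j)) @[n] u =
    if n == 0 then (l 0 j)%:C%C *: (h i) @[-1] u + (l 0 i)%:C%C *: (h j) @[-1] u
    else if n == 1 then ((l 0 i)%:C%C * (l 0 j)%:C%C) *: u else 0.
  move=> n0; have [N HN] := mode_iterate Y 0 (h i) (h j) n u.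
  have := HN N.+1 (leqnSn N); rewrite subr0 => ->.
  (* Beyond the first term of the iterate formula, a positive mode hits [u]. *)
  rewrite big_ord_recl big1 => [|p _]; last first.
    rewrite lift0 !(mult_space_mode _ Hu) ?linear0; try lia.
    by rewrite !ifF ?linear0 ?scaler0 ?addr0 ?scaler0 //; lia.
  rewrite bin0 scale1r expr0 scale1r addr0.
  transitivity ((h i) @[-1] ((h j) @[n] u) + (h j) @[n - 1] ((h i) @[0] u)).
    have ord0E : (ord0 : 'I_N.+1)%:Z = 0 by [].
    by rewrite ord0E !subr0 ?addr0.
  rewrite (mult_space_mode j Hu n0) (mult_space_mode i Hu (lexx 0)) eqxx linearZ /=.
  have [->|n0'] := eqVneq n 0; first by rewrite linearZ.
  rewrite linear0 add0r (mult_space_mode _ Hu); last by lia.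
  rewrite (_ : (n - 1 == 0) = (n == 1)); last by lia.
  by case: eqP => _; rewrite ?scaler0 // scalerA.
split; rewrite sugawara_mode.
  under eq_bigr => i _ do under eq_bigr => j _ do rewrite e //.
  exact: sum_invgram_sym.
have e1 i j : ((h i) @[-1] (h j)) @[1] u = ((l 0 i)%:C%C * (l 0 j)%:C%C) *: u.
  by rewrite e.
under eq_bigr => i _.
  under eq_bigr => j _ do rewrite e1 scalerA; rewrite -scaler_suml; over.
rewrite -scaler_suml scalerA mulrC; congr (_ * _ *: _).
rewrite /wt_form; apply: eq_bigr => i _; rewrite /wt_dual mulr_suml.
by apply: eq_bigr => j _; rewrite (invgram_sym Yh) [_ * invmx _ _ _]mulrC mulrA mulrAC.
Qed.

End HighestWeight.

(** * Homomorphisms of Fock modules as graphs *)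

Section FockWords.
Variables (R : realType) (r : nat) (B : 'M[R[i]]_r).
Variables (W V : lmodType R[i]) (YW : voa W) (Y : voa V).
Variables (hW : 'I_r -> W) (h : 'I_r -> V).
Variables (u : V) (e : W).

(* The graph [fock_tensor] is already generated by the negative modes. *)
Inductive fock_word : W -> V -> Prop :=
| WordTop : fock_word e u
| WordMode i (n : nat) f x of fock_word f x :
    fock_word (mode YW (hW i) (- n.+1%:Z) f) (mode Y (h i) (- n.+1%:Z) x)
| WordLinear (a : R[i]) f x g y of fock_word f x & fock_word g y :
    fock_word (a *: f + g) (a *: x + y).

Lemma fock_word0 : fock_word 0 0.
Proof.
have := WordLinear (-1) WordTop WordTop.
by rewrite !scaleN1r !addNr.
Qed.

Lemma fock_tensor0 : fock_tensor YW Y hW h u e 0 0.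
Proof.
have := FockLinear (-1) (FockTop YW Y hW h u e) (FockTop YW Y hW h u e).
by rewrite !scaleN1r !addNr.
Qed.

Lemma fock_wordZ a f x : fock_word f x -> fock_word (a *: f) (a *: x).
Proof. by move=> fx; have := WordLinear a fx fock_word0; rewrite !addr0. Qed.

Lemma fock_tensorZ a f x : fock_tensor YW Y hW h u e f x ->
  fock_tensor YW Y hW h u e (a *: f) (a *: x).
Proof. by move=> fx; have := FockLinear a fx fock_tensor0; rewrite !addr0. Qed.

Lemma fock_tensorD f x g y : fock_tensor YW Y hW h u e f x ->
  fock_tensor YW Y hW h u e g y -> fock_tensor YW Y hW h u e (f + g) (x + y).
Proof. by move=> fx gy; have := FockLinear 1 fx gy; rewrite !scale1r. Qed.

Lemma fock_tensor_sum (N : nat) (F : nat -> W) (X : nat -> V) :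
  (forall i, fock_tensor YW Y hW h u e (F i) (X i)) ->
  fock_tensor YW Y hW h u e (\sum_(i < N) F i) (\sum_(i < N) X i).
Proof.
move=> FX; elim: N => [|N IH]; first by rewrite !big_ord0; exact: fock_tensor0.
by rewrite !big_ord_recr; exact: fock_tensorD.
Qed.

Hypotheses (WH : heisenberg YW B hW) (VH : heisenberg Y B h).
Variable l : 'rV[R]_r.
Hypotheses (we : mult_space YW hW l e) (vu : mult_space Y h l u).

(** Nonnegative modes move inward to the top vectors. Both coordinates pick up the same scalars, as
    the form and the weight are the same on the two sides. *)
Lemma fock_word_mode i (n : int) f x : fock_word f x ->
  fock_word (mode YW (hW i) n f) (mode Y (h i) n x).
Proof.
move=> fx; case: n => [n|n]; last by rewrite NegzE; exact: WordMode.
elim: fx => [|j k {}f {}x fx IH|a {}f {}x g y fx IH gy IH'].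
- rewrite (mult_space_mode _ we) // (mult_space_mode _ vu) //.
  by case: eqP => _; [exact/fock_wordZ/WordTop|exact: fock_word0].
- rewrite (heis_comm WH) (heis_comm VH) addrC [X in fock_word _ X]addrC.
  exact: WordLinear (WordMode _ _ IH).
- by rewrite !linearP; exact: WordLinear.
Qed.

Lemma fock_tensor_word f x : fock_tensor YW Y hW h u e f x -> fock_word f x.
Proof.
elim=> [|i n {}f {}x _ IH|a {}f {}x g y _ IH _ IH'].
- exact: WordTop.
- exact: fock_word_mode.
- exact: WordLinear.
Qed.

Lemma fock_tensor_wt f x : fock_tensor YW Y hW h u e f x -> wt_space Y h l x.
Proof.
elim=> [|i n {}f {}x _ IH|a {}f {}x g y _ IH _ IH'].
- by case: vu.
- exact: (heis_wt VH).
- exact: wt_space_lin.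
Qed.

End FockWords.

(** * The Sugawara grading and the projection P *)

Section JointEigenspaces.
Variables (R : realType) (r : nat) (B : 'M[R[i]]_r).
Variables (V : lmodType R[i]) (Y : voa V) (h : 'I_r -> V).
Hypothesis Yh : heisenberg Y B h.
Implicit Types (l m k : 'rV[R]_r) (u v x y : V).

Local Notation "a @[ n ] b" := (mode Y a n b)
  (at level 9, n at level 99, b at level 9, format "a @[ n ]  b").
Local Notation sug := (sugawara Y B h).
Local Notation cosetw := (omega Y - sugawara Y B h).

(* The part of degree d (by the Sugawara grading) of the Fock modules of highest
   weight l. *)
Definition fock_degree (p : 'rV[R]_r * int) : set V :=
  [set v | wt_space Y h p.1 v /\
     sug @[1] v = (wt_form B p.1 p.1 / 2 + p.2%:~R) *: v].

(** The consequence of semisimplicity on which the projection rests. It holds for the lattice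
    algebra too, so one theory covers both algebras. *)
Definition fock_spanned := forall v, v \in span
  [set w | exists l u, mult_space Y h l u /\ heis_gen Y h u w].

Lemma fock_degree0 p : fock_degree p 0.
Proof. by split; [exact: wt_space0|rewrite linear0 scaler0]. Qed.

Lemma fock_degree_lin : summand fock_degree.
Proof.
move=> p a x y [wx sx] [wy sy]; split; first exact: wt_space_lin.
by rewrite linearP /= sx sy scalerDr !scalerA [a * _]mulrC.
Qed.

Lemma fock_degree_sep : separated fock_degree.
Proof.
move=> [l d] [m c] ne; have [lm|lm] := eqVneq l m.
  exists (mode Y sug 1), (fun p => wt_form B p.1 p.1 / 2 + p.2%:~R).
  split=> [p y [] //|]; rewrite lm /= (inj_eq (addrI _)) eqr_int.
  by apply: contra_neq ne => ->; rewrite lm.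
have [i li] : exists i, l 0 i != m 0 i.
  apply/existsP; rewrite -negb_forall; apply: contra_neqN lm => /forallP H.
  by apply/rowP => i; apply/eqP.
exists (mode Y (h i) 0), (fun p : 'rV[R]_r * int => (p.1 0 i)%:C%C).
split=> [p y [wy _]|] /=; first exact: wy.
apply/eqP => e; case/eqP: li; exact: complexI e.
Qed.

Lemma fock_degree_mode l d i (n : int) x : fock_degree (l, d) x ->
  fock_degree (l, d - n) ((h i) @[n] x).
Proof.
move=> [wx sx]; split; first exact: (heis_wt Yh).
rewrite (sugawara_heis Yh) sx linearZ /= -scalerBl rmorphB /=.
by rewrite addrA.
Qed.

Lemma fock_degree_hw l u : mult_space Y h l u -> fock_degree (l, 0) u.
Proof.
move=> Hu; split; first by case: Hu.
by rewrite addr0; have [] := sugawara_hw Yh Hu.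
Qed.

Lemma heis_gen_tensor u w : heis_gen Y h u w -> fock_tensor Y Y h h u u w w.
Proof.
move=> /(_ (fun x => `[< fock_tensor Y Y h h u u x x >])) H; apply/asboolP/H.
- split; last by move=> i n x /asboolP wx; apply/asboolP; exact: FockMode.
  split; first by apply/asboolP; exact: fock_tensor0.
  by move=> a x y /asboolP wx /asboolP wy; apply/asboolP; exact: FockLinear.
- by apply/asboolP; exact: FockTop.
Qed.

Hypothesis Vsp : fock_spanned.

Lemma span_fock_degree v :
  v \in span (\bigcup_(p in [set p : 'rV[R]_r * int | 0 <= p.2]) fock_degree p).
Proof.
set S := span _; have [S0 Sl] := span_submod_closed
  (\bigcup_(p in [set p : 'rV[R]_r * int | 0 <= p.2]) fock_degree p).
move: v (Vsp v); apply: span_ind => [||x [l [u [Hu /heis_gen_tensor]]]].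
- exact: S0.
- exact: Sl.
move=> /(fock_tensor_word Yh Yh Hu Hu); elim => [|i n f {}x _ IH|a f {}x g y _ IH _ IH'].
- by apply: mem_span; exists (l, 0) => //; exact: fock_degree_hw.
- move: x IH; apply: span_ind => [|a x y IH IH'|x [[m d] /= d0 Hx]].
  + by rewrite linear0; exact: S0.
  + by rewrite linearP; exact: Sl.
  + apply: mem_span; exists (m, d + n.+1%:Z); first by rewrite /=; lia.
    by rewrite -[n.+1%:Z]opprK; exact: fock_degree_mode.
- exact: Sl.
Qed.

Lemma span_fock_degreeT v : v \in span (\bigcup_(p in setT) fock_degree p).
Proof.
move: v (span_fock_degree v).
apply: span_ind => [|a x y|x [p _ Hx]].
- by have [] := span_submod_closed (\bigcup_(p in setT) fock_degree p).
- by have [_] := span_submod_closed (\bigcup_(p in setT) fock_degree p); exact.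
- by apply: mem_span; exists p.
Qed.

(** The nonnegative degrees span, so x is a combination of summands other than its own. Positive
    modes lower the degree, and therefore vectors of degree 0 are highest-weight vectors. *)
Lemma fock_degree_neg l d x : d < 0 -> fock_degree (l, d) x -> x = 0.
Proof.
move=> d0 Hx.
apply: (rest_indep span_fock_degreeT fock_degree_sep Hx).
have [S0 Sl] := span_submod_closed
  (\bigcup_(m in [set m | m != (l, d)]) fock_degree m).
move: x {Hx} (span_fock_degree x); apply: span_ind => [||x [[m c] /= c0 Hx]].
- exact: S0.
- exact: Sl.
- by apply: (restP Hx); apply/eqP => -[_ e]; move: c0 d0; rewrite e; lia.
Qed.

(* The projection of the weight space l onto its highest-weight vectors along
   the images of the negative modes. *)
Definition hwproj l v := proj fock_degree (l, 0) v.

Lemma hwproj_linear l : linear (hwproj l).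
Proof.
exact: (proj_linear fock_degree0 fock_degree_lin span_fock_degreeT fock_degree_sep).
Qed.

Lemma hwproj_in l v : mult_space Y h l (hwproj l v).
Proof.
have [wp sp] : fock_degree (l, 0) (hwproj l v).
  exact: (proj_in fock_degree0 fock_degree_lin span_fock_degreeT).
split=> // i n; apply: (@fock_degree_neg l (0 - n.+1%:Z)); first by lia.
exact: fock_degree_mode.
Qed.

Lemma hwproj_id l v : mult_space Y h l v -> hwproj l v = v.
Proof.
move=> /fock_degree_hw.
exact: (proj_id fock_degree0 fock_degree_lin span_fock_degreeT fock_degree_sep).
Qed.

Lemma hwproj_other l m v : mult_space Y h m v -> m != l -> hwproj l v = 0.
Proof.
move=> /fock_degree_hw Hv ml.
apply: (proj_rest fock_degree0 fock_degree_lin span_fock_degreeT fock_degree_sep).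
by apply: (restP Hv); apply: contra_neq ml => -[].
Qed.

(** The component of degree 0 comes from a component of v of negative degree. *)
Lemma hwproj_neg l i n v : hwproj l ((h i) @[- n.+1%:Z] v) = 0.
Proof.
have gI : injective (fun p : 'rV[R]_r * int => (p.1, p.2 + n.+1%:Z)).
  by move=> [l1 d1] [l2 d2] /= [-> /addIr ->].
have shift (p : 'rV[R]_r * int) x : fock_degree p x ->
    fock_degree (p.1, p.2 + n.+1%:Z) ((h i) @[- n.+1%:Z] x).
  by case: p => m d Hx; rewrite -[n.+1%:Z]opprK; exact: fock_degree_mode.
have := proj_shift fock_degree0 fock_degree_lin span_fock_degreeT fock_degree_sep
  (T := mode Y (h i) (- n.+1%:Z)) (l, - n.+1%:Z) v gI shift.
rewrite /= addNr /hwproj => ->.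
rewrite (@fock_degree_neg l (- n.+1%:Z) (proj _ _ _)) ?linear0 //.
exact: (proj_in fock_degree0 fock_degree_lin span_fock_degreeT).
Qed.

Lemma hwproj_coset l n v : hwproj l (cosetw @[n] v) = cosetw @[n] (hwproj l v).
Proof.
apply: (proj_shift fock_degree0 fock_degree_lin span_fock_degreeT fock_degree_sep
  (T := mode Y cosetw n) (g := id)) => // p x [wx sx]; split.
  by move=> i; rewrite -(coset_heis Yh) wx linearZ.
by rewrite -(coset_sugawara Yh) sx linearZ.
Qed.

Lemma hwproj_omega l v : hwproj l ((omega Y) @[1] v) = (omega Y) @[1] (hwproj l v).
Proof.
apply: (proj_shift fock_degree0 fock_degree_lin span_fock_degreeT fock_degree_sep
  (T := mode Y (omega Y) 1) (g := id)) => // p x [wx sx].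
have oE y : (omega Y) @[1] y = cosetw @[1] y + sug @[1] y by rewrite modeBl subrK.
split=> [i|].
  by rewrite -linearZ /= -wx (omega_heis Yh) scale0r subr0.
by rewrite /= !oE linearD /= -(coset_sugawara Yh) sx !linearZ /= sx scalerDr.
Qed.

Lemma hwproj_support v : exists s : seq 'rV[R]_r, forall l, l \notin s -> hwproj l v = 0.
Proof.
have [s Hs] := proj_support fock_degree0 fock_degree_lin span_fock_degreeT fock_degree_sep v.
exists [seq p.1 | p <- s] => l ls; apply: Hs; apply: contra ls => Hp.
by apply/mapP; exists (l, 0).
Qed.

End JointEigenspaces.

(** * Exponentials of creation operators *)

Section Schur.
Variables (R : realType) (r : nat) (B : 'M[R[i]]_r).
Variables (V : lmodType R[i]) (Y : voa V) (h : 'I_r -> V).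
Implicit Types (l m k : 'rV[R]_r) (u v x y : V).

Local Notation "a @[ n ] b" := (mode Y a n b)
  (at level 9, n at level 99, b at level 9, format "a @[ n ]  b").

Lemma wt_mode_linear l (n : int) : linear (wt_mode B Y h l n).
Proof.
move=> a x y; rewrite /wt_mode scaler_sumr -big_split; apply: eq_bigr => i _ /=.
by rewrite linearP scalerDr !scalerA mulrC.
Qed.

HB.instance Definition _ l n :=
  GRing.isLinear.Build R[i] V V *:%R (wt_mode B Y h l n) (wt_mode_linear l n).

(** The recursion needs all smaller indices and is not structural; [fuel] makes it so and is removed
    by [schur_fuel]. *)
Fixpoint schur_rec l (fuel j : nat) v : V :=
  if fuel is f.+1 then
    if j is j'.+1 then
      j%:R^-1 *: \sum_(p < j) wt_mode B Y h l (- p.+1%:Z) (schur_rec l f (j' - p) v)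
    else v
  else v.

(* The coefficient of z^j in exp (sum_(n >= 1) l(-n) z^n / n), computed by
   recursion on j from the logarithmic derivative of the exponential. *)
Definition schur l j v := schur_rec l j j v.

Lemma schur_fuel l f j v : (j <= f)%N -> schur_rec l f j v = schur l j v.
Proof.
rewrite /schur; elim/ltn_ind: j f => -[|j] IH [|f] // jf /=.
congr (_ *: _); apply: eq_bigr => p _; congr wt_mode.
by rewrite IH ?[in RHS]IH //; lia.
Qed.

Lemma schur0 l v : schur l 0 v = v. Proof. by []. Qed.

Lemma schurS l j v : j.+1%:R *: schur l j.+1 v =
  \sum_(p < j.+1) wt_mode B Y h l (- p.+1%:Z) (schur l (j - p) v).
Proof.
rewrite /schur /= scalerA mulfV ?pnatr_eq0 // scale1r; apply: eq_bigr => p _.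
by rewrite schur_fuel // leq_subr.
Qed.

Hypothesis Yh : heisenberg Y B h.

Lemma wt_dual_gram l i : \sum_a wt_dual B l a * B i a = (l 0 i)%:C%C.
Proof.
rewrite /wt_dual; under eq_bigr => a _ do rewrite mulr_suml.
rewrite exchange_big (bigD1 i) //= [X in _ + X]big1 => [|j /negbTE ji].
  under eq_bigr => a _ do rewrite -mulrA.
  by rewrite -mulr_sumr (sum_invgram Yh) eqxx mulr1 addr0.
under eq_bigr => a _ do rewrite -mulrA.
by rewrite -mulr_sumr (sum_invgram Yh) ji mulr0.
Qed.

Lemma wt_mode_wt l m (n : int) x : wt_space Y h m x ->
  wt_space Y h m (wt_mode B Y h l n x).
Proof.
move=> Hx; rewrite /wt_mode; apply: (big_ind (wt_space Y h m)).
- exact: wt_space0.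
- by move=> y z Hy Hz; rewrite -[y]scale1r; exact: wt_space_lin.
- move=> i _; rewrite -[_ *: _]addr0; apply: wt_space_lin; last exact: wt_space0.
  exact: (heis_wt Yh).
Qed.

Lemma schur_wt l m j x : wt_space Y h m x -> wt_space Y h m (schur l j x).
Proof.
move=> Hx; elim/ltn_ind: j => -[|j] IH //.
have -> : schur l j.+1 x = j.+1%:R^-1 *: (j.+1%:R *: schur l j.+1 x).
  by rewrite scalerA mulVf ?scale1r ?pnatr_eq0.
rewrite schurS -[_ *: _]addr0; apply: wt_space_lin; last exact: wt_space0.
apply: (big_ind (wt_space Y h m)) => [|y z Hy Hz|p _]; first exact: wt_space0.
  by rewrite -[y]scale1r; exact: wt_space_lin.
by apply/wt_mode_wt/IH; rewrite ltnS leq_subr.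
Qed.

Lemma heis_wt_mode l i (n p : int) x : (h i) @[n] (wt_mode B Y h l p x) =
  wt_mode B Y h l p ((h i) @[n] x) +
  (if n + p == 0 then n%:~R * (l 0 i)%:C%C else 0) *: x.
Proof.
rewrite /wt_mode linear_sum /= -(wt_dual_gram l i).
under eq_bigr => a _ do rewrite linearZ /= (heis_comm Yh) scalerDr scalerA.
rewrite big_split /=; congr (_ + _); rewrite -scaler_suml; congr (_ *: _).
case: ifP => _; last by rewrite big1 // => a _; rewrite mulr0.
by rewrite mulr_sumr; apply: eq_bigr => a _; rewrite mulrCA.
Qed.

(** On generating series, h_i(p + 1) applied to the exponential gives the factor l_i z^(p + 1),
    because [h_i(n), l(-n)] = n l_i. In the recursion, j + 1 splits as p + 1 from this bracket and j
    - p from the induction hypothesis. *)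
Lemma heis_schur l m i p j x : mult_space Y h m x ->
  (h i) @[p.+1%:Z] (schur l j x) =
  if (p < j)%N then (l 0 i)%:C%C *: schur l (j - p.+1) x else 0.
Proof.
move=> Hx; elim/ltn_ind: j => -[|j] IH; first by rewrite (mult_space_mode _ Hx).
have nz : (j.+1%:R : R[i]) != 0 by rewrite pnatr_eq0.
apply: (scalerI nz); rewrite -linearZ schurS linear_sum /=.
under eq_bigr => q _ do rewrite heis_wt_mode IH ?ltnS ?leq_subr //.
rewrite big_split /= ltnS; case: leqP => pj; last first.
  rewrite scaler0 !big1 ?addr0 // => q _.
    by rewrite ifF ?scale0r //; have := ltn_ord q; lia.
  by rewrite ifF ?linear0 //; lia.
have -> : \sum_(q < j.+1) (if p.+1%:Z + - q.+1%:Z == 0 then p.+1%:~R * (l 0 i)%:C%C else 0)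
    *: schur l (j - q) x = (p.+1%:R * (l 0 i)%:C%C) *: schur l (j - p) x.
  have pj' : (p < j.+1)%N by [].
  rewrite (bigD1 (Ordinal pj')) //= subrr eqxx big1 ?addr0 // => q.
  by rewrite -val_eqE /= => qp; rewrite ifF ?scale0r //; lia.
have -> : \sum_(q < j.+1) wt_mode B Y h l (- q.+1%:Z)
    (if (p < j - q)%N then (l 0 i)%:C%C *: schur l (j - q - p.+1) x else 0) =
    (l 0 i)%:C%C *: ((j - p)%:R *: schur l (j - p) x).
  rewrite (bigID (fun q : 'I_j.+1 => (q < j - p)%N)) /= [X in _ + X]big1 ?addr0; last first.
    by move=> q; rewrite -leqNgt => qp; rewrite ifF ?linear0 //; lia.
  rewrite -(big_ord_widen_cond j.+1 xpredT (fun q => wt_mode B Y h l (- q.+1%:Z)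
    (if (p < j - q)%N then (l 0 i)%:C%C *: schur l (j - q - p.+1) x else 0))); last by lia.
  case e : (j - p)%N => [|c]; first by rewrite big_ord0 scale0r scaler0.
  rewrite schurS scaler_sumr; apply: eq_bigr => q _.
  have qc := ltn_ord q; rewrite ifT; last by lia.
  by rewrite linearZ /=; congr (_ *: wt_mode B Y h l _ (schur l _ _)); lia.
rewrite scalerA -scalerDl scalerA subSS; congr (_ *: _).
rewrite [_ * (l 0 i)%:C%C]mulrC -mulrDr mulrC -natrD; congr (_%:R * _).
by lia.
Qed.

Hypothesis Vsp : fock_spanned Y h.
Local Notation hwproj := (hwproj B Y h).

Let hwlin k := hwproj_linear Yh Vsp k.

Lemma hwprojD k x y : hwproj k (x + y) = hwproj k x + hwproj k y.
Proof. by have := hwlin k 1 x y; rewrite !scale1r. Qed.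

Lemma hwproj0 k : hwproj k 0 = 0.
Proof. by rewrite (hwproj_id Yh Vsp) //; exact: mult_space0. Qed.

Lemma hwprojZ k a x : hwproj k (a *: x) = a *: hwproj k x.
Proof. by have := hwlin k a x 0; rewrite hwproj0 !addr0. Qed.

Lemma hwprojB k x y : hwproj k (x - y) = hwproj k x - hwproj k y.
Proof. by rewrite hwprojD -[- y]scaleN1r hwprojZ scaleN1r. Qed.

Lemma hwproj_sum k I (s : seq I) (P : pred I) (F : I -> V) :
  hwproj k (\sum_(i <- s | P i) F i) = \sum_(i <- s | P i) hwproj k (F i).
Proof.
by apply: (big_morph (hwproj k)) => [x y|]; [exact: hwprojD|exact: hwproj0].
Qed.

Lemma hwproj_wt_mode k l p x : hwproj k (wt_mode B Y h l (- p.+1%:Z) x) = 0.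
Proof.
rewrite /wt_mode hwproj_sum big1 // => i _.
by rewrite hwprojZ (hwproj_neg Yh Vsp) scaler0.
Qed.

Lemma hwproj_schurS k l j x : hwproj k (schur l j.+1 x) = 0.
Proof.
have nz : (j.+1%:R : R[i]) != 0 by rewrite pnatr_eq0.
apply: (scalerI nz); rewrite -hwprojZ schurS hwproj_sum scaler0.
by rewrite big1 // => p _; rewrite hwproj_wt_mode.
Qed.

(* The difference of both sides is killed by the positive modes and by the
   projection, by induction on the number M of terms. *)
Lemma schur_expansion (y : int -> V) l k (N : int) :
  (forall n, wt_space Y h k (y n)) ->
  (forall i p n, (h i) @[p.+1%:Z] (y n) = (l 0 i)%:C%C *: y (n + p.+1%:Z)) ->
  (forall n, N <= n -> y n = 0) ->
  forall (M : nat) (n : int), N <= n + M%:Z ->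
  y n = \sum_(j < M) schur l j (hwproj k (y (n + j%:Z))).
Proof.
move=> ywt yh yN; elim/ltn_ind => M IH n NM.
apply/eqP; rewrite -subr_eq0; apply/eqP; set d := _ - _.
have Hp j : mult_space Y h k (hwproj k (y (n + j%:Z))) by exact: (hwproj_in Yh Vsp).
have dh : mult_space Y h k d.
  split=> [|i p].
    rewrite /d addrC -scaleN1r; apply: wt_space_lin => //.
    apply: (big_ind (wt_space Y h k)) => [|a b Ha Hb|j _]; first exact: wt_space0.
      by rewrite -[a]scale1r; exact: wt_space_lin.
    by apply: schur_wt; case: (Hp j).
  rewrite linearB linear_sum /= yh.
  under eq_bigr => j _ do rewrite (heis_schur _ _ _ _ (Hp j)).
  case: (leqP M p) => [Mp|pM].
    rewrite yN ?scaler0 ?sub0r ?big1 ?oppr0 //; last by lia.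
    by move=> j _; rewrite ifF //; have := ltn_ord j; lia.
  (* The positive mode shifts n by p + 1, after which M - p - 1 terms suffice; [heis_schur] shifts
     the index of the other sum by the same amount. *)
  rewrite (IH (M - p.+1)%N _ (n + p.+1%:Z)); try lia.
  pose F j := if (p < j)%N then
    (l 0 i)%:C%C *: schur l (j - p.+1) (hwproj k (y (n + j%:Z))) else 0.
  apply/eqP; rewrite subr_eq0; apply/eqP; symmetry.
  rewrite -(big_mkord xpredT F) (big_cat_nat (n := p.+1)) //= big_nat big1 => [|j]; last first.
    by rewrite /F ltnS => jp; rewrite ifF //; lia.
  rewrite add0r -{1}[p.+1]add0n big_addn big_mkord scaler_sumr.
  apply: eq_bigr => j _; rewrite /F ifT ?addnK; last by lia.
  by have -> : n + (j + p.+1)%:Z = n + p.+1%:Z + j%:Z by lia.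
rewrite -(hwproj_id Yh Vsp dh) hwprojB hwproj_sum; case: M IH NM @d dh => [|M] IH NM d dh.
  by rewrite big_ord0 yN ?hwproj0 ?subr0 //; lia.
rewrite big_ord_recl schur0 (hwproj_id Yh Vsp (Hp 0%N)) big1 => [|j _].
  by rewrite addr0 /= addr0 subrr.
exact: hwproj_schurS.
Qed.

End Schur.

(** * Multiplication by powers of 1 - w/z *)

Section Twist.
Variables (K : numFieldType) (V : lmodType K).
Implicit Types (H : int -> int -> V) (k : K).

(* The coefficient of t^j in (1 - t)^k. *)
Definition acoef k (j : nat) : K := \prod_(i < j) ((i%:R - k) / i.+1%:R).

Lemma acoefS k j : j.+1%:R * acoef k j.+1 = (j%:R - k) * acoef k j.
Proof.
rewrite /acoef big_ord_recr /= [_ * (_ / _)]mulrC mulrA mulrCA mulfV ?mulr1 //.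
by rewrite pnatr_eq0.
Qed.

Lemma acoef0 k : acoef k 0 = 1. Proof. exact: big_ord0. Qed.

(** The differential equation d/dt (1 - t)^k = - k (1 - t)^k / (1 - t), in the shape that matches
    [schurS]. *)
Lemma acoef_sum k j : j.+1%:R * acoef k j.+1 = - k * \sum_(i < j.+1) acoef k i.
Proof.
elim: j => [|j IH]; first by rewrite acoefS big_ord1 acoef0 !mulr1 sub0r.
by rewrite acoefS big_ord_recr /= mulrDr -IH -mulrDl.
Qed.

Lemma acoef0l j : acoef 0 j.+1 = 0.
Proof. by rewrite /acoef big_ord_recl subr0 mul0r mul0r. Qed.

Lemma acoef_pascal k j : acoef k j.+1 - acoef k j = acoef (k + 1) j.+1.
Proof.
have nz (i : nat) : (i.+1%:R : K) != 0 by rewrite pnatr_eq0.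
have e : j.+1%:R * (acoef k j.+1 - acoef k j) = (- k - 1) * acoef k j.
  by rewrite mulrBr acoefS -mulrBl; congr (_ * _); rewrite -natr1; ring.
apply: (mulfI (nz j)); rewrite e; elim: j {e} => [|j IH].
  by rewrite acoefS !acoef0; ring.
rewrite acoefS; apply: (mulfI (nz j)); rewrite mulrCA acoefS.
by rewrite [RHS]mulrCA -IH -natr1; ring.
Qed.

(* Multiplication by (1 - w / z)^k. *)
Definition twist k H (a b : int) :=
  fsum (fun j : nat => acoef k j *: H (a - j%:Z) (b + j%:Z)).

Definition eventually0 H := exists N : int, forall a b, N <= b -> H a b = 0.

Lemma twist_vanish k H N (a b : int) : (forall a b, N <= b -> H a b = 0) ->
  vanish_from `|N - b|%N (fun j : nat => acoef k j *: H (a - j%:Z) (b + j%:Z)).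
Proof. by move=> HN j jN; rewrite HN ?scaler0 //; lia. Qed.

Lemma twist_step k H a b : eventually0 H ->
  twist k H a b - twist k H (a - 1) (b + 1) = twist (k + 1) H a b.
Proof.
move=> [N HN]; rewrite /twist.
have v1 := @twist_vanish k H N a b HN; have v2 := @twist_vanish k H N (a - 1) (b + 1) HN.
have v3 := @twist_vanish (k + 1) H N a b HN.
rewrite [X in X - _]fsum_recl; last by exists `|N - b|%N.
rewrite [RHS]fsum_recl; last by exists `|N - b|%N.
rewrite !acoef0 !scale1r -addrA; congr (_ + _).
have [M hM] : exists M, forall j : nat, (M <= j)%N -> N <= b + j%:Z.
  by exists `|N - b|%N => j; lia.
have big (f : nat -> V) : (forall j, (M <= j)%N -> f j = 0) -> fsum f = \sum_(j < M) f j.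
  by move=> f0; exact: fsumE.
rewrite (big (fun j => acoef k j.+1 *: _)) => [|j jM]; last first.
  by rewrite HN ?scaler0 //; have := hM j jM; lia.
rewrite (big (fun j => acoef (k + 1) j.+1 *: _)) => [|j jM]; last first.
  by rewrite HN ?scaler0 //; have := hM j jM; lia.
rewrite (big (fun j => acoef k j *: H (a - 1 - j%:Z) _)) => [|j jM]; last first.
  by rewrite HN ?scaler0 //; have := hM j jM; lia.
rewrite -sumrB; apply: eq_bigr => j _.
have -> : a - 1 - j%:Z = a - j.+1%:Z by lia.
have -> : b + 1 + j%:Z = b + j.+1%:Z by lia.
by rewrite -scalerBl acoef_pascal.
Qed.

(** Since z - w = z (1 - w/z), each factor raises the exponent of the twist by one and shifts the
    index of z. *)
Lemma iter_zw_twist k H c a b : eventually0 H ->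
  iter c (@zw V) (twist k H) (a - c%:Z) b = twist (k + c%:R) H a b.
Proof.
move=> H0; elim: c k a b => [|c IH] k a b; first by rewrite !addr0.
rewrite iterSr; have -> : zw (twist k H) = fun a b => twist (k + 1) H (a + 1) b.
  apply/funext => u; apply/funext => v; rewrite -(twist_step _ _ _ H0) /zw.
  by rewrite addrK.
have shift (f : int -> int -> V) d u v : iter d (@zw V) (fun a b => f (a + 1) b) u v =
    iter d (@zw V) f (u + 1) v.
  by elim: d u v => //= d IHd u v; rewrite /zw !IHd.
rewrite shift (_ : a - c.+1%:Z + 1 = a - c%:Z); last by lia.
by rewrite IH -natr1 [c%:R + 1]addrC addrA.
Qed.

Lemma twist0 H a b : twist 0 H a b = H a b.
Proof.
rewrite /twist (@fsumE _ _ 1%N) => [|[//|j] _]; last by rewrite acoef0l scale0r.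
rewrite big_ord1 acoef0 scale1r.
by have -> : (ord0 : 'I_1)%:Z = 0 by []; rewrite ?subr0 ?addr0.
Qed.

End Twist.

Section TwistedLocality.
Variables (K : numFieldType) (V : lmodType K).
Implicit Types (f H G : int -> int -> V).

Definition swap f := fun a b => f b a.

Lemma iter_zw_shift f d (s t u v : int) :
  iter d (@zw V) (fun a b => f (a + s) (b + t)) u v =
  iter d (@zw V) f (u + s) (v + t).
Proof.
elim: d u v => //= d IH u v; rewrite /zw !IH.
by rewrite [u + 1 + s]addrAC [v + 1 + t]addrAC.
Qed.

Lemma iter_zw_swap f d a b :
  iter d (@zw V) (swap f) a b = (-1) ^+ d *: iter d (@zw V) f b a.
Proof.
elim: d a b => [|d IH] a b; first by rewrite scale1r.
by rewrite !iterS /zw !IH exprS -scalerBr mulN1r scaleNr -scalerN opprB.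
Qed.

Lemma iter_zwZ f d (c : K) : iter d (@zw V) (fun a b => c *: f a b) =
  fun a b => c *: iter d (@zw V) f a b.
Proof.
elim: d => //= d ->; apply/funext => a; apply/funext => b.
by rewrite /zw scalerBr.
Qed.

Lemma iter_zw_untwist k H c a b : eventually0 H -> k + c%:R = 0 ->
  iter c (@zw V) (twist k H) a b = H (a + c%:Z) b.
Proof.
by move=> H0 kc; rewrite -[a in LHS](addrK c%:Z) iter_zw_twist // kc twist0.
Qed.

Lemma iter_zw_pos H c a b : eventually0 H ->
  iter c (@zw V) H a b = twist c%:R H (a + c%:Z) b.
Proof.
move=> H0; rewrite -[a in LHS](addrK c%:Z) -[H in LHS](_ : twist 0 H = H).
  by rewrite iter_zw_twist // add0r.
by apply/funext => u; apply/funext => v; rewrite twist0.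
Qed.

Lemma iter_zw_swap2 f d a b :
  iter d (@zw V) f a b = (-1) ^+ d *: iter d (@zw V) (swap f) b a.
Proof. by rewrite -[f in LHS]/(swap (swap f)) iter_zw_swap. Qed.

(* Since (1 - w/z)^k z^k and (1 - z/w)^k w^k differ by the sign (-1)^k, twisting
   by these series preserves locality up to this sign. *)
Lemma twisted_locality (k : int) H1 H2 G1 G2 N :
  eventually0 H1 -> eventually0 (swap H2) ->
  G1 = twist k%:~R H1 -> swap G2 = twist k%:~R (swap H2) ->
  iter N (@zw V) (G1 - G2) = 0 ->
  iter (N + `|k|) (@zw V)
    (fun a b => H1 (a - k) b - (-1) ^+ `|k|%N *: H2 a (b - k)) = 0.
Proof.
move=> H10 H20 G1E G2E GN.
have sgn (c : nat) (x : V) : (-1) ^+ c *: ((-1) ^+ c *: x) = x.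
  by rewrite scalerA -expr2 sqrr_sign scale1r.
have G2ba a b : G2 a b = twist k%:~R (swap H2) b a by rewrite -G2E.
(* For k = c, the factor (z - w)^c turns the untwisted difference into G1 - G2; for k = - c, it
   turns G1 - G2 into the untwisted difference. *)
have [c [kc|kc]] : exists c : nat, k = c%:Z \/ k = - c%:Z.
- by exists `|k|%N; lia.
- have -> : `|k|%N = c by lia.
  rewrite iterD [X in iter N _ X](_ : _ = G1 - G2) //.
  have -> : (fun a b => H1 (a - k) b - (-1) ^+ c *: H2 a (b - k)) =
      (fun a b => H1 (a - k) (b + 0)) - (fun a b => (-1) ^+ c *: H2 (a + 0) (b - k)).
    by apply/funext => a; apply/funext => b; rewrite !fctE !addr0.
  rewrite (iter_morphB _ (@zwB V)).
  apply/funext => a; apply/funext => b; rewrite !fctE.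
  rewrite (iter_zwZ (fun a b => H2 (a + 0) (b - k))) !iter_zw_shift !addr0 G2ba G1E kc.
  rewrite (iter_zw_swap2 H2) sgn !iter_zw_pos //.
  by rewrite !subrK.
have -> : `|k|%N = c by lia.
have k0 : k%:~R + c%:R = 0 :> K by rewrite kc mulrNz addNr.
have -> : (fun a b => H1 (a - k) b - (-1) ^+ c *: H2 a (b - k)) =
    iter c (@zw V) (G1 - G2).
  rewrite (iter_morphB _ (@zwB V)).
  apply/funext => a; apply/funext => b; rewrite !fctE G1E iter_zw_untwist //.
  rewrite (iter_zw_swap2 G2) G2E iter_zw_untwist // kc opprK.
  by [].
rewrite addnC iterD -[X in iter c _ X]iterD addnC iterD GN.
by rewrite !iter_zw0.
Qed.

End TwistedLocality.

(** * Compositions of projected modes *)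

Section ProjectedModes.
Variables (R : realType) (r : nat) (B : 'M[R[i]]_r).
Variables (V : lmodType R[i]) (Y : voa V) (h : 'I_r -> V).
Hypotheses (Yh : heisenberg Y B h) (Vsp : fock_spanned Y h).
Implicit Types (l m k : 'rV[R]_r) (u v x y : V).

Local Notation "a @[ n ] b" := (mode Y a n b)
  (at level 9, n at level 99, b at level 9, format "a @[ n ]  b").
Local Notation hwproj := (hwproj B Y h).
Local Notation cosetw := (omega Y - sugawara Y B h).

Lemma mode_wt_mode l m u (n p : int) x : mult_space Y h l u ->
  u @[n] (wt_mode B Y h m p x) =
  wt_mode B Y h m p (u @[n] x) - wt_form B m l *: u @[n + p] x.
Proof.
move=> Hu; rewrite /wt_mode linear_sum /wt_form scaler_suml -sumrB.
apply: eq_bigr => i _; rewrite linearZ /= (heis_hw _ _ _ _ Hu) scalerDr scalerA.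
by rewrite [p + n]addrC addrK.
Qed.

(** Moving exp (sum_n m(-n) w^n / n) to the left past Y(u, z) costs the factor (1 - w/z)^((m, l));
    once leftmost, the projection replaces it by 1. *)
Lemma hwproj_mode_schur k l m u (n : int) j x : mult_space Y h l u ->
  hwproj k (u @[n] (schur B Y h m j x)) =
  acoef (wt_form B m l) j *: hwproj k (u @[n - j%:Z] x).
Proof.
move=> Hu; elim/ltn_ind: j n => -[|j] IH n.
  by rewrite acoef0 scale1r schur0; have -> : n - 0%:Z = n by lia.
have nz : (j.+1%:R : R[i]) != 0 by rewrite pnatr_eq0.
apply: (scalerI nz); rewrite scalerA acoef_sum.
rewrite -(hwprojZ Yh Vsp) -linearZ schurS linear_sum (hwproj_sum Yh Vsp) /=.
rewrite mulr_sumr scaler_suml (reindex_inj rev_ord_inj) /=; apply: eq_bigr => p _.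
have pj := ltn_ord p.
rewrite (mode_wt_mode _ _ _ _ Hu) (hwprojB Yh Vsp) (hwproj_wt_mode Yh Vsp) sub0r.
rewrite (hwprojZ Yh Vsp) IH; last by lia.
rewrite scalerA mulNr scaleNr subSS; congr (- (_ * acoef _ _ *: hwproj _ (mode _ _ _ _))); lia.
Qed.

Lemma hw_expansion l m u v (N : int) : mult_space Y h l u -> mult_space Y h m v ->
  (forall n, N <= n -> u @[n] v = 0) ->
  forall (M : nat) (n : int), N <= n + M%:Z ->
  u @[n] v = \sum_(j < M) schur B Y h l j (hwproj (l + m) (u @[n + j%:Z] v)).
Proof.
move=> Hu Hv HN.
apply: (@schur_expansion _ _ _ _ _ _ Yh Vsp (fun n => u @[n] v)) => // [n|i p n].
  by apply: (hw_wt _ Hu); case: Hv.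
rewrite (heis_hw _ _ _ _ Hu) (mult_space_mode _ Hv) // linear0 add0r.
by rewrite addrC.
Qed.

Lemma hwproj_twist l m k p u v x :
  mult_space Y h l u -> mult_space Y h m v -> mult_space Y h k x ->
  (fun a b => hwproj p (u @[a] (v @[b] x))) =
  twist (wt_form B m l) (fun a b => hwproj p (u @[a] (hwproj (m + k) (v @[b] x)))).
Proof.
move=> Hu Hv Hx; apply/funext => a; apply/funext => b.
have [N HN] := mode_truncN Y v x.
rewrite (hw_expansion Hv Hx HN (M := `|N%:Z - b|%N)); last by lia.
rewrite linear_sum (hwproj_sum Yh Vsp) /twist.
have H0 (c d : int) : N%:Z <= d -> hwproj p (u @[c] (hwproj (m + k) (v @[d] x))) = 0.
  by move=> Nd; rewrite HN // (hwproj0 Yh Vsp) linear0 (hwproj0 Yh Vsp).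
rewrite [RHS](fsumE (@twist_vanish _ _ _ (fun a b =>
  hwproj p (u @[a] (hwproj (m + k) (v @[b] x)))) N%:Z a b H0)).
by apply: eq_bigr => j _; rewrite (hwproj_mode_schur _ _ _ _ _ Hu).
Qed.

(* [omega - sugawara] acts on the multiplicity spaces as a translation operator
   for the projected modes, twisted by the pairing of the weights. *)
Lemma hwproj_translation l m k u v (n : int) :
  mult_space Y h l u -> mult_space Y h m v ->
  cosetw @[0] (hwproj k (u @[n] v)) - hwproj k (u @[n] (cosetw @[0] v)) =
  - (n%:~R + wt_form B l m) *: hwproj k (u @[n - 1] v).
Proof.
move=> Hu Hv; rewrite -(hwproj_coset Yh Vsp) -(hwprojB Yh Vsp).
have -> : cosetw @[0] (u @[n] v) - u @[n] (cosetw @[0] v) = (cosetw @[0] u) @[n] v.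
  have [N HN] := mode_truncN Y cosetw u.
  rewrite (@mode_comm _ _ _ _ _ N.+1 _ 0 n) => [|j Nj]; last by apply: HN; lia.
  rewrite big_ord_recl big1 => [|j _]; last by rewrite lift0 zbin0 scale0r.
  rewrite zbin0r scale1r addr0.
  by have -> : 0 + n - (ord0 : 'I_N.+1)%:Z = n by rewrite /=; lia.
have [s0 _] := sugawara_hw Yh Hu.
rewrite [X in mode Y X n v]modeBl s0 modeBl mode_transl (hwprojB Yh Vsp) (hwprojZ Yh Vsp).
rewrite opprD scalerDl scaleNr; congr (_ + _).
(* In the iterate formula for h_i(-1) u, creation operators in front are projected away and positive
   modes kill [v]; only the zero mode on [v] remains. *)
have wE (i : 'I_r) : hwproj k (((h i) @[-1] u) @[n] v) =
    (m 0 i)%:C%C *: hwproj k (u @[n - 1] v).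
  have [N HN] := mode_iterate Y 0 (h i) u n v.
  have := HN N.+1 (leqnSn N).
  have -> : -1 - 0%:Z = -1 by [].
  move=> ->; rewrite (hwproj_sum Yh Vsp) big_ord_recl big1 ?addr0 => [|p _]; last first.
    rewrite lift0 (mult_space_mode _ Hv) // linear0 scaler0 addr0.
    rewrite (hwprojZ Yh Vsp); have -> : -1 - p.+1%:Z = - p.+2%:Z by lia.
    by rewrite (hwproj_neg Yh Vsp) scaler0.
  rewrite bin0 scale1r expr0 scale1r (hwprojD Yh Vsp).
  rewrite -[-1]/(- 1%:Z) (hwproj_neg Yh Vsp) add0r.
  by rewrite (mult_space_mode _ Hv) //= linearZ /= (hwprojZ Yh Vsp).
rewrite /wt_mode mode_suml (hwproj_sum Yh Vsp) /wt_form scaleNr scaler_suml.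
congr (- _); apply: eq_bigr => i _.
by rewrite modeZl (hwprojZ Yh Vsp) wE scalerA.
Qed.

End ProjectedModes.

(** * The vertex operator algebra on the multiplicity spaces *)

Section BilinearExtension.
Variables (R : realType) (r : nat) (B : 'M[R[i]]_r).
Variables (V : lmodType R[i]) (Y : voa V) (h : 'I_r -> V).
Hypotheses (Yh : heisenberg Y B h) (Vsp : fock_spanned Y h).
Implicit Types (l m k : 'rV[R]_r) (u v x y : V).

Local Notation "a @[ n ] b" := (mode Y a n b)
  (at level 9, n at level 99, b at level 9, format "a @[ n ]  b").
Local Notation hwproj := (hwproj B Y h).

Definition hwsupp v : seq 'rV[R]_r :=
  undup (xget [::] [set s : seq 'rV[R]_r | forall l, l \notin s -> hwproj l v = 0]).

Lemma hwsuppP v l : l \notin hwsupp v -> hwproj l v = 0.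
Proof.
rewrite mem_undup; move: l.
exact: (@xgetPex _ [::] [set s : seq 'rV[R]_r | forall l, l \notin s -> hwproj l v = 0])
  (hwproj_support Yh Vsp v).
Qed.

(** Linear extension of a family of maps that depends on the weight of its argument. It is total on
    V because the projections are. *)
Definition glue (F : 'rV[R]_r -> V -> V) v :=
  \sum_(l <- hwsupp v) F l (hwproj l v).

Lemma sum_seq_sub (I : eqType) (s t : seq I) (F : I -> V) : uniq s -> uniq t ->
  {subset s <= t} -> (forall i, i \notin s -> F i = 0) ->
  \sum_(i <- t) F i = \sum_(i <- s) F i.
Proof.
move=> us ut st F0; rewrite (bigID (fun i => i \in s)) /= [X in _ + X]big1 ?addr0 //.
rewrite -big_filter; apply: perm_big; apply: uniq_perm; rewrite ?filter_uniq //.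
by move=> i; rewrite mem_filter andb_idr // => /st.
Qed.

Lemma glueE F v (s : seq 'rV[R]_r) : uniq s ->
  (forall l, l \notin s -> hwproj l v = 0) -> (forall l, F l 0 = 0) ->
  glue F v = \sum_(l <- s) F l (hwproj l v).
Proof.
move=> us sv F0; pose t := undup (s ++ hwsupp v).
have ut : uniq t := undup_uniq _.
rewrite /glue -(@sum_seq_sub _ _ t) ?undup_uniq //; first 1 last.
- by move=> l ls; rewrite mem_undup mem_cat ls orbT.
- by move=> l /hwsuppP ->.
apply: sum_seq_sub => // [l ls|l /sv -> //].
by rewrite mem_undup mem_cat ls.
Qed.

Lemma glue_linear F : (forall l, linear (F l)) -> linear (glue F).
Proof.
move=> lF a x y.
have F0 l : F l 0 = 0.
  by have /= := lF l (-1) 0 0; rewrite scaler0 addr0 scaleN1r addNr.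
pose s := undup (hwsupp x ++ hwsupp y).
have us : uniq s := undup_uniq _.
have sx l : l \notin s -> hwproj l x = 0.
  by rewrite mem_undup mem_cat negb_or => /andP[/hwsuppP].
have sy l : l \notin s -> hwproj l y = 0.
  by rewrite mem_undup mem_cat negb_or => /andP[_ /hwsuppP].
rewrite !(@glueE F _ s) // => [|l ls]; last first.
  by rewrite (hwprojD Yh Vsp) (hwprojZ Yh Vsp) sx ?sy // scaler0 addr0.
rewrite scaler_sumr -big_split; apply: eq_bigr => l _ /=.
by rewrite (hwprojD Yh Vsp) (hwprojZ Yh Vsp) lF.
Qed.

Lemma glue_hw F l v : (forall m, F m 0 = 0) -> mult_space Y h l v -> glue F v = F l v.
Proof.
move=> F0 Hv; rewrite (@glueE F v [:: l]) ?big_seq1 ?(hwproj_id Yh Vsp) //.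
by move=> m; rewrite inE => ml; apply: (hwproj_other Yh Vsp Hv); rewrite eq_sym.
Qed.

Lemma glue_linear_fun a F G v :
  glue (fun l x => a *: F l x + G l x) v = a *: glue F v + glue G v.
Proof. by rewrite /glue scaler_sumr -big_split. Qed.

Variable eps : 'rV[R]_r -> 'rV[R]_r -> R[i].

(** On pairs with a non-integral form the value is the default 0, so that the modes below are
    total. *)
Definition pairing l m : int := xget 0 [set k | wt_form B l m = k%:~R].

(* On highest-weight vectors, [Y(e^l, z) e^m] has leading coefficient
   [eps l m *: e (l + m)] at z^(l, m), so this is the n-th mode of the operator E
   with Y(u, z) v = Y(e^l, z) e^m (x) E(u, z) v. *)
Definition hwmode n l m u v :=
  (eps l m)^-1 *: hwproj (l + m) (u @[n - pairing l m] v).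

Definition cosmode u (n : int) v :=
  glue (fun l x => glue (fun m y => hwmode n l m x y) v) u.

Lemma hwmode_linearl n l m v : linear (fun u => hwmode n l m u v).
Proof.
move=> a x y; rewrite /hwmode modeDl modeZl (hwprojD Yh Vsp) (hwprojZ Yh Vsp).
by rewrite scalerDr !scalerA mulrC.
Qed.

Lemma hwmode_linearr n l m u : linear (hwmode n l m u).
Proof.
move=> a x y; rewrite /hwmode linearP /= (hwprojD Yh Vsp) (hwprojZ Yh Vsp).
by rewrite scalerDr !scalerA mulrC.
Qed.

Lemma cosmode_linearl n v : linear (fun u => cosmode u n v).
Proof.
move=> a x y; apply: glue_linear => l {}a {}x {}y.
rewrite -glue_linear_fun; apply: eq_bigr => m _.
exact: hwmode_linearl.
Qed.

Lemma cosmode_linearr u n : linear (cosmode u n).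
Proof.
move=> a x y; rewrite /cosmode -glue_linear_fun; apply: eq_bigr => l _.
exact: (glue_linear (fun m => hwmode_linearr n l m _)).
Qed.

Lemma cosmode_hw l m u n v : mult_space Y h l u -> mult_space Y h m v ->
  cosmode u n v = hwmode n l m u v.
Proof.
move=> Hu Hv; have lin0 (f : V -> V) : linear f -> f 0 = 0.
  by move=> lf; have /= := lf (-1) 0 0; rewrite scaler0 addr0 scaleN1r addNr.
have r0 k x p : hwmode n k p x 0 = 0 by exact: (lin0 _ (hwmode_linearr n k p x)).
rewrite /cosmode (glue_hw (l := l)) ?(glue_hw (l := m)) // => k.
rewrite /glue big1 // => p _.
exact: (lin0 _ (hwmode_linearl n k p _)).
Qed.

Lemma cosmode_in l m u n v : mult_space Y h l u -> mult_space Y h m v ->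
  mult_space Y h (l + m) (cosmode u n v).
Proof.
move=> Hu Hv; rewrite (cosmode_hw _ Hu Hv) /hwmode -[_ *: _]addr0.
by apply: mult_space_lin; [exact: (hwproj_in Yh Vsp)|exact: mult_space0].
Qed.

End BilinearExtension.

(** * The axioms for the glued modes *)

Section CosetAlgebra.
Variables (R : realType) (r : nat) (B : 'M[R[i]]_r).
Variables (V : lmodType R[i]) (Y : voa V) (h : 'I_r -> V).
Variables (E : {pred 'rV[R]_r}) (eps : 'rV[R]_r -> 'rV[R]_r -> R[i]).
Hypotheses (Yh : heisenberg Y B h) (Vsp : fock_spanned Y h).
Hypothesis Ezmod : zmod_closed E.
Hypothesis Eeven : {in E, forall l, exists k : int, wt_form B l l = (2 * k)%:~R}.
Hypothesis eps_unit : {in E, forall l, eps 0 l = 1 /\ eps l 0 = 1}.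
Hypothesis eps_cocycle : {in E & &, forall l m n,
  eps l m * eps (l + m) n = eps m n * eps l (m + n)}.
Hypothesis eps_comm : {in E &, forall l m (k : int), wt_form B l m = k%:~R ->
  eps l m = (-1) ^+ `|k|%N * eps m l}.
Implicit Types (l m k : 'rV[R]_r) (u v x y : V).

Local Notation "a @[ n ] b" := (mode Y a n b)
  (at level 9, n at level 99, b at level 9, format "a @[ n ]  b").
Local Notation hwproj := (hwproj B Y h).
Local Notation pairing := (pairing B).
Local Notation cosmode := (cosmode B Y h eps).
Local Notation hwmode := (hwmode B Y h eps).
Local Notation cosetw := (omega Y - sugawara Y B h).
Local Notation ES := (span (\bigcup_(l in [set` E]) mult_space Y h l)).

Lemma lattice0 : 0 \in E. Proof. by case: Ezmod. Qed.

Lemma latticeD l m : l \in E -> m \in E -> l + m \in E.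
Proof.
case: Ezmod => E0 EB lE mE.
by rewrite -[m]opprK -[- m]sub0r; apply: (EB) => //; exact: EB.
Qed.

(** Polarization: an even lattice is integral. *)
Lemma pairing_int l m : l \in E -> m \in E -> exists k : int, wt_form B l m = k%:~R.
Proof.
move=> lE mE; have [a Ha] := Eeven lE; have [b Hb] := Eeven mE.
have [c Hc] := Eeven (latticeD lE mE); exists (c - a - b).
have two : (2 : R[i]) != 0 by rewrite pnatr_eq0.
have sym l1 l2 := wt_formC l1 l2 (invgram_sym Yh).
apply: (mulfI two); have := Hc.
rewrite wt_formDl ![wt_form B _ (l + m)]sym !wt_formDl Ha Hb (sym m l) !intrM !rmorphB /=.
rewrite !mulrBr => <-.
ring.
Qed.

Lemma pairingP l m : l \in E -> m \in E -> wt_form B l m = (pairing l m)%:~R.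
Proof.
move=> lE mE; rewrite /pairing.
exact: (@xgetPex _ 0 [set k : int | wt_form B l m = k%:~R] (pairing_int lE mE)).
Qed.

Lemma pairingC l m : l \in E -> m \in E -> pairing l m = pairing m l.
Proof.
move=> lE mE; apply: (@intr_inj R[i]).
by rewrite -!pairingP //; exact: wt_formC (invgram_sym Yh).
Qed.

Lemma pairingDl l m k : l \in E -> m \in E -> k \in E ->
  pairing (l + m) k = pairing l k + pairing m k.
Proof.
move=> lE mE kE; apply: (@intr_inj R[i]).
by rewrite rmorphD /= -!pairingP ?latticeD // wt_formDl.
Qed.

Lemma pairingDr l m k : l \in E -> m \in E -> k \in E ->
  pairing k (l + m) = pairing k l + pairing k m.
Proof.
by move=> lE mE kE; rewrite !(pairingC kE) ?latticeD // pairingDl.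
Qed.

Lemma pairing0l l : l \in E -> pairing 0 l = 0.
Proof.
move=> lE; apply: (@intr_inj R[i]).
by rewrite -pairingP ?lattice0 // wt_form0l.
Qed.

Lemma mem_ES l x : l \in E -> mult_space Y h l x -> x \in ES.
Proof. by move=> lE Hx; apply: mem_span; exists l. Qed.

Lemma ES_lin a x y : x \in ES -> y \in ES -> a *: x + y \in ES.
Proof. by have [_] := span_submod_closed (\bigcup_(l in [set` E]) mult_space Y h l); apply. Qed.

Lemma ES0 : 0 \in ES.
Proof. by have [] := span_submod_closed (\bigcup_(l in [set` E]) mult_space Y h l). Qed.

Lemma ES_ind (Q : V -> Prop) : Q 0 ->
  (forall a x y, Q x -> Q y -> Q (a *: x + y)) ->
  (forall l x, l \in E -> mult_space Y h l x -> Q x) -> forall v, v \in ES -> Q v.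
Proof.
move=> Q0 QD QE; apply: span_ind => // x [l /= lE Hx]; exact: QE lE Hx.
Qed.

Let clinl n v := cosmode_linearl Yh Vsp eps n v.
Let clinr u n := cosmode_linearr Yh Vsp eps u n.

Lemma cosmode0l n v : cosmode 0 n v = 0.
Proof.
by have /= := clinl n v (-1) 0 0; rewrite scaler0 addr0 scaleN1r addNr.
Qed.

Lemma cosmode0r u n : cosmode u n 0 = 0.
Proof.
by have /= := clinr u n (-1) 0 0; rewrite scaler0 addr0 scaleN1r addNr.
Qed.

Lemma cosmode_ES u n v : u \in ES -> v \in ES -> cosmode u n v \in ES.
Proof.
move=> uS; move: v; apply: ES_ind => [|a x y Hx Hy|m v mE Hv].
- by rewrite cosmode0r ES0.
- by rewrite clinr ES_lin.
move: u uS; apply: ES_ind => [|a x y Hx Hy|l u lE Hu].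
- by rewrite cosmode0l ES0.
- by rewrite clinl ES_lin.
- exact: (mem_ES (latticeD lE mE) (cosmode_in Yh Vsp eps n Hu Hv)).
Qed.

Lemma cosmode_trunc u v : u \in ES -> v \in ES ->
  exists N : int, forall n, N <= n -> cosmode u n v = 0.
Proof.
move=> uS; move: v; apply: ES_ind => [|a x y [N HN] [M HM]|m v mE Hv].
- by exists 0 => n _; rewrite cosmode0r.
- exists (Num.max N M) => n; rewrite ge_max => /andP[Nn Mn].
  by rewrite clinr HN // HM // scaler0 addr0.
move: u uS; apply: ES_ind => [|a x y [N HN] [M HM]|l u lE Hu].
- by exists 0 => n _; rewrite cosmode0l.
- exists (Num.max N M) => n; rewrite ge_max => /andP[Nn Mn].
  by rewrite clinl HN // HM // scaler0 addr0.
have [N HN] := voa_trunc Y u v; exists (N + pairing l m) => n Nn.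
rewrite (cosmode_hw Yh Vsp eps n Hu Hv) /hwmode HN; last by rewrite lerBrDr.
by rewrite (hwproj0 Yh Vsp) scaler0.
Qed.

Lemma commutant_mode m c n x : mult_space Y h 0 c -> mult_space Y h m x ->
  mult_space Y h m (c @[n] x).
Proof.
move=> Hc Hx; split=> [|i p]; first by rewrite -[m]add0r; apply: (hw_wt _ Hc); case: Hx.
rewrite (heis_hw _ _ _ _ Hc) (mult_space_mode _ Hx) // mxE scale0r addr0.
exact: linear0.
Qed.

(** In weight 0 the shift and the cocycle are trivial, and c_n x is already a highest-weight vector,
    which the projection fixes. *)
Lemma cosmode_commutant c n x : mult_space Y h 0 c -> x \in ES ->
  cosmode c n x = c @[n] x.
Proof.
move=> Hc; move: x; apply: ES_ind => [|a x y Hx Hy|m x mE Hx].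
- by rewrite cosmode0r linear0.
- by rewrite clinr Hx Hy linearP.
rewrite (cosmode_hw Yh Vsp eps n Hc Hx) /hwmode pairing0l // subr0 add0r.
have [-> _] := eps_unit mE; rewrite invr1 scale1r (hwproj_id Yh Vsp) //.
exact: commutant_mode.
Qed.

(** The bound on n matters: already u_(-2) vac = T u contains l(-1) u in addition to its coset part,
    and the projection removes it. *)
Lemma cosmode_vac u n : u \in ES -> -1 <= n -> cosmode u n (vac Y) = u @[n] (vac Y).
Proof.
move=> uS n1; move: u uS; apply: ES_ind => [|a x y Hx Hy|l x lE Hx].
- by rewrite cosmode0l mode0l.
- by rewrite clinl Hx Hy modeDl modeZl.
rewrite (cosmode_hw Yh Vsp eps n Hx (mult_space_vac Y h)) /hwmode.
rewrite pairingC ?lattice0 // pairing0l // subr0 addr0.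
have [_ ->] := eps_unit lE; rewrite invr1 scale1r (hwproj_id Yh Vsp) //.
have [->|n0] := eqVneq n (-1); first by rewrite voa_create.
by rewrite voa_creation; [exact: mult_space0|lia].
Qed.

Lemma cosmode_translation u n v : u \in ES -> v \in ES ->
  cosetw @[0] (cosmode u n v) - cosmode u n (cosetw @[0] v) =
  - n%:~R *: cosmode u (n - 1) v.
Proof.
move=> uS; move: v; apply: ES_ind => [|a x y Hx Hy|m v mE Hv].
- by rewrite !linear0 !cosmode0r linear0 subr0 scaler0.
- rewrite !clinr !linearP /= clinr opprD addrACA -scalerBr.
  by rewrite Hx Hy.
move: u uS; apply: ES_ind => [|a x y Hx Hy|l u lE Hu].
- by rewrite !cosmode0l linear0 subr0 scaler0.
- rewrite !clinl linearP /= opprD addrACA -scalerBr Hx Hy.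
  by rewrite scalerDr !scalerA [a * _]mulrC.
have Hv' := commutant_mode 0 (mult_space_coset Yh) Hv.
rewrite !(cosmode_hw Yh Vsp eps _ Hu Hv) (cosmode_hw Yh Vsp eps _ Hu Hv').
rewrite /hwmode linearZ -scalerBr /=.
(* The shift of the index by (l, m) cancels the (l, m) in the twisted translation rule. *)
rewrite (hwproj_translation Yh Vsp _ _ Hu Hv) pairingP // -rmorphD /= subrK.
by rewrite scalerA mulrC -scalerA [n - 1 - _]addrAC.
Qed.

Definition cosmode_local u v N := forall c, c \in ES ->
  iter N (@zw V) (fun a b => cosmode u a (cosmode v b c) - cosmode v b (cosmode u a c)) = 0.

Lemma cosmode_localW u v N M : (N <= M)%N -> cosmode_local u v N -> cosmode_local u v M.
Proof. by move=> NM HN c cS; rewrite -(subnK NM) iterD HN // iter_zw0. Qed.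

Lemma zw_linear_comb (f g : int -> int -> V) a N :
  iter N (@zw V) f = 0 -> iter N (@zw V) g = 0 ->
  iter N (@zw V) (fun p q => a *: f p q + g p q) = 0.
Proof.
move=> f0 g0; have -> : (fun p q => a *: f p q + g p q) = (fun p q => a *: f p q) - (- g).
  by rewrite opprK.
have -> : - g = 0 - g by rewrite sub0r.
rewrite !(iter_morphB _ (@zwB V)) iter_zwZ f0 g0 iter_zw0 !subr0.
by apply/funext => p; apply/funext => q; exact: scaler0.
Qed.

Lemma cosmode_local_linl u v w a N : cosmode_local u w N -> cosmode_local v w N ->
  cosmode_local (a *: u + v) w N.
Proof.
move=> Hu Hv c cS; have := zw_linear_comb a (Hu c cS) (Hv c cS).
congr (iter _ _ _ = _); apply/funext => p; apply/funext => q.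
by rewrite !clinl clinr opprD addrACA -scalerBr.
Qed.

Lemma cosmode_local_linr u v w a N : cosmode_local w u N -> cosmode_local w v N ->
  cosmode_local w (a *: u + v) N.
Proof.
move=> Hu Hv c cS; have := zw_linear_comb a (Hu c cS) (Hv c cS).
congr (iter _ _ _ = _); apply/funext => p; apply/funext => q.
by rewrite !clinl clinr opprD addrACA -scalerBr.
Qed.

Lemma cosmode_local_hw l m u v : l \in E -> m \in E ->
  mult_space Y h l u -> mult_space Y h m v -> exists N, cosmode_local u v N.
Proof.
move=> lE mE Hu Hv; have [N HN] := mode_comm_zw Y u v.
pose k := pairing l m; exists (N + `|k|)%N; apply: ES_ind => [|a x y Hx Hy|n x nE Hx].
- rewrite [X in iter _ _ X](_ : _ = 0) ?iter_zw0 //.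
  by apply/funext => p; apply/funext => q; rewrite !cosmode0r subrr.
- have := zw_linear_comb a Hx Hy.
  congr (iter _ _ _ = _); apply/funext => p; apply/funext => q.
  by rewrite !clinr opprD addrACA -scalerBr.
pose t := l + (m + n).
pose H1 a b := hwproj t (u @[a] (hwproj (m + n) (v @[b] x))).
pose H2 a b := hwproj t (v @[b] (hwproj (l + n) (u @[a] x))).
pose G1 a b := hwproj t (u @[a] (v @[b] x)).
pose G2 a b := hwproj t (v @[b] (u @[a] x)).
have H10 : eventually0 H1.
  have [M HM] := voa_trunc Y v x; exists M => a b Mb.
  by rewrite /H1 HM // (hwproj0 Yh Vsp) linear0 (hwproj0 Yh Vsp).
have H20 : eventually0 (swap H2).
  have [M HM] := voa_trunc Y u x; exists M => a b Mb.
  by rewrite /swap /H2 HM // (hwproj0 Yh Vsp) linear0 (hwproj0 Yh Vsp).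
have G1E : G1 = twist k%:~R H1.
  have -> : k%:~R = wt_form B m l by rewrite /k pairingC // -pairingP.
  exact: (hwproj_twist Yh Vsp t Hu Hv Hx).
have G2E : swap G2 = twist k%:~R (swap H2).
  have -> : k%:~R = wt_form B l m by rewrite /k -pairingP.
  exact: (hwproj_twist Yh Vsp t Hv Hu Hx).
have GN : iter N (@zw V) (G1 - G2) = 0.
  have -> : G1 - G2 = fun a b => hwproj t (u @[a] (v @[b] x) - v @[b] (u @[a] x)).
    by apply/funext => a; apply/funext => b; rewrite !fctE (hwprojB Yh Vsp).
  have iter_hwproj (f : int -> int -> V) d : iter d (@zw V) (fun a b => hwproj t (f a b)) =
      fun a b => hwproj t (iter d (@zw V) f a b).
    elim: d => //= d ->; apply/funext => a; apply/funext => b.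
    by rewrite /zw (hwprojB Yh Vsp).
  rewrite iter_hwproj HN; apply/funext => a; apply/funext => b.
  exact: (hwproj0 Yh Vsp).
have loc := twisted_locality H10 H20 G1E G2E GN.
(* These are the cocycle factors of u v x and v u x. The cocycle identity rewrites both through eps
   (l + m) n, so their ratio is eps l m / eps m l, the sign in [twisted_locality]. *)
pose c1 := (eps l (m + n) * eps m n)^-1.
pose c2 := (eps m (l + n) * eps l n)^-1.
have c12 : c2 = (-1) ^+ `|k|%N * c1.
  have kP : wt_form B l m = k%:~R by exact: pairingP.
  have e1 := eps_cocycle lE mE nE; have e2 := eps_cocycle mE lE nE.
  rewrite /c2 [eps m _ * _]mulrC -e2 /c1 [eps l _ * _]mulrC -e1.
  rewrite (eps_comm lE mE kP) [m + l]addrC -!mulrA [in RHS]invfM mulrA.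
  by rewrite -exprVn invrN1 -expr2 sqrr_sign mul1r.
pose D a b := H1 (a - k) b - (-1) ^+ `|k|%N *: H2 a (b - k).
rewrite [X in iter _ _ X](_ : _ = fun p q => c1 *: D (p + - pairing l n) (q + - pairing m n)).
  rewrite iter_zwZ; apply/funext => p; apply/funext => q.
  by rewrite iter_zw_shift loc; exact: scaler0.
apply/funext => p; apply/funext => q.
have Hvx b := cosmode_in Yh Vsp eps b Hv Hx.
have Hux a := cosmode_in Yh Vsp eps a Hu Hx.
rewrite (cosmode_hw Yh Vsp eps p Hu (Hvx q)) (cosmode_hw Yh Vsp eps q Hv (Hux p)).
rewrite (cosmode_hw Yh Vsp eps q Hv Hx) (cosmode_hw Yh Vsp eps p Hu Hx) /hwmode.
rewrite !linearZ /= !(hwprojZ Yh Vsp) !scalerA -!invfM -/c1 -/c2 /D scalerBr scalerA.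
(* Bilinearity splits the shift (l, m + n) into k, which the twist absorbs, and (l, n), a mere
   translation of the indices; likewise for (m, l + n). *)
rewrite [c1 * _]mulrC -c12 /H1 /H2 /t [m + (l + n)]addrCA !pairingDr // (pairingC mE lE) -/k.
have -> : p - (k + pairing l n) = p - pairing l n - k by rewrite opprD addrA addrAC.
have -> : q - (k + pairing m n) = q - pairing m n - k by rewrite opprD addrA addrAC.
by rewrite scalerN scalerA -invfM.
Qed.

Lemma cosmode_locality u v : u \in ES -> v \in ES -> exists N, cosmode_local u v N.
Proof.
move=> uS; move: v; apply: ES_ind => [|a x y [N HN] [M HM]|m v mE Hv].
- exists 0%N => c _; apply/funext => p; apply/funext => q /=.
  by rewrite !cosmode0l cosmode0r subrr.
- exists (maxn N M); apply: cosmode_local_linr.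
  + exact: cosmode_localW (leq_maxl _ _) HN.
  + exact: cosmode_localW (leq_maxr _ _) HM.
move: u uS; apply: ES_ind => [|a x y [N HN] [M HM]|l u lE Hu].
- exists 0%N => c _; apply/funext => p; apply/funext => q /=.
  by rewrite !cosmode0l cosmode0r subrr.
- exists (maxn N M); apply: cosmode_local_linl.
  + exact: cosmode_localW (leq_maxl _ _) HN.
  + exact: cosmode_localW (leq_maxr _ _) HM.
exact: cosmode_local_hw lE mE Hu Hv.
Qed.

End CosetAlgebra.

Section CosetVOA.
Variables (R : realType) (r : nat) (B : 'M[R[i]]_r).
Variables (V : lmodType R[i]) (Y : voa V) (h : 'I_r -> V).
Variables (E : {pred 'rV[R]_r}) (eps : 'rV[R]_r -> 'rV[R]_r -> R[i]).
Hypotheses (Yh : heisenberg Y B h) (Vsp : fock_spanned Y h).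
Hypothesis Ezmod : zmod_closed E.
Hypothesis Eeven : {in E, forall l, exists k : int, wt_form B l l = (2 * k)%:~R}.
Hypothesis eps_unit : {in E, forall l, eps 0 l = 1 /\ eps l 0 = 1}.
Hypothesis eps_cocycle : {in E & &, forall l m n,
  eps l m * eps (l + m) n = eps m n * eps l (m + n)}.
Hypothesis eps_comm : {in E &, forall l m (k : int), wt_form B l m = k%:~R ->
  eps l m = (-1) ^+ `|k|%N * eps m l}.

Local Notation cosmode := (cosmode B Y h eps).
Local Notation cosetw := (omega Y - sugawara Y B h).
Local Notation ES := (span (\bigcup_(l in [set` E]) mult_space Y h l)).
Local Notation W := (mult_sum Y h E).

Lemma val_lin (a : R[i]) (x y : W) : val (a *: x + y) = a *: val x + val y.
Proof. by []. Qed.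

Lemma val_sum (N : nat) (F : nat -> W) :
  val (\sum_(i < N) F i) = \sum_(i < N) val (F i).
Proof. by apply: (big_morph val) => [x y|]. Qed.

Definition cos_mode (u : W) n (v : W) : W :=
  SpanType (cosmode_ES eps Yh Vsp Ezmod n (span_valP u) (span_valP v)).

Definition cos_vac : W :=
  SpanType (mem_ES (lattice0 Ezmod) (mult_space_vac Y h)).

Definition cos_omega : W :=
  SpanType (mem_ES (lattice0 Ezmod) (mult_space_coset Yh)).

Lemma cos_modeE u n v : val (cos_mode u n v) = cosmode (val u) n (val v).
Proof. by []. Qed.

Let ES_val (u : W) : val u \in ES := span_valP u.

Lemma cos_omegaE n v : val (cos_mode cos_omega n v) = mode Y cosetw n (val v).
Proof.
rewrite cos_modeE /=.
exact: (cosmode_commutant Yh Vsp Ezmod Eeven eps_unit n (mult_space_coset Yh) (ES_val v)).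
Qed.

(** The projection commutes with omega_1, so it carries an eigenvector decomposition of x in V into
    C_l. There the coset L(0) differs from omega_1 by (l, l)/2, an integer because the lattice is
    even. *)
Lemma cos_grading (v : W) :
  v \in span [set w | exists n : int, cos_mode cos_omega 1 w = n%:~R *: w].
Proof.
set Z := [set w | _]; have [Z0 ZD] := span_submod_closed Z.
suff H : forall y, y \in ES -> exists2 w : W, val w = y & w \in span Z.
  by have [w /val_inj <-] := H _ (ES_val v).
apply: ES_ind => [|a x y [w <- wZ] [w' <- wZ']|l x lE Hx].
- by exists 0.
- by exists (a *: w + w') => //; exact: ZD.
suff H : forall y, y \in span [set w | exists n : int, mode Y (omega Y) 1 w = n%:~R *: w] ->
    exists2 w : W, val w = hwproj B Y h l y & w \in span Z.
  by have := H x (voa_grading Y x); rewrite (hwproj_id Yh Vsp).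
apply: span_ind => [|a y z [w wy wZ] [w' wz wZ']|y [n Hn]].
- by exists 0 => //; rewrite (hwproj0 Yh Vsp).
- exists (a *: w + w'); last exact: ZD.
  by rewrite val_lin wy wz (hwprojD Yh Vsp) (hwprojZ Yh Vsp).
have Hp := hwproj_in Yh Vsp l y.
exists (SpanType (mem_ES lE Hp)) => //; apply: mem_span.
have [k Hk] := Eeven lE; exists (n - k); apply: val_inj.
rewrite cos_omegaE /= modeBl -(hwproj_omega Yh Vsp) Hn (hwprojZ Yh Vsp).
have [_ ->] := sugawara_hw Yh Hp; rewrite Hk -scalerBl rmorphB /=.
by rewrite intrM [2%:~R * _]mulrC mulfK // pnatr_eq0.
Qed.

Lemma coset_voa : exists YE : voa W,
  [/\ val (vac YE) = vac Y, val (omega YE) = cosetw &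
      forall u n v, val (mode YE u n v) = cosmode (val u) n (val v)].
Proof.
have E1 : forall n (b : W), linear (fun a => cos_mode a n b).
  by move=> n b a x y; apply: val_inj; exact: (cosmode_linearl Yh Vsp eps n (val b) a).
have E2 : forall (a : W) n, linear (cos_mode a n).
  by move=> a n c0 x y; apply: val_inj; exact: (cosmode_linearr Yh Vsp eps (val a) n c0).
have E3 : forall a b : W, exists N : int, forall n, N <= n -> cos_mode a n b = 0.
  move=> a b; have [N HN] := cosmode_trunc eps Yh Vsp (ES_val a) (ES_val b).
  by exists N => n Nn; apply: val_inj; exact: HN.
have E4 : forall n (b : W), cos_mode cos_vac n b = if n == -1 then b else 0.
  move=> n b; apply: val_inj; rewrite cos_modeE.
  rewrite (cosmode_commutant Yh Vsp Ezmod Eeven eps_unit n (mult_space_vac Y h) (ES_val b)).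
  by rewrite voa_vacuum; case: ifP.
have E5 : forall (a : W) (n : int), 0 <= n -> cos_mode a n cos_vac = 0.
  move=> a n n0; apply: val_inj; rewrite cos_modeE.
  rewrite (cosmode_vac Yh Vsp Ezmod Eeven eps_unit (ES_val a)); last by lia.
  by rewrite voa_creation.
have E6 : forall a : W, cos_mode a (-1) cos_vac = a.
  move=> a; apply: val_inj; rewrite cos_modeE.
  rewrite (cosmode_vac Yh Vsp Ezmod Eeven eps_unit (ES_val a)) //.
  by rewrite voa_create.
have E7 : forall a b : W, exists N : nat, forall (m n : int) c,
    \sum_(i < N.+1) ((-1) ^+ i * 'C(N, i)%:R) *:
      (cos_mode a (m + N%:Z - i%:Z) (cos_mode b (n + i%:Z) c) -
       cos_mode b (n + i%:Z) (cos_mode a (m + N%:Z - i%:Z) c)) = 0.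
  move=> a b; have [N HN] := cosmode_locality Yh Vsp Ezmod Eeven eps_cocycle eps_comm
    (ES_val a) (ES_val b).
  exists N => m n c; apply: val_inj.
  have := congr1 (fun f => f m n) (HN (val c) (ES_val c)).
  rewrite zw_iterE => e; apply: etrans e.
  exact: (val_sum N.+1 (fun i => ((-1) ^+ i * 'C(N, i)%:R) *:
      (cos_mode a (m + N%:Z - i%:Z) (cos_mode b (n + i%:Z) c) -
       cos_mode b (n + i%:Z) (cos_mode a (m + N%:Z - i%:Z) c)))).
have E8 : forall (a : W) (n : int) b,
    cos_mode cos_omega 0 (cos_mode a n b) - cos_mode a n (cos_mode cos_omega 0 b) =
      - n%:~R *: cos_mode a (n - 1) b.
  move=> a n b; apply: val_inj.
  rewrite -[LHS]/(val (cos_mode cos_omega 0 (cos_mode a n b)) -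
    val (cos_mode a n (cos_mode cos_omega 0 b))).
  rewrite cos_omegaE [X in _ - X]cos_modeE cos_omegaE.
  exact: (cosmode_translation eps Yh Vsp Ezmod Eeven n (ES_val a) (ES_val b)).
have E9 : forall (m n : int) v,
    cos_mode cos_omega (m + 1) (cos_mode cos_omega (n + 1) v) -
    cos_mode cos_omega (n + 1) (cos_mode cos_omega (m + 1) v) =
      (m - n)%:~R *: cos_mode cos_omega (m + n + 1) v +
      (if m + n == 0 then
         (((m ^+ 3 - m)%:~R / 12%:R) * (ccharge Y - r%:R)) *: v else 0).
  move=> m n v; apply: val_inj.
  have := coset_virasoro Yh m n (val v).
  rewrite -!cos_omegaE => e.
  rewrite -[LHS]/(val (cos_mode cos_omega (m + 1) (cos_mode cos_omega (n + 1) v)) -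
    val (cos_mode cos_omega (n + 1) (cos_mode cos_omega (m + 1) v))) e val_lin.
  by case: ifP.
by exists (VOA E1 E2 E3 E4 E5 E6 E7 E8 E9 cos_grading).
Qed.

End CosetVOA.

(** * The tensor product formula *)

Section FockFunctional.
Variables (R : realType) (r : nat) (B : 'M[R[i]]_r).
Variables (W V : lmodType R[i]) (YW : voa W) (Y : voa V).
Variables (hW : 'I_r -> W) (h : 'I_r -> V).
Hypotheses (WH : heisenberg YW B hW) (VH : heisenberg Y B h).
Hypotheses (Wsp : fock_spanned YW hW) (Vsp : fock_spanned Y h).

(** A measure for induction: every product of d positive modes kills x. *)
Fixpoint depth (d : nat) (x : V) : Prop :=
  if d is d'.+1 then forall i (n : nat), depth d' (mode Y (h i) n.+1%:Z x) else x = 0.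

Lemma depth_lin d a x y : depth d x -> depth d y -> depth d (a *: x + y).
Proof.
elim: d x y => [|d IH] x y /=; first by move=> -> ->; rewrite scaler0 addr0.
by move=> Hx Hy i n; rewrite linearP; apply: IH; [exact: Hx|exact: Hy].
Qed.

Lemma depthS d x : depth d x -> depth d.+1 x.
Proof.
elim: d x => [|d IH] x Hx i n; first by rewrite Hx linear0.
exact: IH (Hx i n).
Qed.

Lemma depthW d d' x : (d <= d')%N -> depth d x -> depth d' x.
Proof.
move=> dd'; rewrite -(subnK dd'); elim: (d' - d)%N => // k IH /IH.
exact: depthS.
Qed.

Lemma depth_creation d j p x : depth d x ->
  depth d.+1 (mode Y (h j) (- p.+1%:Z) x).
Proof.
elim: d x => [|d IH] x Hx i n; first by rewrite Hx !linear0.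
change (depth d.+1 (mode Y (h i) n.+1%:Z (mode Y (h j) (- p.+1%:Z) x))).
rewrite (heis_comm VH) [X in depth _ X]addrC; apply: depth_lin => //.
exact: IH (Hx i n).
Qed.

Section Word.
Variables (l : 'rV[R]_r) (e : W) (u : V).
Hypotheses (We : mult_space YW hW l e) (Vu : mult_space Y h l u).
Local Notation word := (fock_word YW Y hW h u e).
Local Notation tensor := (fock_tensor YW Y hW h u e).

Lemma fock_word_depth f x : word f x -> exists d, depth d x.
Proof.
elim=> [|i n {}f {}x _ [d Hd]|a {}f {}x g y _ [d Hd] _ [d' Hd']].
- by exists 1%N => i n /=; case: Vu => _ ->.
- by exists d.+1; exact: depth_creation.
- exists (maxn d d'); apply: depth_lin.
  + exact: depthW (leq_maxl _ _) Hd.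
  + exact: depthW (leq_maxr _ _) Hd'.
Qed.

Lemma fock_word_hwproj f x : word f x ->
  exists c, hwproj B YW hW l f = c *: e /\ hwproj B Y h l x = c *: u.
Proof.
elim=> [|i n {}f {}x _ _|a {}f {}x g y _ [c [fc xc]] _ [d [gd yd]]].
- by exists 1; rewrite !scale1r (hwproj_id WH Wsp We) (hwproj_id VH Vsp Vu).
- by exists 0; rewrite !scale0r (hwproj_neg WH Wsp) (hwproj_neg VH Vsp).
- exists (a * c + d); rewrite (hwprojD WH Wsp) (hwprojD VH Vsp).
  by rewrite (hwprojZ WH Wsp) (hwprojZ VH Vsp) fc xc gd yd !scalerA -!scalerDl.
Qed.

Hypothesis e0 : e <> 0.

(** A form of the simplicity of Fock modules, making the graph single-valued. By induction on the
    depth, positive modes kill x, so x is its own projection c u; the other coordinate gives c e =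
    0, whence c = 0. *)
Lemma fock_tensor_inj x : tensor 0 x -> x = 0.
Proof.
move=> Hx; have [d Hd] := fock_word_depth (fock_tensor_word WH VH We Vu Hx).
elim: d x Hx Hd => // d IH x Hx Hd.
have Hu : mult_space Y h l x.
  split=> [|i n]; first exact: (fock_tensor_wt VH Vu Hx).
  apply: IH (Hd i n); rewrite -(linear0 (mode YW (hW i) n.+1%:Z)).
  exact: FockMode.
have [c []] := fock_word_hwproj (fock_tensor_word WH VH We Vu Hx).
rewrite (hwproj0 WH Wsp) (hwproj_id VH Vsp Hu) => /esym/eqP.
rewrite scaler_eq0 => /orP[/eqP -> -> |/eqP //]; exact: scale0r.
Qed.

Lemma fock_tensor_fun f x y : tensor f x -> tensor f y -> x = y.
Proof.
move=> fx fy; apply/eqP; rewrite -subr_eq0 addrC -scaleN1r; apply/eqP.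
apply: fock_tensor_inj; have := FockLinear (-1) fy fx.
by rewrite (_ : -1 *: f + f = 0) // scaleN1r addNr.
Qed.

(* The homomorphism of Fock modules sending e to u, extended by 0. *)
Definition fock_hom f : V := xget 0 [set x | tensor f x].

Lemma fock_homE f x : tensor f x -> fock_hom f = x.
Proof.
move=> fx; apply: (fock_tensor_fun _ fx).
by apply: (@xgetPex _ 0 [set x | tensor f x]); exists x.
Qed.

End Word.

Lemma fock_tensor_u0 e f x : fock_tensor YW Y hW h 0 e f x -> x = 0.
Proof.
elim=> // [i n {}f {}x _ ->|a {}f {}x g y _ -> _ ->]; first by rewrite linear0.
by rewrite scaler0 addr0.
Qed.

Lemma fock_tensor_schur l e u j : fock_tensor YW Y hW h u e
  (schur B YW hW l j e) (schur B Y h l j u).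
Proof.
elim/ltn_ind: j => -[|j] IH; first exact: FockTop.
have nz : (j.+1%:R : R[i]) != 0 by rewrite pnatr_eq0.
rewrite -[schur B YW hW l j.+1 e]scale1r -[schur B Y h l j.+1 u]scale1r.
rewrite -(mulVf nz) -!scalerA !schurS; apply: fock_tensorZ.
apply: (@fock_tensor_sum _ _ _ _ _ _ _ _ _ _ j.+1
  (fun p => wt_mode B YW hW l (- p.+1%:Z) (schur B YW hW l (j - p) e))
  (fun p => wt_mode B Y h l (- p.+1%:Z) (schur B Y h l (j - p) u))) => p.
rewrite /wt_mode; elim/big_rec2: _ => [|i x f _ fx]; first exact: fock_tensor0.
by apply: FockLinear => //; apply/FockMode/IH; rewrite ltnS leq_subr.
Qed.

End FockFunctional.

(** * Symmetric partial sums over the integers *)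

Section IntSum.
Variable V : zmodType.
Implicit Type z : int -> V.

Definition isum N z : V := \sum_(j < N.*2.+1) z (j%:Z - N%:Z).

Lemma isumS N z : isum N.+1 z = z (- N.+1%:Z) + isum N z + z N.+1%:Z.
Proof.
rewrite /isum doubleS big_ord_recl big_ord_recr /= addrA; congr (_ + _ + z _).
- by congr z; lia.
- by apply: eq_bigr => j _; congr z; rewrite /bump /=; lia.
- by rewrite /bump /=; lia.
Qed.

Lemma isum_widen N0 N z : (forall j : int, (N0 < `|j|)%N -> z j = 0) ->
  (N0 <= N)%N -> isum N z = isum N0 z.
Proof.
move=> z0; elim: N => [|N IH]; first by rewrite leqn0 => /eqP ->.
rewrite leq_eqVlt => /predU1P[-> //|]; rewrite ltnS => N0N.
by rewrite isumS !z0 ?addr0 ?add0r ?IH //; lia.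
Qed.

Lemma isum_interval (a : int) (M N : nat) z :
  (forall j : int, j < a \/ a + M%:Z <= j -> z j = 0) -> (`|a| + M <= N)%N ->
  isum N z = \sum_(j < M) z (a + j%:Z).
Proof.
move=> z0 aN; rewrite /isum; pose c := `|(a + N%:Z)%R|%N.
have cE : c%:Z = a + N%:Z by rewrite /c; lia.
rewrite -(big_mkord xpredT (fun j => z (j%:Z - N%:Z))).
rewrite (big_cat_nat (n := c)) //=; last by lia.
rewrite big_nat big1 ?add0r => [|j jc]; last by apply: z0; left; lia.
rewrite (big_cat_nat (n := (c + M)%N)) //=; [|by lia|by lia].
rewrite [X in _ + X]big_nat [X in _ + X]big1 ?addr0 => [|j jc]; last first.
  by apply: z0; right; lia.
rewrite -{1}[c]add0n big_addn addKn big_mkord; apply: eq_bigr => j _.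
by congr z; lia.
Qed.

Lemma uniform_bound (P : nat -> nat -> Prop) :
  (forall i N M, (N <= M)%N -> P i N -> P i M) -> (forall i, exists N, P i N) ->
  forall Q, exists N, forall i, (i < Q)%N -> P i N.
Proof.
move=> mono ex; elim=> [|Q [N HN]]; first by exists 0%N.
have [M HM] := ex Q; exists (maxn N M) => i; rewrite ltnS leq_eqVlt => /predU1P[->|iQ].
  exact: mono (leq_maxr _ _) HM.
exact: mono (leq_maxl _ _) (HN _ iQ).
Qed.

End IntSum.

Lemma schurZ (R : realType) (r : nat) (B : 'M[R[i]]_r) (V : lmodType R[i]) (Y : voa V)
  (h : 'I_r -> V) (l : 'rV[R]_r) j (t : R[i]) (x : V) :
  schur B Y h l j (t *: x) = t *: schur B Y h l j x.
Proof.
elim/ltn_ind: j => -[|j] IH //.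
have nz : (j.+1%:R : R[i]) != 0 by rewrite pnatr_eq0.
apply: (scalerI nz); rewrite schurS.
have scalerC (c1 c2 : R[i]) (y : V) : c1 *: (c2 *: y) = c2 *: (c1 *: y).
  by rewrite !scalerA mulrC.
rewrite scalerC schurS scaler_sumr.
by apply: eq_bigr => p _; rewrite IH ?linearZ // ltnS leq_subr.
Qed.

Lemma schur_at0 (R : realType) (r : nat) (B : 'M[R[i]]_r) (V : lmodType R[i]) (Y : voa V)
  (h : 'I_r -> V) (l : 'rV[R]_r) j : schur B Y h l j 0 = 0.
Proof. by have := schurZ B Y h l j 0 0; rewrite !scale0r. Qed.

(** * Propagating the tensor product formula from top vectors to Fock modules *)

Section Inherited.
Variables (R : realType) (r : nat) (B : 'M[R[i]]_r).
Variables (A V : lmodType R[i]) (YA : voa A) (Y : voa V).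
Variables (hA : 'I_r -> A) (h : 'I_r -> V).
Hypotheses (Ah : heisenberg YA B hA) (Vh : heisenberg Y B h).
Hypotheses (Asp : fock_spanned YA hA) (Vsp : fock_spanned Y h).
Variables (l m : 'rV[R]_r) (a b c : A) (u v : V) (s : R[i]) (k : int) (w : int -> V).
Hypotheses (Ha : mult_space YA hA l a) (Hb : mult_space YA hA m b).
Hypotheses (Hc : mult_space YA hA (l + m) c) (c0 : c <> 0).
Hypotheses (Hu : mult_space Y h l u) (Hv : mult_space Y h m v).
Hypothesis Hw : forall j, mult_space Y h (l + m) (w j).
(** The link between the two algebras: with the same scalar [s] and exponent [k] in both leading
    terms, the expansions in [schur] vectors agree. *)
Hypothesis leadA : forall n : int,
  hwproj B YA hA (l + m) (mode YA a n b) = if n == -1 - k then s *: c else 0.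
Hypothesis leadV : forall n : int,
  hwproj B Y h (l + m) (mode Y u n v) = s *: w (n + k).
Hypothesis w_trunc : exists J : int, forall j, J <= j -> w j = 0.

Implicit Types (f g : A) (x y : V).

Local Notation tensor j := (fock_tensor YA Y hA h (w j) c).
Local Notation hom j := (fock_hom YA Y hA h c (w j)).

Definition tensorable f := forall j, exists x, tensor j f x.

Let homE j f x (fx : tensor j f x) : hom j f = x :=
  fock_homE Ah Vh Asp Vsp Hc (Hw j) c0 fx.

Lemma homP j f : tensorable f -> tensor j f (hom j f).
Proof. by move=> /(_ j) [x fx]; rewrite (homE fx). Qed.

Lemma tensorable_lin t f g : tensorable f -> tensorable g -> tensorable (t *: f + g).
Proof.
by move=> df dg j; exists (t *: hom j f + hom j g); apply: FockLinear; exact: homP.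
Qed.

Lemma tensorable_mode i n f : tensorable f -> tensorable (mode YA (hA i) n f).
Proof. by move=> df j; exists (mode Y (h i) n (hom j f)); apply/FockMode/homP. Qed.

Lemma tensorable0 : tensorable 0.
Proof. by move=> j; exists 0; exact: fock_tensor0. Qed.

Lemma tensorable_sum (N : nat) (F : nat -> A) : (forall i, tensorable (F i)) ->
  tensorable (\sum_(i < N) F i).
Proof.
move=> FN; elim: N => [|N IH]; first by rewrite big_ord0; exact: tensorable0.
by rewrite big_ord_recr /= addrC -[F N]scale1r; exact: tensorable_lin.
Qed.

Lemma hom_lin j t f g : tensorable f -> tensorable g ->
  hom j (t *: f + g) = t *: hom j f + hom j g.
Proof. by move=> df dg; apply: homE; apply: FockLinear; exact: homP. Qed.

Lemma hom_mode j i n f : tensorable f -> hom j (mode YA (hA i) n f) = mode Y (h i) n (hom j f).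
Proof. by move=> df; apply: homE; apply/FockMode/homP. Qed.

Lemma hom0 j : hom j 0 = 0.
Proof. by apply: homE; exact: fock_tensor0. Qed.

Lemma hom_sum j (N : nat) (F : nat -> A) : (forall i, tensorable (F i)) ->
  hom j (\sum_(i < N) F i) = \sum_(i < N) hom j (F i).
Proof.
move=> FN; elim: N => [|N IH]; first by rewrite !big_ord0 hom0.
rewrite !big_ord_recr /= -IH addrC -[F N]scale1r hom_lin ?scale1r 1?addrC //.
exact: tensorable_sum.
Qed.

Lemma hom_w0 j f : w j = 0 -> hom j f = 0.
Proof.
move=> wj; rewrite /fock_hom; case: xgetP => // x _ /=; rewrite wj.
exact: fock_tensor_u0.
Qed.

(** The vector w j vanishes for large j, the mode of f for very negative j. The bound is uniform in
    n' >= n since the iterate formula runs through all n + p. *)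
Lemma hom_support f g (n : int) : exists N0 : nat, forall (n' j : int), n <= n' ->
  (N0 < `|j|)%N -> hom j (mode YA f (n' - 1 - j) g) = 0.
Proof.
have [J HJ] := w_trunc; have [M HM] := mode_truncN YA f g.
exists (`|J| + M + `|n| + 1)%N => n' j nn' Nj.
have [Jj|jJ] := leP J j; first by rewrite hom_w0 // HJ.
by rewrite HM ?hom0 //; lia.
Qed.

(* For x = f (x) u and y = g (x) v, the vector x_n y is the sum over j of
   f_(n-1-j) g (x) w j, where w j = u_j v. *)
Definition inherited f x g y :=
  (forall n, tensorable (mode YA f n g)) /\
  forall n, exists N0, forall N, (N0 <= N)%N ->
    mode Y x n y = isum N (fun j => hom j (mode YA f (n - 1 - j) g)).

Lemma inherited_hw : inherited a u b v.
Proof.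
have [MA HMA] := mode_truncN YA a b; have [MV HMV] := mode_truncN Y u v.
(* By [leadA], the expansion of a_n b has only the term with n + j = -1 - k. *)
have modeA (n : int) : mode YA a n b =
    if n <= -1 - k then s *: schur B YA hA l `|(-1 - k - n)%R|%N c else 0.
  have := hw_expansion Ah Asp Ha Hb HMA (M := (`|(MA%:Z - n)%R| + `|(-1 - k - n)%R|).+1) (n := n).
  move=> ->; last by lia.
  case: ifP => nk.
    have jM : (`|(-1 - k - n)%R| < (`|(MA%:Z - n)%R| + `|(-1 - k - n)%R|).+1)%N by lia.
    rewrite (bigD1 (Ordinal jM)) //= big1 ?addr0 => [|j].
      by rewrite leadA ifT ?schurZ //; lia.
    rewrite -val_eqE /= => jne; rewrite leadA ifF; last by lia.
    exact: schur_at0.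
  rewrite big1 // => j _; rewrite leadA ifF; last by lia.
  exact: schur_at0.
have tA (n : int) j : tensor j (mode YA a n b)
    (if n <= -1 - k then s *: schur B Y h l `|(-1 - k - n)%R|%N (w j) else 0).
  rewrite modeA; case: ifP => _; last exact: fock_tensor0.
  exact/fock_tensorZ/fock_tensor_schur.
split=> [n j|n]; first by eexists; exact: tA.
have [N0 HN0] := hom_support a b n.
pose M := `|(MV%:Z - n)%R|%N.
exists (maxn N0 (`|(n + k)%R| + M))%N => N; rewrite geq_max => /andP[NN0 NM].
rewrite (hw_expansion Vh Vsp Hu Hv HMV (M := M)); last by rewrite /M; lia.
have zE j : hom j (mode YA a (n - 1 - j) b) = if n + k <= j
    then s *: schur B Y h l `|(j - n - k)%R|%N (w j) else 0.
  rewrite (homE (tA _ j)); have -> : (n - 1 - j <= -1 - k) = (n + k <= j) by lia.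
  by have -> : -1 - k - (n - 1 - j) = j - n - k by lia.
have w0 j : n + k + M%:Z <= j -> s *: w j = 0.
  move=> Mj; have := leadV (j - k); rewrite subrK => <-.
  by rewrite HMV ?(hwproj0 Vh Vsp) //; rewrite /M in Mj; lia.
rewrite (@isum_interval _ (n + k) M) => [|j [jl|jr]|//].
- apply: eq_bigr => j _; rewrite zE ifT; last by lia.
  rewrite leadV schurZ; have -> : n + k + j%:Z - n - k = j%:Z by lia.
  by have -> : n + j%:Z + k = n + k + j%:Z by lia.
- by rewrite zE ifF //; lia.
- rewrite zE; case: ifP => // _; rewrite -schurZ w0 //.
  by rewrite schur_at0.
Qed.

(** As [a] and [u] have the same weight, commuting a Heisenberg mode past either gives the same
    correction. *)
Lemma inherited_right g y : fock_tensor YA Y hA h v b g y -> inherited a u g y.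
Proof.
elim=> [|i p {}g {}y _ [dg Hg]|t {}g {}y g' y' _ [dg Hg] _ [dg' Hg']].
- exact: inherited_hw.
- have modeA (n : int) : mode YA a n (mode YA (hA i) p g) =
      - (l 0 i)%:C%C *: mode YA a (n + p) g + mode YA (hA i) p (mode YA a n g).
    by rewrite (heis_hw _ _ _ _ Ha) [p + n]addrC scaleNr [RHS]addrC addrK.
  split=> [n|n].
    by rewrite modeA; apply: tensorable_lin; [exact: dg|exact/tensorable_mode/dg].
  have [N1 H1] := Hg n; have [N2 H2] := Hg (n + p).
  exists (maxn N1 N2) => N; rewrite geq_max => /andP[NN1 NN2].
  have -> : mode Y u n (mode Y (h i) p y) =
      - (l 0 i)%:C%C *: mode Y u (n + p) y + mode Y (h i) p (mode Y u n y).
    by rewrite (heis_hw _ _ _ _ Hu) [p + n]addrC scaleNr [RHS]addrC addrK.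
  rewrite (H1 _ NN1) (H2 _ NN2) /isum scaler_sumr linear_sum -big_split.
  apply: eq_bigr => j _ /=; rewrite modeA hom_lin ?hom_mode //; last exact/tensorable_mode/dg.
  by have -> : n + p - 1 - (j%:Z - N%:Z) = n - 1 - (j%:Z - N%:Z) + p by lia.
- split=> [n|n]; first by rewrite linearP; exact: tensorable_lin (dg n) (dg' n).
  have [N1 H1] := Hg n; have [N2 H2] := Hg' n.
  exists (maxn N1 N2) => N; rewrite geq_max => /andP[NN1 NN2].
  rewrite linearP /= (H1 _ NN1) (H2 _ NN2) /isum scaler_sumr -big_split.
  by apply: eq_bigr => j _ /=; rewrite linearP hom_lin //; [exact: dg|exact: dg'].
Qed.

(** Words in negative modes allow the iterate formula on both sides. The difficulty is to exchange
    its sum over p with the sum over j: j is bounded uniformly in p, then p uniformly over the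
    finitely many remaining j. *)
Lemma inherited_left f x : fock_word YA Y hA h u a f x ->
  forall g y, fock_tensor YA Y hA h v b g y -> inherited f x g y.
Proof.
elim=> [|i q {}f {}x _ IH|t {}f {}x f' x' _ IH _ IH'] g y Hg.
- exact: inherited_right.
- pose ca (p : nat) : R[i] := 'C(q + p, p)%:R.
  pose FA n (p : nat) := ca p *: (mode YA (hA i) (-1 - q%:Z - p%:Z) (mode YA f (n + p%:Z) g) +
     (-1) ^+ q *: mode YA f (n - 1 - q%:Z - p%:Z) (mode YA (hA i) p%:Z g)).
  have qE : - q.+1%:Z = -1 - q%:Z by lia.
  have IHp (p : nat) := IH _ _ (FockMode i p%:Z Hg).
  have [dg Hgn] := IH _ _ Hg.
  have dFA n p : tensorable (FA n p).
    rewrite /FA -[_ *: _]addr0; apply: tensorable_lin; last exact: tensorable0.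
    rewrite addrC; apply: tensorable_lin; last exact/tensorable_mode/dg.
    by case: (IHp p).
  split=> [n|n].
    have [N0 HN0] := mode_iterate YA q (hA i) f n g.
    by rewrite qE (HN0 _ (leqnn N0)); exact: (tensorable_sum N0 (dFA n)).
  have [Nz Hz] := hom_support f g n.
  have [Q HQ] := mode_truncN YA (hA i) g.
  (* Since h_i(p) g = 0 for p >= Q, only finitely many p need a bound of their own. *)
  have [Nzz Hzz] : exists N, forall p, (p < Q)%N -> forall j : int, (N < `|j|)%N ->
      hom j (mode YA f (n - 1 - q%:Z - p%:Z - 1 - j) (mode YA (hA i) p%:Z g)) = 0.
    apply: (@uniform_bound (fun p N => forall j : int, (N < `|j|)%N ->
      hom j (mode YA f (n - 1 - q%:Z - p%:Z - 1 - j) (mode YA (hA i) p%:Z g)) = 0)).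
      by move=> p N M NM H j Mj; apply: H; apply: leq_ltn_trans Mj.
    move=> p; have [N HN] := hom_support f (mode YA (hA i) p%:Z g) (n - 1 - q%:Z - p%:Z).
    by exists N => j; exact: HN.
  have zz0 p (j : int) : (Nzz < `|j|)%N ->
      hom j (mode YA f (n - 1 - q%:Z - p%:Z - 1 - j) (mode YA (hA i) p%:Z g)) = 0.
    move=> Nj; case: (ltnP p Q) => pQ; first exact: Hzz.
    by rewrite HQ ?linear0 ?hom0 //; lia.
  exists (maxn Nz Nzz) => N; rewrite geq_max => /andP[NzN NzzN].
  have X1 (p : nat) : mode Y x (n + p%:Z) y =
      isum N (fun j => hom j (mode YA f (n + p%:Z - 1 - j) g)).
    have [N1 HN1] := Hgn (n + p%:Z).
    rewrite (HN1 (maxn N N1)) ?leq_maxr //; apply: isum_widen (leq_maxl _ _) => j Nj.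
    by apply: Hz; [lia|apply: leq_ltn_trans Nj].
  have X2 (p : nat) : mode Y x (n - 1 - q%:Z - p%:Z) (mode Y (h i) p%:Z y) =
      isum N (fun j => hom j (mode YA f (n - 1 - q%:Z - p%:Z - 1 - j) (mode YA (hA i) p%:Z g))).
    have [_ /(_ (n - 1 - q%:Z - p%:Z)) [N1 HN1]] := IHp p.
    rewrite (HN1 (maxn N N1)) ?leq_maxr //; apply: isum_widen (leq_maxl _ _) => j Nj.
    by apply: zz0; apply: leq_ltn_trans Nj.
  (* With j confined to [-N, N], indexed by d = j + N, one truncation of the sum over p serves all
     terms. *)
  have [M HM] : exists M, forall d, (d < N.*2.+1)%N -> forall M', (M <= M')%N ->
      mode YA (mode YA (hA i) (- q.+1%:Z) f) (n - 1 - (d%:Z - N%:Z)) g =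
      \sum_(p < M') FA (n - 1 - (d%:Z - N%:Z)) p.
    apply: (@uniform_bound (fun d M => forall M', (M <= M')%N ->
      mode YA (mode YA (hA i) (- q.+1%:Z) f) (n - 1 - (d%:Z - N%:Z)) g =
      \sum_(p < M') FA (n - 1 - (d%:Z - N%:Z)) p)) => [d M1 M2 M12 H M' M'2|d].
      by apply: H; exact: leq_trans M'2.
    have [M0 H0] := mode_iterate YA q (hA i) f (n - 1 - (d%:Z - N%:Z)) g.
    by exists M0 => M' MM'; rewrite qE; exact: H0.
  have [M' HM'] := mode_iterate Y q (h i) x n y.
  pose P := maxn M M'.
  rewrite qE (HM' P) ?leq_maxr //.
  transitivity (\sum_(p < P) isum N (fun j => hom j (FA (n - 1 - j) p))).
    apply: eq_bigr => p _; rewrite X1 X2 /isum scaler_sumr linear_sum -big_split scaler_sumr.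
    apply: eq_bigr => j _ /=; move: (j%:Z - N%:Z) => j'.
    have [d1 _] := IHp p; rewrite /FA -[in RHS](addr0 (ca p *: _)).
    rewrite hom_lin ?hom0 ?addr0; [|rewrite addrC; apply: tensorable_lin|exact: tensorable0].
    - congr (_ *: _); rewrite [in RHS]addrC hom_lin; [|exact: d1|exact/tensorable_mode/dg].
      rewrite hom_mode // addrC.
      have -> : n + p%:Z - 1 - j' = n - 1 - j' + p%:Z by lia.
      by have -> : n - 1 - q%:Z - p%:Z - 1 - j' = n - 1 - j' - 1 - q%:Z - p%:Z by lia.
    - exact: d1.
    - exact/tensorable_mode/dg.
  rewrite /isum exchange_big; apply: eq_bigr => j _ /=.
  by rewrite -qE (HM j (ltn_ord j) P (leq_maxl _ _)) (hom_sum _ P (dFA _)).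
- have [dg Hgn] := IH _ _ Hg; have [dg' Hgn'] := IH' _ _ Hg.
  split=> [n|n]; first by rewrite modeDl modeZl; exact: tensorable_lin (dg n) (dg' n).
  have [N1 H1] := Hgn n; have [N2 H2] := Hgn' n.
  exists (maxn N1 N2) => N; rewrite geq_max => /andP[NN1 NN2].
  rewrite modeDl modeZl (H1 _ NN1) (H2 _ NN2) /isum scaler_sumr -big_split.
  by apply: eq_bigr => j _ /=; rewrite modeDl modeZl hom_lin.
Qed.

End Inherited.

(** * Leading terms of the lattice vertex operators *)

Section LatticeLeadingTerm.
Variables (R : realType) (r : nat) (B : 'M[R[i]]_r).

Lemma pow_coef0 (V : lmodType R[i]) (x : nat -> V -> V) m k :
  (forall p, x p.+1 0 = 0) -> pow_coef x m k 0 = 0.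
Proof.
move=> x0; elim: m k => [|m IH] k /=; first by case: ifP.
by rewrite big1 // => j _; rewrite IH x0 scaler0.
Qed.

Lemma exp_coef0 (V : lmodType R[i]) (x : nat -> V -> V) k :
  (forall p, x p.+1 0 = 0) -> exp_coef x k 0 = 0.
Proof. by move=> x0; rewrite /exp_coef big1 // => m _; rewrite pow_coef0 ?scaler0. Qed.

Lemma pow_coef_killed (V : lmodType R[i]) (x : nat -> V -> V) m k v :
  (forall p, x p.+1 0 = 0) -> (forall p, x p.+1 v = 0) ->
  pow_coef x m k v = if (m == 0%N) && (k == 0%N) then v else 0.
Proof.
move=> x0 xv; elim: m k => [|m IH] k //=.
by rewrite big1 // => j _; rewrite IH; case: ifP => _; rewrite ?xv ?x0 scaler0.
Qed.

Lemma exp_coef_killed (V : lmodType R[i]) (x : nat -> V -> V) k v :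
  (forall p, x p.+1 0 = 0) -> (forall p, x p.+1 v = 0) ->
  exp_coef x k v = if k == 0%N then v else 0.
Proof.
move=> x0 xv; rewrite /exp_coef big_ord_recl big1 => [|m _]; last first.
  by rewrite pow_coef_killed // scaler0.
by rewrite addr0 pow_coef_killed //= invr1 scale1r.
Qed.

Variables (V : lmodType R[i]) (Y : voa V) (h : 'I_r -> V).

Lemma fock_spanned_semisimple : heis_semisimple Y h -> fock_spanned Y h.
Proof.
move=> ss v; have [S0 SD] := span_submod_closed
  [set w | exists l u, mult_space Y h l u /\ heis_gen Y h u w].
move: v (ss v); apply: span_ind => [||x [l [M [[u [_ Hu ->]] Mx]]]].
- exact: S0.
- exact: SD.
- by apply: mem_span; exists l, u.
Qed.

Hypotheses (Yh : heisenberg Y B h) (Vsp : fock_spanned Y h).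

Lemma hwproj_exp_coef k l q v : mult_space Y h k v ->
  hwproj B Y h k (exp_coef (fun p => wt_mode B Y h l (- p%:Z)) q v) =
  if q == 0%N then v else 0.
Proof.
move=> Hv; rewrite /exp_coef (hwproj_sum Yh Vsp) big_ord_recl big1 => [|m _].
  rewrite addr0 /= invr1 scale1r; case: ifP => _; last exact: (hwproj0 Yh Vsp).
  exact: (hwproj_id Yh Vsp).
rewrite (hwprojZ Yh Vsp) lift0 /= (hwproj_sum Yh Vsp) big1 ?scaler0 // => j _.
by rewrite (hwprojZ Yh Vsp) (hwproj_wt_mode Yh Vsp) scaler0.
Qed.

End LatticeLeadingTerm.

Section LatticeVOA.
Variables (R : realType) (r : nat) (B : 'M[R[i]]_r) (E : {pred 'rV[R]_r}).
Variables (A : lmodType R[i]) (YA : voa A) (hA : 'I_r -> A).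
Variables (e : 'rV[R]_r -> A) (eps : 'rV[R]_r -> 'rV[R]_r -> R[i]).
Hypothesis lat : lattice_voa B E YA hA e eps.

Lemma fock_spanned_lattice : fock_spanned YA hA.
Proof.
move=> v; have [S0 SD] := span_submod_closed
  [set w | exists l u, mult_space YA hA l u /\ heis_gen YA hA u w].
move: v (lat_sum lat v); apply: span_ind => [||x [l /= lE Hx]].
- exact: S0.
- exact: SD.
- by apply: mem_span; exists l, (e l); have [_ ?] := lat_hw lat lE.
Qed.

(** The annihilation exponential fixes e^m, and the projection keeps only the constant term of the
    creation exponential. What is left is z^k, the coefficient at index -1 - k. *)
Lemma lattice_leading l m (k n : int) : l \in E -> m \in E -> wt_form B l m = k%:~R ->
  hwproj B YA hA (l + m) (mode YA (e l) n (e m)) =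
  if n == -1 - k then eps l m *: e (l + m) else 0.
Proof.
move=> lE mE lm; have Ah := lat_heis lat; have Asp := fock_spanned_lattice.
have [T [Te _ Tv]] := lat_vertex lat lE.
have [_ Hm] := lat_hw lat mE.
have [_ Hlm] := lat_hw lat (latticeD (lat_zmod lat) lE mE).
have gen : heis_gen YA hA (e m) (e m) by move=> M _.
have [N0 HN0] := Tv m mE k n (e m) lm gen.
have X0 p : wt_mode B YA hA l (- p.+1%:Z) 0 = 0 by rewrite linear0.
have inner j : exp_coef (fun p v => - wt_mode B YA hA l p%:Z v) j (e m) =
    if j == 0%N then e m else 0.
  apply: exp_coef_killed => p; first by rewrite linear0 oppr0.
  rewrite /wt_mode big1 ?oppr0 // => a _.
  by case: Hm => _ ->; rewrite scaler0.
rewrite (HN0 N0.+1 (leqnSn N0)) (hwproj_sum Ah Asp) big_mkcond big_ord_recl.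
rewrite big1 => [|j _]; last first.
  by case: ifP => // _; rewrite inner lift0 /= linear0 exp_coef0 ?(hwproj0 Ah Asp).
rewrite inner /= addr0 Te //; case: ifP => nk.
  rewrite (hwproj_exp_coef Ah Asp); last first.
    by rewrite -[_ *: _]addr0; apply: mult_space_lin Hlm _; exact: mult_space0.
  have -> : (`|(0%N%:Z - n - 1 - k)%R|%N == 0%N) = (n == -1 - k) by lia.
  by [].
by rewrite ifF //; lia.
Qed.

End LatticeVOA.

Theorem theorem4p1 (R : realType) (r : nat) (B : 'M[R[i]]_r)
  (V : lmodType R[i]) (Y : voa V) (h : 'I_r -> V)
  (E : {pred 'rV[R]_r})
  (A : lmodType R[i]) (YA : voa A) (hA : 'I_r -> A)
  (e : 'rV[R]_r -> A) (eps : 'rV[R]_r -> 'rV[R]_r -> R[i]) :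
  voa_simple Y ->
  heisenberg Y B h ->
  heis_semisimple Y h ->
  zmod_closed E ->
  [set` E] `<=` heis_weights Y h ->
  lattice_voa B E YA hA e eps ->
  exists YE : voa (mult_sum Y h E), natural_voa B YA hA e YE.
Proof.
move=> _ Yh ss Ezmod _ lat.
have Vsp := fock_spanned_semisimple ss.
have Ah := lat_heis lat; have Asp := fock_spanned_lattice lat.
have [YE [vacE omegaE modeE]] := coset_voa Yh Vsp Ezmod (lat_even lat)
  (lat_eps_unit lat) (lat_eps_cocycle lat) (lat_eps_comm lat).
exists YE; split=> // [c Hc|l m lE mE u v n Hu Hv|].
(* The generators [h i] lie in [heis_sub], so their nonnegative modes kill [c]. *)
- have c0 : mult_space Y h 0 c.
    by apply: mult_space0P => i n n0; apply: Hc => // U _; apply; exists i.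
  exists (SpanType (mem_ES (lattice0 Ezmod) c0)) => // n x.
  rewrite modeE; exact: (cosmode_commutant Yh Vsp Ezmod (lat_even lat)
    (lat_eps_unit lat) n c0 (span_valP x)).
- by rewrite modeE; exact: (cosmode_in Yh Vsp eps n Hu Hv).
move=> l m lE mE u v f x g y n Hu Hv Hf Hg.
have [_ Hel] := lat_hw lat lE; have [_ Hem] := lat_hw lat mE.
have [elm0 Helm] := lat_hw lat (latticeD Ezmod lE mE).
have form := pairingP Yh Ezmod (lat_even lat) lE mE.
have epsN0 := lat_eps_neq0 lat lE mE.
pose w j := val (mode YE u j v).
have Hw j : mult_space Y h (l + m) (w j).
  by rewrite /w modeE; exact: (cosmode_in Yh Vsp eps j Hu Hv).
(* The definition of [hwmode] solved for the projection; here eps l m must be nonzero. *)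
have leadV (p : int) : hwproj B Y h (l + m) (mode Y (val u) p (val v)) =
    eps l m *: w (p + pairing B l m).
  rewrite /w modeE (cosmode_hw Yh Vsp eps _ Hu Hv) /hwmode addrK.
  by rewrite scalerA mulfV // scale1r.
have w0 : exists J : int, forall j, J <= j -> w j = 0.
  by have [J HJ] := voa_trunc YE u v; exists J => j /HJ; rewrite /w => ->.
have [dom sumE] := inherited_left Ah Yh Asp Vsp Hel Hem Helm elm0 Hu Hv Hw
  (fun p => lattice_leading lat p lE mE form) leadV w0
  (fock_tensor_word Ah Yh Hel Hu Hf) Hg.
exists (fun j => fock_hom YA Y hA h (e (l + m)) (w j) (mode YA f (n - 1 - j) g)).
by split=> [j|]; [exact: (homP Ah Yh Asp Vsp Helm elm0 Hw)|exact: sumE].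
Qed.
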